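(* Let $H$ be a bipartite graph with $h$ vertices and $\ell$ edges that contains a cycle and is Erdős–Simonovits good. Let $A,\alpha$ be positive reals such that $\mathrm{ex}(n,H)\leq An^\alpha$ for every $n\in\mathbb{N}$. There exists a constant $C$ such that the following holds for all sufficiently large $n\in\mathbb{N}$ and all $k\in\mathbb{R}^+$ with \[k\leq n^{\frac{\phi(\alpha,H)}{\lambda^*(\alpha,H)-1}}/(\log n)^{\frac{2}{\lambda^*(\alpha,H)-1}}.\] Let $\mathcal{I}(n)$ be the set of all $H$-free graphs on $[n]$ and $\mathcal{G}(n,k)$ the set of all graphs on $[n]$ with at most $kn^\alpha$ edges. There exist a collection $\mathcal{S}$ of colored graphs with $n$ vertices and at most $Ck^{1-\lambda^*(\alpha,H)}n^\alpha$ edges, and functions $g:\mathcal{I}(n)\to\mathcal{S}$ and $h:\mathcal{S}\to\mathcal{G}(n,k)$ such that (a) for every $s\geq 1$, the number of colored graphs in $\mathcal{S}$ with $s$ edges is at most \[\left(\frac{Cn^\alpha}{s}\right)^{\frac{\lambda^*(\alpha,H)}{\lambda^*(\alpha,H)-1}\cdot s}\cdot\exp\left(Ck^{1-\lambda^*(\alpha,H)}n^\alpha\right);\] (b) for every $I\in\mathcal{I}(n)$, $g(I)\subseteq I\subseteq h(g(I))\cup g(I)$. Here $\phi(\alpha,H)=\frac{\alpha\ell-\alpha+h-2\ell}{\ell-1}$ and $\lambda^*(\alpha,H)=\frac{1}{m_2^*(H)(2-\alpha)}$.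
   Context: A colored graph is a graph together with a labelled partition of its edge set; containment refers to underlying edge sets. $\mathrm{ex}(n,H)$ is the maximum number of edges of an $H$-free $n$-vertex graph. The proper $2$-density is $m_2^*(H)=\max\{\frac{e(F)-1}{v(F)-2}: F\subsetneq H, v(F)>2\}$. A bipartite graph $H$ with $h$ vertices and $\ell$ edges is Erdős–Simonovits good (with respect to $\alpha$) if there exist constants $C',c>0$ such that for all sufficiently large $n$, every $n$-vertex graph $G$ with $e(G)>C'n^\alpha$ contains at least $c\,[e(G)]^{\ell}/n^{2\ell-h}$ copies of $H$.
   Formalization: The formal theorem also assumes α < 2: at α = 2 the quantity λ* is undefined, and for α > 2 the claim fails, since for tiny k both edge bounds drop below 1 and one-edge H-free graphs violate (b). *)

(* Defs.v *)
From mathcomp Require Import all_boot all_order all_algebra.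
From mathcomp Require Import finmap.
From mathcomp Require Import classical_sets reals sequences exp.
Set Implicit Arguments.
Unset Strict Implicit.
Unset Printing Implicit Defensive.
Import Order.TTheory GRing.Theory Num.Theory.
Local Open Scope ring_scope.

(* A finite simple graph with vertex set V is a set of two-element subsets
   of V; isolated vertices are therefore allowed. *)
Notation edge V := {e : {set V} | #|e| == 2%N}.
Notation graph V := {set edge V}.

Definition endpoints (V : finType) (e : edge V) : {set V} := val e.

(* A colored graph is a partial map from pairs to labels: its domain is the
   underlying edge set and the fibres of the labels are the labelled parts. *)
Notation colored_graph V := {ffun edge V -> option nat}.

Definition uncolor (V : finType) (J : colored_graph V) : graph V :=
  [set e | J e != None]%SET.

Definition adj (V : finType) (H : graph V) : rel V :=
  [rel x y | [set x; y]%SET \in [set endpoints e | e in H]%SET].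

Definition bipartite (V : finType) (H : graph V) : Prop :=
  exists X : {set V}, forall e, e \in H -> #|(endpoints e :&: X)%SET| = 1%N.

Definition has_cycle (V : finType) (H : graph V) : Prop :=
  exists2 s : seq V, (2 < size s)%N & ucycle (adj H) s.

(* A subgraph is recorded as its vertex set together with its edge set. *)
Definition subgraph (V : finType) (H : graph V) : {set {set V} * graph V} :=
  [set F : {set V} * graph V |
     (F.2 \subset H) && [forall e in F.2, endpoints e \subset F.1]]%SET.

(* Copies are unlabelled: subgraphs of G isomorphic to H, not embeddings. *)
Definition copies (V W : finType) (H : graph V) (G : graph W) :
    {set {set W} * graph W} :=
  [set F in subgraph G | [exists f : {ffun V -> W},
     [&& injectiveb f, (f @: [set: V])%SET == F.1 &
         [set f @: endpoints e | e in H]%SET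
           == [set endpoints e | e in F.2]%SET]]]%SET.

Definition is_free (V W : finType) (H : graph V) (G : graph W) : bool :=
  #|copies H G| == 0%N.

Definition turan (V : finType) (n : nat) (H : graph V) : nat :=
  \max_(G : graph 'I_n | is_free H G) #|G|.

(* The set is finite, so its supremum is a maximum as soon as H has a proper
   subgraph with more than two vertices. *)
Definition m2star (R : realType) (V : finType) (H : graph V) : R :=
  sup [set d : R | exists F : {set V} * graph V,
    [/\ F \in subgraph H, F <> ([set: V]%SET, H), (2 < #|F.1|)%N &
        d = (#|F.2|%:R - 1) / (#|F.1|%:R - 2)]]%classic.

Definition phi (R : realType) (V : finType) (alpha : R) (H : graph V) : R :=
  let h := #|V|%:R in let l := #|H|%:R in
  (alpha * l - alpha + h - 2 * l) / (l - 1).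

Definition lambdastar (R : realType) (V : finType) (alpha : R) (H : graph V) : R :=
  1 / (m2star R H * (2 - alpha)).

(* The exponent 2l - h is a real power since it may be negative when H has
   isolated vertices. *)
Definition ES_good (R : realType) (V : finType) (alpha : R) (H : graph V) : Prop :=
  exists C' c : R, [/\ 0 < C', 0 < c & exists n0 : nat,
    forall n : nat, (n0 <= n)%N -> forall G : graph 'I_n,
      C' * n%:R `^ alpha < #|G|%:R ->
      c * (#|G|%:R ^+ #|H| / n%:R `^ (2 * #|H|%:R - #|V|%:R))
        <= #|copies H G|%:R].

(* Main.v *)
(* Restricting a graph with k n^alpha edges to a random vertex set of density
   about k^(-1/(2-alpha)) leaves just enough edges for the supersaturation
   hypothesis to apply, while a subgraph F of H survives with probability
   k^(-v(F)/(2-alpha)).  Comparing the two shows that a family of copies of H which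
   is still too small can be enlarged while every set of j edges keeps degree at
   most of order |family| / e(G) * k^(-lambda (j-1)); the value
   lambda = 1 / (m2star (2-alpha)) is exactly what the densest proper F permits.

   Such a balanced family feeds a container algorithm that repeatedly picks a
   vertex of maximum degree of the independent set and passes to links.  Iterating
   it, the edge count drops geometrically, from n^2 to k n^alpha; the fingerprints
   have geometrically growing sizes, apart from a term n^(alpha-phi) per round,
   and the two logarithms lost in the bound on k pay for the O(log n) rounds.

   The exponents make sense only when lambda > 1.  Otherwise the extremal number of
   H would be of the order given by the deletion method for its 2-densest subgraph,
   which the locally tree-like structure of the copies in a sparse random graph
   refutes: a greedy process there beats deletion by any constant factor. *)
Require Import Defs.
From mathcomp Require Import all_boot all_order all_algebra.
From mathcomp Require Import finmap.
From mathcomp Require Import classical_sets boolp reals sequences exp.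
(* Shadow the homonyms of [classical_sets], such as [set0] and [subsetP]. *)
From mathcomp Require Import fintype finset.
From mathcomp Require Import ring lra zify.
Set Implicit Arguments.
Unset Strict Implicit.
Unset Printing Implicit Defensive.
Import Order.TTheory GRing.Theory Num.Theory.
Local Open Scope set_scope.
Local Open Scope ring_scope.

(** Fingerprints are not counted size by size during the iteration. What is bounded is the sum of
    z^|J| over all fingerprints J with z = k^(-lambda): it multiplies over rounds, stays below
    exp(O(k^(1-lambda) n^alpha)), and dividing it by z^s gives (a), where s <= C k^(1-lambda)
    n^alpha turns the power of k into the power of C n^alpha / s. Containers are used only for k
    above a constant and phi > 0; in the remaining cases the H-free graphs are few enough to be
    listed.

    That lambda > 1 is delicate because alpha may equal the deletion exponent, so the contradiction
    must come from the constant A. Let S be a subgraph of largest density mu with fewest edges, j of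
    them. In a random graph of density K n^(-1/mu), cleaned of the rare subgraphs denser than S,
    overlapping copies of S leave no slack in density, and the minimality of S then forbids short
    cycles of copies. Each edge lies in at most order K^(j-1) copies. Selecting every edge with
    probability M / K leaves it unblocked with probability bounded below independently of K, so K
    may be taken large and the surviving constant, of order M, is arbitrary. *)

Ltac pos := solve [repeat first
  [ done | by apply: ltW | apply: mulr_gt0 | apply: divr_gt0 | apply: exprn_gt0 | apply: addr_gt0
  | rewrite invr_gt0 | rewrite ltr0n | apply: powR_gt0 | apply: expR_gt0
  | apply: mulr_ge0 | apply: divr_ge0 | apply: exprn_ge0 | apply: addr_ge0
  | rewrite invr_ge0 | apply: powR_ge0 | apply: expR_ge0 | apply: ltW ]].

(** [pick] returns the first witness in the enumeration, so discarding other witnesses leaves it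
    unchanged. This tie-breaking keeps the algorithm consistent when the independent set shrinks. *)
Lemma pick_sub (T : finType) (P Q : pred T) (x : T) :
  [pick y | P y] = Some x -> (forall y, Q y -> P y) -> Q x ->
  [pick y | Q y] = Some x.
Proof.
rewrite /pick => Hx QP Qx.
have enumF (D : pred T) : enum D = filter D (enum T).
  by rewrite enumT.
move: Hx; rewrite (enumF P) (enumF Q); elim: (enum T) => //= y s IH.
case Py: (P y) => /=.
  by case=> yx; rewrite yx Qx.
move=> Hx; case Qy: (Q y); last exact: IH.
by rewrite (QP _ Qy) in Py.
Qed.

(** * Hypergraph containers *)

Section WeightedHypergraph.
Variables (R : realType) (T : finType).
Implicit Types (w : {set T} -> R) (U I J G S e f : {set T}).

Definition wdeg w U : R := \sum_(e : {set T} | U \subset e) w e.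
Definition wtot w : R := \sum_(e : {set T}) w e.
Definition windep w I := forall e, e \subset I -> w e = 0.

Section Link.
(* A state holds the vertices picked so far and their accumulated links.  A
   hyperedge stops being available once it contains a picked vertex or a set
   that is already saturated in the links. *)
Variables (w : {set T} -> R) (thr : {set T} -> R).

Definition state : Type := ({set T} * {ffun {set T} -> R})%type.

Definition avail (st : state) e :=
  [disjoint e & st.1] &&
  [forall U : {set T}, (U != set0) && (U \subset e) ==> (wdeg st.2 U < thr U)].

Definition adeg (st : state) u : R := \sum_(e | avail st e && (u \in e)) w e.

Definition picked I (st : state) : option T :=
  [pick u | (u \in I :\: st.1) &&
            [forall u' in I :\: st.1, adeg st u' <= adeg st u]].

Definition link_step I (st : state) : state :=
  if picked I st is Some v then
    (v |: st.1,
     [ffun f => st.2 f + (if (v \notin f) && avail st (v |: f)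
                          then w (v |: f) else 0)])
  else st.

Definition link_run I b : state := iter b (link_step I) (set0, [ffun => 0]).

Lemma link_runS I b : link_run I b.+1 = link_step I (link_run I b).
Proof. by []. Qed.

Hypothesis w_ge0 : forall e, 0 <= w e.

Lemma pickedP I st :
  match picked I st with
  | Some v => [/\ v \in I, v \notin st.1 &
               forall u, u \in I -> u \notin st.1 -> adeg st u <= adeg st v]
  | None => I \subset st.1
  end.
Proof.
rewrite /picked; case: pickP => /= [v /andP[]|none].
  rewrite inE => /andP[vS vI] /forall_inP H; split=> // u uI uS.
  by apply: H; rewrite inE uS.
apply/subsetP => u uI; apply/negPn/negP => uS.
have uD : u \in I :\: st.1 by rewrite inE uS.
pose v := [arg max_(v > u in I :\: st.1) adeg st v]%O.
have := none v; rewrite /v; case: Order.TotalTheory.arg_maxP => // v' v'D vmax.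
by rewrite v'D /= => /negP; apply; apply/forall_inP.
Qed.

Lemma link_run_sub I b : (link_run I b).1 \subset I.
Proof.
elim: b => [|b IH]; first by rewrite sub0set.
rewrite link_runS /link_step.
have := pickedP I (link_run I b); case: picked => [v [vI _ _]|_] //=.
by rewrite subUset sub1set vI.
Qed.

Lemma link_run_mono I b : (link_run I b).1 \subset (link_run I b.+1).1.
Proof.
by rewrite link_runS /link_step; case: picked => [v|] //=; rewrite subsetUr.
Qed.

Lemma card_link_run I b : (#|(link_run I b).1| <= b)%N.
Proof.
elim: b => [|b IH]; first by rewrite cards0.
rewrite link_runS /link_step; case: picked => [v|] /=; last exact: leqW.
by rewrite (leq_trans (leq_card_setU _ _)) // cards1 add1n.
Qed.

(** A maximiser over [I] that lies in the smaller set [J] is still a maximiser there and is picked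
    again. Hence a run depends only on the vertices it picks, which lets a fingerprint determine its
    container. *)
Lemma link_run_consistent I J b :
  (link_run I b).1 \subset J -> J \subset I -> link_run J b = link_run I b.
Proof.
elim: b => [//|b IH] SJ JI.
have E := IH (subset_trans (link_run_mono I b) SJ) JI.
rewrite !link_runS /link_step E -[picked J]/(picked J).
have := pickedP I (link_run I b).
move: SJ; rewrite link_runS /link_step.
case pI : (picked I (link_run I b)) => [v|] /=.
  move=> SJ [vI vS vmax].
  suff -> : picked J (link_run I b) = Some v by [].
  apply: pick_sub pI _ _.
    move=> u /andP[]; rewrite !inE => /andP[uS uJ] /forall_inP H.
    rewrite uS (subsetP JI) //=; apply/forall_inP => u'.
    rewrite inE => /andP[u'S u'I].
    apply: (le_trans (vmax _ u'I u'S)); apply: H.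
    by rewrite inE vS (subsetP SJ) // !inE eqxx.
  rewrite inE vS (subsetP SJ) ?inE ?eqxx //=.
  by apply/forall_inP => u; rewrite inE => /andP[uS /(subsetP JI) uI]; exact: vmax.
move=> _ IS.
have := pickedP J (link_run I b); case: picked => [v [vJ vS _]|] //.
by rewrite (subsetP IS) ?(subsetP JI) in vS.
Qed.

Lemma link_run_ge0 I b f : 0 <= (link_run I b).2 f.
Proof.
elim: b => [|b IH]; first by rewrite ffunE.
rewrite link_runS /link_step; case: picked => [v|] //=.
by rewrite ffunE addr_ge0 //; case: ifP.
Qed.

Lemma link_run_mono_w I b f : (link_run I b).2 f <= (link_run I b.+1).2 f.
Proof.
rewrite link_runS /link_step; case: picked => [v|] //=.
by rewrite ffunE lerDl; case: ifP.
Qed.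

Lemma link_run_supp I b f :
  (link_run I b).2 f != 0 ->
  exists v, [/\ v \in I, v \notin f & w (v |: f) != 0].
Proof.
elim: b => [|b IH]; first by rewrite ffunE eqxx.
rewrite link_runS /link_step.
have := pickedP I (link_run I b); case: picked => [v [vI _ _]|] //=.
rewrite ffunE; case: ifP => [/andP[vf _]|_]; last by rewrite addr0; exact: IH.
have [->|wv _] := eqVneq (w (v |: f)) 0; first by rewrite addr0; exact: IH.
by exists v.
Qed.

Lemma link_run_indep I b : windep w I -> windep (link_run I b).2 I.
Proof.
move=> wI f fI; apply/eqP/negPn/negP => /link_run_supp [v [vI _ /eqP]]; apply.
by apply: wI; rewrite subUset sub1set vI.
Qed.

Lemma sum_link v (P : pred {set T}) :
  \sum_(f : {set T}) (if (v \notin f) && P (v |: f) then w (v |: f) else 0) =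
  \sum_(e | P e && (v \in e)) w e.
Proof.
rewrite -big_mkcond /= [RHS](reindex_onto (fun e => v |: e) (fun e => e :\ v)) /=; last first.
  by move=> e /andP[_ ve]; rewrite setD1K.
apply: eq_bigl => f; rewrite setU11 andbT [RHS]andbC; congr (_ && _).
apply/idP/eqP => [vf|<-]; first by rewrite setU1K.
by rewrite !inE eqxx.
Qed.

Lemma wtot_step I st v : picked I st = Some v ->
  wtot (link_step I st).2 = wtot st.2 + adeg st v.
Proof.
move=> pv; rewrite /wtot /link_step pv /=.
under eq_bigr do rewrite ffunE.
by rewrite big_split /= sum_link.
Qed.

Lemma adeg_mono I b u :
  adeg (link_run I b.+1) u <= adeg (link_run I b) u.
Proof.
rewrite /adeg [leRHS](bigID (fun e => avail (link_run I b.+1) e)) /=.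
rewrite -[leLHS]addr0 lerD ?sumr_ge0 //.
rewrite le_eqVlt; apply/orP; left; apply/eqP/eq_bigl => e.
rewrite [RHS]andbAC; congr (_ && _); apply/idP/andP => [H|[]//]; split=> //.
case/andP: H => dis /forallP H; apply/andP; split.
  by apply: disjointWr dis; apply: link_run_mono.
apply/forallP => U; apply/implyP => HU.
apply: le_lt_trans (implyP (H U) HU).
by apply: ler_sum => f _; apply: link_run_mono_w.
Qed.

(** Each of the [b] picks added to the links a degree at least that of [u] at that moment, and
    available degrees only decrease. So light links force every unpicked element of [I] to have
    small available degree. *)
Lemma adeg_bound I b u : u \in I -> u \notin (link_run I b).1 ->
  b%:R * adeg (link_run I b) u <= wtot (link_run I b).2.
Proof.
elim: b u => [|b IH] u uI uS.
  by rewrite mul0r /wtot sumr_ge0 // => f _; rewrite ffunE.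
have uS' : u \notin (link_run I b).1.
  by apply: contra uS; apply/subsetP/link_run_mono.
have := pickedP I (link_run I b).
case pv : (picked I (link_run I b)) => [v|]; last first.
  by move/subsetP/(_ _ uI); rewrite (negPf uS').
case=> vI vS vmax; rewrite link_runS (wtot_step pv) -link_runS.
have le1 := adeg_mono I b u.
rewrite -natr1 mulrDl mul1r lerD //.
  by apply: le_trans (IH _ uI uS'); rewrite ler_wpM2l.
exact: le_trans (vmax _ uI uS').
Qed.

(** An edge with no saturated subset at the end had none earlier, since links only grow. It was
    therefore available when its first vertex was picked, and its whole weight entered the link at
    that step. *)
Lemma touched_bound I b :
  \sum_(e : {set T} | ~~ [disjoint e & (link_run I b).1] &&
      [forall U : {set T}, (U != set0) && (U \subset e) ==>
        (wdeg (link_run I b).2 U < thr U)]) w e <= wtot (link_run I b).2.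
Proof.
elim: b => [|b IH].
  rewrite big1; first by apply: sumr_ge0 => f _; rewrite ffunE.
  by move=> e; rewrite -setI_eq0 setI0 eqxx.
have pm := link_run_mono_w I b.
move: pm; rewrite link_runS => pm.
case pv : (picked I (link_run I b)) => [v|]; last by rewrite /link_step pv.
rewrite (wtot_step pv).
apply: le_trans (lerD IH (lexx _)).
rewrite /adeg [X in _ <= _ + X]big_mkcond [X in _ <= X + _]big_mkcond -big_split /=.
rewrite big_mkcond ler_sum // => e _.
case: ifP => [/andP[nd /forallP sat]|_]; last first.
  by rewrite addr_ge0 //; case: ifP.
have sat' : [forall U : {set T}, (U != set0) && (U \subset e) ==>
   (wdeg (link_run I b).2 U < thr U)].
  apply/forallP => U; apply/implyP => HU.
  apply: le_lt_trans (implyP (sat U) HU); by apply: ler_sum => f _.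
rewrite sat' andbT /avail sat' andbT.
case: (boolP [disjoint e & (link_run I b).1]) => /= [dis|_]; last by rewrite addr0.
rewrite add0r; case: ifP => // ve.
move: nd; rewrite /link_step pv /= -setI_eq0 setIUr setU_eq0 !setI_eq0 dis andbT.
by rewrite disjoint_sym disjoints1 ve.
Qed.

(** Once [U] is saturated, no available edge contains it and its degree is frozen. The step that
    crosses the threshold overshoots by at most [wdeg w (v |: U)], hence the factor 2. *)
Lemma wdeg_run I b U : U != set0 ->
  (forall v, 0 <= thr U /\ (v \notin U -> wdeg w (v |: U) <= thr U)) ->
  wdeg (link_run I b).2 U <= 2 * thr U.
Proof.
move=> U0 Hthr; elim: b => [|b IH].
  rewrite /wdeg big1 ?mulr_ge0 // => [|f _]; last by rewrite ffunE.
  case/set0Pn: U0 => v _; exact: (Hthr v).1.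
rewrite link_runS /link_step; case: picked => [v|] //=.
have [thr0 Hv] := Hthr v.
rewrite /wdeg; under eq_bigr do rewrite ffunE.
rewrite big_split /= -/(wdeg _ U).
have [lt|ge] := ltP (wdeg (link_run I b).2 U) (thr U); last first.
  rewrite [X in _ + X]big1 ?addr0 // => f Uf; case: ifP => // /andP[_].
  case/andP=> _ /forallP/(_ U); rewrite U0 /=.
  by rewrite (subset_trans Uf) ?subsetUr //= ltNge ge.
rewrite mulrDl mul1r lerD //; first exact: ltW.
have [vU|vU] := boolP (v \in U).
  by rewrite big1 // => f /subsetP/(_ _ vU) ->.
apply: le_trans (Hv vU).
rewrite big_mkcond /=.
have -> : wdeg w (v |: U) =
  \sum_(f : {set T}) (if (v \notin f) && (v |: U \subset v |: f) then w (v |: f) else 0).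
  rewrite (sum_link v (fun e => v |: U \subset e)); apply: eq_bigl => e.
  by rewrite subUset sub1set; case: (v \in e); rewrite ?andbT ?andbF.
apply: ler_sum => f _; case: (boolP (U \subset f)) => Uf; last by case: ifP.
rewrite setUS // andbT; case: (v \notin f) => //=; by case: ifP.
Qed.

End Link.
End WeightedHypergraph.

(** * One container step, by induction on the uniformity of the hypergraph *)

Section ContainerLemma.
Variable R : realType.

(* [S] maps an independent set to its fingerprint and [F] to its container;
   by the last clause both can be recomputed from the fingerprint alone. *)
Definition is_container (T : finType) (P : pred {set T}) (G : {set T})
    (s f : R) (SF : {set T} -> {set T} * {set T}) : Prop :=
  forall I : {set T}, I \subset G -> P I ->
  [/\ (SF I).1 \subset I, #|(SF I).1|%:R <= s,
      I \subset (SF I).1 :|: (SF I).2, (SF I).2 \subset G /\ #|(SF I).2|%:R <= f &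
      forall J : {set T}, (SF I).1 \subset J -> J \subset I -> SF J = SF I].

Lemma sum_wdeg (T : finType) (w : {set T} -> R) (P : pred {set T}) i :
  (forall e, 0 <= w e) -> (forall e, w e != 0 -> #|e| = i) ->
  \sum_(U | P U) wdeg w U <= 2 ^+ i * wtot w.
Proof.
move=> w0 wi; rewrite /wdeg (exchange_big_dep predT) //= /wtot mulr_sumr.
apply: (@le_trans _ _ (\sum_(e : {set T}) \sum_(U in powerset e) w e)).
  apply: ler_sum => e _; rewrite big_mkcond [leRHS]big_mkcond /=.
  by apply: ler_sum => U _; rewrite inE; case: (P U) => //=; case: ifP.
apply: ler_sum => e _; rewrite sumr_const card_powerset.
have [->|/wi ->] := eqVneq (w e) 0; first by rewrite mul0rn mulr0.
by rewrite -[leLHS]mulr_natl natrX.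
Qed.

(** After [b] picks there are two cases. Heavy links form a hypergraph of uniformity one less with
    comparable degree bounds, and induction applies. Light links mean that few edges were touched or
    contain a saturated set, so most of the weight is still available, yet every unpicked element of
    [I] has small available degree. As no degree exceeds [B], a fixed proportion of [G] has larger
    available degree and can be left out of the container. *)
Lemma container_lemma (i : nat) (kap : R) : 0 < kap ->
  exists2 del : R, 0 < del < 1 &
  forall (T : finType) (G : {set T}) (p B : R) (b : nat) (w : {set T} -> R),
  0 < p <= 1 -> 0 < B -> p * #|G|%:R <= b%:R ->
  (forall e, 0 <= w e) ->
  (forall e, w e != 0 -> #|e| = i.+1 /\ e \subset G) ->
  (forall U, U != set0 -> wdeg w U <= B * p ^+ #|U|.-1) ->
  kap * B * #|G|%:R <= wtot w ->
  exists SF, is_container (fun I => `[< windep w I >]) G (i * b)%:R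
               ((1 - del) * #|G|%:R) SF.
Proof.
elim: i kap => [|i IH] kap kap0.
  exists (Num.min kap 2^-1).
    by rewrite lt_min kap0 invr_gt0 ltr0n /= gt_min invf_lt1 ?ltr1n ?ltr0n ?orbT.
  move=> T G p B b w /andP[p0 p1] B0 pb w0 wsupp wd wt.
  pose Z := [set u in G | w [set u] != 0].
  exists (fun=> (set0, G :\: Z)) => I IG /asboolP wI; split=> //=.
  - exact: sub0set.
  - by rewrite cards0 mul0n.
  - rewrite set0U subsetD IG /= -setI_eq0; apply/eqP/setP => u; rewrite !inE.
    apply/negP => /andP[uI /andP[_]]; rewrite wI ?eqxx //.
    by rewrite sub1set.
  split; first exact: subsetDl.
  have ZG : Z \subset G by apply/subsetP => u; rewrite inE => /andP[].
  have -> : #|G :\: Z|%:R = #|G|%:R - #|Z|%:R :> R.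
    by rewrite cardsD (setIidPr ZG) natrB // subset_leq_card.
  suff : kap * #|G|%:R <= #|Z|%:R.
    have: Num.min kap 2^-1 <= kap by rewrite ge_min lexx.
    have := ler0n R #|G|; nra.
  rewrite -(ler_pM2r B0) mulrAC (le_trans wt) // mulr_natl -sumr_const /wtot.
  apply: (@le_trans _ _ (\sum_(u in Z) wdeg w [set u])); last first.
    apply: ler_sum => u _; apply: le_trans (wd _ _) _; rewrite ?cards1 ?mulr1 //.
    by rewrite -card_gt0 cards1.
  rewrite /wdeg (exchange_big_dep predT) //=; apply: ler_sum => e _.
  rewrite sumr_const; have [->|we] := eqVneq (w e) 0; first by rewrite mul0rn.
  have [/eqP/cards1P[u eu] eG] := wsupp _ we.
  rewrite -[leLHS]mulr1n ler_wpMn2l //; apply/card_gt0P; exists u.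
  by rewrite unfold_in inE -eu we subxx (subsetP eG) // eu inE.
(* A link edge has [2 ^ i.+1] subsets, so edges over saturated sets weigh at most [2 ^ i.+1 * c],
   that is 1/8 of the total. The halving of [c * kap] below comes from the degree bound [2 * B * p]
   of the links. *)
pose c : R := 2 ^- (i + 4).
have c0 : 0 < c by rewrite invr_gt0 exprn_gt0.
have ck0 : 0 < c * kap / 2 by rewrite divr_gt0 // mulr_gt0.
have [del /andP[del0 del1] {}IH] := IH (c * kap / 2) ck0.
exists (Num.min del (Num.min (kap / 4) 2^-1)).
  by rewrite !lt_min !gt_min del0 del1 divr_gt0 //= invr_gt0 ltr0n.
move=> T G p B b w /andP[p0 p1] B0 pb w0 wsupp wd wt.
(* This is the hypothesis on [wdeg w] for sets with one element more, so a single pick adds at most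
   [thr U] to the degree of [U]. *)
pose thr (U : {set T}) := B * p ^+ #|U|.
have thr0 U : 0 < thr U by rewrite mulr_gt0 ?exprn_gt0.
pose run I := link_run w thr I b.
have good_run (I : {set T}) : I \subset G -> c * p * wtot w <= wtot (run I).2 ->
    exists SF, is_container (fun I' => `[< windep (run I).2 I' >]) G (i * b)%:R
               ((1 - del) * #|G|%:R) SF.
  move=> IG big; apply: (IH T G p (2 * B * p) b) => //.
  - by rewrite p0.
  - by rewrite !mulr_gt0.
  - by move=> e; apply: link_run_ge0.
  - move=> f /link_run_supp [v [vI vf /wsupp [cf fG]]].
    move: cf; rewrite cardsU1 vf add1n => -[] ->; split=> //.
    by apply: subset_trans fG; apply: subsetUr.
  - move=> U U0; have -> : 2 * B * p * p ^+ #|U|.-1 = 2 * thr U.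
      by rewrite /thr -[in RHS](@prednK #|U|) ?card_gt0 // exprS; ring.
    apply: wdeg_run => // v; split; first exact: ltW.
    move=> vU; apply: le_trans (wd _ _) _.
      by apply/set0Pn; exists v; rewrite !inE eqxx.
    by rewrite cardsU1 vU.
  apply: le_trans big; rewrite [leLHS](_ : _ = c * p * (kap * B * #|G|%:R)); last by field.
  by rewrite ler_wpM2l // ltW // mulr_gt0.
pose goodSF (w' : {ffun {set T} -> R}) SF :=
  is_container (fun I : {set T} => `[< windep w' I >]) G (i * b)%:R
    ((1 - del) * #|G|%:R) SF.
(* The map is chosen from the link weights alone, so sets with equal runs share it and consistency
   survives the induction. *)
have [SFw HSF] : { SFw & forall w' : {ffun {set T} -> R},
    (exists SF, goodSF w' SF) -> goodSF w' (SFw w') }.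
  apply: (@choice _ _ (fun w' SF0 => (exists SF, goodSF w' SF) -> goodSF w' SF0)) => w'.
  have [[SF HSF]|no] := pselect (exists SF, goodSF w' SF); first by exists SF.
  by exists (fun=> (set0, set0)).
pose low I := [set u in G | #|G|%:R * adeg w thr (run I) u <= c * wtot w].
exists (fun I => if c * p * wtot w <= wtot (run I).2
                 then ((run I).1 :|: (SFw (run I).2 I).1, (SFw (run I).2 I).2)
                 else ((run I).1, low I)) => I IG /asboolP wI.
have runI : (run I).1 \subset I by apply: link_run_sub.
have crun : #|(run I).1|%:R <= b%:R :> R by rewrite ler_nat card_link_run.
have sub_le (x y : R) : x <= y -> (1 - y) * #|G|%:R <= (1 - x) * #|G|%:R.
  by move=> xy; rewrite ler_wpM2r // lerD2l lerN2.
have min1 : Num.min del (Num.min (kap / 4) 2^-1) <= del by rewrite ge_min lexx.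
case: ifPn => [big|]; last rewrite -ltNge => small.
  have [] := HSF _ (good_run _ IG big) I IG _.
    by apply/asboolP; apply: link_run_indep.
  set S' := (SFw _ I).1; set F' := (SFw _ I).2 => S'I cS' cover [F'G cF'] cons.
  split=> /=; first by rewrite subUset runI.
  - rewrite mulSn natrD (le_trans _ (lerD crun cS')) // -natrD ler_nat.
    exact: leq_card_setU.
  - by apply: subset_trans cover _; rewrite -setUA subsetUr.
  - by split=> //; apply: le_trans cF' _; apply: sub_le.
  move=> J /[!subUset] /andP[rJ S'J] JI.
  have rE : run J = run I by apply: link_run_consistent.
  by rewrite rE big (cons J) // .
have Gpos : (0 < #|G|)%N.
  rewrite lt0n; apply/negP => /eqP G0; move: small; rewrite ltNge => /negP; apply.
  have -> : wtot w = 0.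
    apply: big1 => e _; apply/eqP/negPn/negP => /wsupp [ce /subset_leq_card].
    by rewrite ce G0.
  by rewrite mulr0; apply: sumr_ge0 => f _; apply: link_run_ge0.
have Gpos' : 0 < #|G|%:R :> R by rewrite ltr0n.
split=> //=.
- by rewrite (le_trans crun) // ler_nat leq_pmull.
- apply/subsetP => u uI; rewrite inE; case: (boolP (u \in (run I).1)) => //= uS.
  rewrite inE (subsetP IG) //=.
  rewrite -(ler_pM2l p0) mulrA (le_trans (ler_wpM2r _ pb)) //.
    by apply: sumr_ge0.
  apply: (le_trans (adeg_bound w0 uI uS)).
  by rewrite (le_trans (ltW small)) // [c * p]mulrC mulrA.
- split; first by apply/subsetP => u; rewrite inE => /andP[].
  set Fl := low I.
  have FlG : Fl \subset G by apply/subsetP => u; rewrite inE => /andP[].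
  apply: le_trans (sub_le _ (kap / 4) _); last first.
    by rewrite !ge_min lexx orbT.
  have tot0 : 0 <= wtot w by apply: sumr_ge0.
  pose A := \sum_(e | avail thr (run I) e) w e.
  pose sat (U : {set T}) := (U != set0) && (thr U <= wdeg (run I).2 U).
  have satE (e : {set T}) : ~~ [forall U : {set T}, (U != set0) && (U \subset e) ==>
        (wdeg (run I).2 U < thr U)] = [exists U : {set T}, sat U && (U \subset e)].
    rewrite negb_forall; apply: eq_existsb => U.
    by rewrite negb_imply -leNgt /sat andbAC.
  have run_supp f : (run I).2 f != 0 -> #|f| = i.+1.
    move=> /link_run_supp [v [vI vf /wsupp [cf fG]]].
    by move: cf; rewrite cardsU1 vf add1n => -[].
  (* The edges over a saturated [U] weigh at most [thr U / p], and [thr U] is at most the degree of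
     [U] in the links; summing these degrees counts each link edge once for each of its saturated
     subsets. *)
  have satB : p * \sum_(e : {set T} | [exists U : {set T}, sat U && (U \subset e)]) w e
      <= 2 ^+ i.+1 * wtot (run I).2.
    apply: le_trans (sum_wdeg sat _ run_supp); last by move=> e; apply: link_run_ge0.
    apply: (@le_trans _ _ (\sum_(U | sat U) thr U)); last first.
      by apply: ler_sum => U /andP[].
    apply: (@le_trans _ _ (p * \sum_(U | sat U) wdeg w U)).
      rewrite ler_pM2l // /wdeg (exchange_big_dep predT) //= big_mkcond.
      apply: ler_sum => e _; case: ifP => [/existsP[U HU]|_].
        by rewrite (bigD1 U) //= lerDl sumr_ge0.
      by rewrite sumr_ge0.
    rewrite mulr_sumr; apply: ler_sum => U /andP[U0 _].
    rewrite /thr -(@prednK #|U|) ?card_gt0 // exprS mulrCA ler_pM2l // wd //.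
  have totA : wtot w / 2 <= A.
    have split3 : wtot w <= A + wtot (run I).2 +
        \sum_(e : {set T} | [exists U : {set T}, sat U && (U \subset e)]) w e.
      apply: le_trans (lerD (lerD (lexx A) (touched_bound thr w0 I b)) (lexx _)).
      rewrite /A [X in _ <= X + _ + _]big_mkcond [X in _ <= _ + X + _]big_mkcond.
      rewrite [X in _ <= _ + X]big_mkcond -!big_split /=.
      apply: ler_sum => e _; rewrite -satE /avail.
      case: [disjoint _ & _] => /=; case: [forall _, _] => /=;
        rewrite ?addr0 ?add0r //.
    have c1 : c <= 2^-1 * 2^-1 * 2^-1.
      rewrite /c exprD invfM -[leRHS]mul1r.
      rewrite (_ : 2 ^- 4 = 2^-1 * (2^-1 * 2^-1 * 2^-1)); last by rewrite !exprS expr0 !invfM !invr1; ring.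
      rewrite mulrA ler_wpM2r ?mulr_ge0 ?invr_ge0 // -invfM -exprSr.
      by rewrite invf_le1 ?exprn_gt0 // exprn_ege1 // ler1n.
    have c2 : 2 ^+ i.+1 * c = 2^-1 * 2^-1 * 2^-1.
      rewrite /c addnS -addSn exprD invfM mulrA divff ?mul1r ?expf_neq0 ?pnatr_eq0 //.
      by rewrite !exprS expr0 !invfM invr1; ring.
    set sb := \sum_(e | _) w e in satB split3.
    have sb0 : p * sb <= p * (2 ^+ i.+1 * c * wtot w).
      apply: le_trans satB _; rewrite -!mulrA mulrCA ler_pM2l ?exprn_gt0 //.
      by rewrite mulrA [p * c]mulrC ltW.
    rewrite ler_pM2l // c2 in sb0.
    have wl : wtot (run I).2 <= c * wtot w.
      rewrite (le_trans (ltW small)) // -mulrA ler_wpM2l //; first exact: ltW.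
      by rewrite ler_piMl.
    have : c * wtot w <= 2^-1 * 2^-1 * 2^-1 * wtot w by rewrite ler_wpM2r.
    lra.
  have degsum : A <= \sum_(u in G) adeg w thr (run I) u.
    rewrite /A /adeg (exchange_big_dep (avail thr (run I))) /=; last by move=> u e _ /andP[].
    apply: ler_sum => e av; rewrite sumr_const.
    have [->|we] := eqVneq (w e) 0; first by rewrite mul0rn.
    have [ce eG] := wsupp _ we.
    rewrite -[leLHS]mulr1n ler_wpMn2l //; apply/card_gt0P.
    have /set0Pn [u ue] : e != set0 by rewrite -card_gt0 ce.
    by exists u; rewrite unfold_in (subsetP eG) // av.
  have high : \sum_(u in G :\: Fl) adeg w thr (run I) u <= B * #|G :\: Fl|%:R.
    have -> : B * #|G :\: Fl|%:R = \sum_(u in G :\: Fl) B.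
      by rewrite sumr_const mulr_natr.
    apply: ler_sum => u _; have := wd [set u]; rewrite cards1 expr0 mulr1 -card_gt0 cards1 => /(_ isT).
    apply: le_trans; rewrite /adeg /wdeg [leRHS]big_mkcond [leLHS]big_mkcond /=.
    by apply: ler_sum => e _; rewrite sub1set; case: (u \in e); rewrite ?andbT ?andbF //; case: ifP.
  have lowS : \sum_(u in Fl) adeg w thr (run I) u <= c * wtot w.
    apply: (@le_trans _ _ (\sum_(u in Fl) (c * wtot w / #|G|%:R))).
      by apply: ler_sum => u; rewrite inE => /andP[_]; rewrite ler_pdivlMr // mulrC.
    rewrite sumr_const -[leLHS]mulr_natr -[leLHS]mulrA ler_piMr ?mulr_ge0 ?(ltW c0) //.
    by rewrite mulrC ler_pdivrMr // mul1r ler_nat subset_leq_card.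
  have c4 : c <= 4^-1.
    rewrite lef_pV2 ?posrE ?exprn_gt0 ?ltr0n //.
    have -> : 4 = 2 ^+ 2 :> R by rewrite expr2 -natrM.
    by apply: ler_weXn2l; [rewrite ler1n | rewrite addnC leq_addr].
  have cG : #|G|%:R = #|Fl|%:R + #|G :\: Fl|%:R :> R.
    by rewrite -natrD -(cardsID Fl G) (setIidPr FlG).
  have split2 : \sum_(u in G) adeg w thr (run I) u =
     \sum_(u in Fl) adeg w thr (run I) u + \sum_(u in G :\: Fl) adeg w thr (run I) u.
    rewrite (bigID (mem Fl)) /=; congr (_ + _); apply: eq_bigl => u.
      by rewrite andb_idl // => /(subsetP FlG).
    by rewrite [RHS]in_setD andbC.
  (* At least half of the weight is available, and elements of [Fl] account for at most a quarter of
     it; the remaining quarter is carried by elements of degree at most [B]. *)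
  have : B * (kap / 4 * #|G|%:R) <= B * #|G :\: Fl|%:R.
    apply: le_trans high.
    rewrite (_ : B * _ = kap * B * #|G|%:R / 4); last by field.
    have : c * wtot w <= 4^-1 * wtot w by rewrite ler_wpM2r.
    move: totA degsum split2 lowS wt; move: (\sum_(u in G) _) (\sum_(u in Fl) _).
    move: (\sum_(u in _) _) (wtot w) A (kap * B * _) (c * _) => x1 x2 x3 x4 x5 x6 x7.
    lra.
  rewrite ler_pM2l // => h; move: h cG.
  move: (#|G|%:R) (#|Fl|%:R) (#|G :\: Fl|%:R) => x y z h cG; lra.
move=> J rJ JI; have rE : run J = run I by apply: link_run_consistent.
by rewrite /low rE leNgt small.
Qed.
End ContainerLemma.
(** * Copies of a graph *)

Section GraphMaps.
Variables (V W : finType).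

Lemma eimg_subproof (f : V -> W) (fi : injective f) (e : edge V) :
  #|f @: val e| == 2%N.
Proof. by rewrite card_imset //; exact: (valP e). Qed.

Definition eimg (f : V -> W) (fi : injective f) (e : edge V) : edge W :=
  exist _ (f @: val e) (eimg_subproof fi e).

Lemma eimg_inj (f : V -> W) (fi : injective f) : injective (eimg fi).
Proof.
move=> e1 e2 /(congr1 val) /= E; apply/val_inj/setP => x.
by rewrite -[LHS](mem_imset _ _ fi) E mem_imset.
Qed.

End GraphMaps.

Section Cover.
Variables (V : finType).
Implicit Types (Q U : graph V) (e : edge V).

Definition cov Q : {set V} := \bigcup_(e in Q) endpoints e.

Lemma card_endpoints e : #|endpoints e| = 2%N.
Proof. exact/eqP/(valP e). Qed.

Lemma endpoints_cov e Q : e \in Q -> endpoints e \subset cov Q.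
Proof. by move=> eQ; apply: bigcup_sup eQ. Qed.

Lemma cov_sub Q (X : {set V}) :
  (cov Q \subset X) = [forall e in Q, endpoints e \subset X].
Proof. by apply/bigcupsP/forall_inP. Qed.

Lemma covS U Q : U \subset Q -> cov U \subset cov Q.
Proof.
move=> UQ; rewrite cov_sub; apply/forall_inP => e /(subsetP UQ).
exact: endpoints_cov.
Qed.

Lemma cov1 e : cov [set e] = endpoints e.
Proof. by rewrite /cov big_set1. Qed.

Lemma covU Q U : cov (Q :|: U) = cov Q :|: cov U.
Proof. exact: bigcup_setU. Qed.

Lemma covI Q U : cov (Q :&: U) \subset cov Q :&: cov U.
Proof. by rewrite subsetI !covS ?subsetIl ?subsetIr. Qed.

Lemma cov_ge2 Q : Q != set0 -> (2 <= #|cov Q|)%N.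
Proof.
case/set0Pn => e eQ; rewrite -(card_endpoints e).
exact/subset_leq_card/endpoints_cov.
Qed.

Lemma cov_gt2 Q : (2 <= #|Q|)%N -> (2 < #|cov Q|)%N.
Proof.
move=> Q2; rewrite ltn_neqAle cov_ge2 ?andbT; last by rewrite -card_gt0 ltnW.
apply/negP => /eqP c2.
have /card_gt1P [e1 [e2 [e1Q e2Q /eqP]]] := Q2; apply.
have E e : e \in Q -> endpoints e = cov Q.
  move=> eQ; apply/eqP; rewrite eqEcard endpoints_cov //= -c2.
  by rewrite card_endpoints.
by apply: val_inj; rewrite -!/(endpoints _) !E.
Qed.

End Cover.

Section Copies.
Variables (V W : finType).
Implicit Types (H : graph V) (G : graph W).

Lemma cov_eimg (f : V -> W) (fi : injective f) (U : graph V) :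
  cov (eimg fi @: U) = f @: cov U.
Proof.
apply/setP => y; apply/bigcupP/imsetP.
  by case=> _ /imsetP[e eU ->] /imsetP[x xe ->]; exists x => //; apply/bigcupP; exists e.
case=> x /bigcupP[e eU xe] ->; exists (eimg fi e); first exact: imset_f.
exact: imset_f.
Qed.

Lemma card_cov_eimg (f : V -> W) (fi : injective f) (U : graph V) :
  #|cov (eimg fi @: U)| = #|cov U|.
Proof. by rewrite cov_eimg card_imset. Qed.

Lemma card_eimg (f : V -> W) (fi : injective f) (U : graph V) :
  #|eimg fi @: U| = #|U|.
Proof. by rewrite card_imset //; apply: eimg_inj. Qed.

Lemma copiesP H G (F : {set W} * graph W) :
  reflect (exists (f : V -> W) (fi : injective f),
             [/\ F.1 = f @: [set: V], F.2 = eimg fi @: H & F.2 \subset G])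
          (F \in copies H G).
Proof.
rewrite 2!inE; apply: (iffP andP).
  case=> /andP[FG _] /existsP[f /and3P[/injectiveP fi /eqP F1 /eqP F2]].
  exists f, fi; split=> //; apply/setP => e; apply/idP/imsetP.
    move=> eF; have : endpoints e \in [set endpoints e | e in F.2] by apply: imset_f.
    by rewrite -F2 => /imsetP[e' e'H E]; exists e' => //; apply: val_inj.
  case=> e' e'H ->; have : f @: endpoints e' \in [set f @: endpoints e | e in H].
    by apply/imsetP; exists e'.
  by rewrite F2 => /imsetP[e0 e0F E]; rewrite (_ : eimg fi e' = e0) //; apply: val_inj.
case=> f [fi [F1 F2 FG]]; split.
  rewrite FG /=; apply/forall_inP => e; rewrite F1 F2 => /imsetP[e' _ ->].
  by apply: imsetS; apply: subsetT.
apply/existsP; exists [ffun x => f x].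
have fE : [ffun x => f x] =1 f by move=> x; rewrite ffunE.
apply/and3P; split.
- by apply/injectiveP => x y; rewrite !ffunE; apply: fi.
- by rewrite F1 (eq_imset _ fE).
apply/eqP/setP => X; rewrite F2; apply/imsetP/imsetP.
  case=> e eH ->; exists (eimg fi e); first exact: imset_f.
  by rewrite (eq_imset _ fE).
case=> _ /imsetP[e eH ->] ->; exists e => //.
by rewrite (eq_imset _ fE).
Qed.

Lemma copies_card H G F : F \in copies H G ->
  [/\ #|F.1| = #|V|, #|F.2| = #|H|, F.2 \subset G & cov F.2 \subset F.1].
Proof.
case/copiesP=> f [fi [F1 F2 FG]]; split=> //.
- by rewrite F1 card_imset // cardsT.
- by rewrite F2 card_eimg.
by rewrite F2 cov_eimg F1 imsetS // subsetT.
Qed.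

Lemma copies_sub H G F (U : graph W) : F \in copies H G -> U \subset F.2 ->
  exists U' : graph V, [/\ U' \subset H, #|U'| = #|U| & #|cov U'| = #|cov U|].
Proof.
case/copiesP=> f [fi [F1 F2 FG]] UF.
exists [set e in H | eimg fi e \in U].
have E : U = eimg fi @: [set e in H | eimg fi e \in U].
  apply/setP => e; apply/idP/imsetP.
    move=> eU; have := subsetP UF _ eU; rewrite F2 => /imsetP[e' e'H eE].
    by exists e' => //; rewrite inE e'H -eE.
  by case=> e'; rewrite inE => /andP[_ e'U] ->.
split; first by apply/subsetP => e; rewrite inE => /andP[].
  by rewrite [in RHS]E card_eimg.
by rewrite [in RHS]E card_cov_eimg.
Qed.

Lemma copiesS H G G' : G \subset G' -> copies H G \subset copies H G'.
Proof.
move=> GG'; apply/subsetP => F /copiesP[f [fi [F1 F2 FG]]].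
by apply/copiesP; exists f, fi; split=> //; apply: subset_trans FG GG'.
Qed.

Lemma is_freePn H G : ~~ is_free H G ->
  exists (f : V -> W) (fi : injective f), eimg fi @: H \subset G.
Proof.
rewrite /is_free -lt0n => /card_gt0P[F /copiesP[f [fi [_ F2 FG]]]].
by exists f, fi; rewrite -F2.
Qed.

Lemma is_freeS H G G' : G \subset G' -> is_free H G' -> is_free H G.
Proof.
move=> /(copiesS H)/subset_leq_card; rewrite /is_free => le /eqP E.
by rewrite -leqn0 (leq_trans le) // E.
Qed.

End Copies.

Section Pullback.
Variables (R : realType) (V : finType) (H : graph V).

(** Enumerating [X] transports a graph living inside [X] to one on [#|X|] labelled vertices. Only
    copies whose whole vertex set lies in [X], isolated vertices included, are counted. *)
Lemma ES_subset (C' c alpha : R) (n0 : nat) :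
  (forall n : nat, (n0 <= n)%N -> forall G : graph 'I_n,
      C' * n%:R `^ alpha < #|G|%:R ->
      c * (#|G|%:R ^+ #|H| / n%:R `^ (2 * #|H|%:R - #|V|%:R))
        <= #|copies H G|%:R) ->
  forall (W : finType) (X : {set W}) (G : graph W), (n0 <= #|X|)%N ->
  (forall e, e \in G -> endpoints e \subset X) ->
  C' * #|X|%:R `^ alpha < #|G|%:R ->
  c * (#|G|%:R ^+ #|H| / #|X|%:R `^ (2 * #|H|%:R - #|V|%:R))
     <= #|[set F in copies H G | F.1 \subset X]|%:R.
Proof.
move=> ES W X G nX GX; pose io (i : 'I_#|X|) := enum_val i.
have ioi : injective io := enum_val_inj.
pose G' : graph 'I_#|X| := [set e | eimg ioi e \in G].
have ioX : io @: [set: 'I_#|X|] = X.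
  apply/setP => x; apply/imsetP/idP => [[i _ ->]|xX]; first exact: enum_valP.
  by exists (enum_rank_in xX x) => //; rewrite /io enum_rankK_in.
have GE : eimg ioi @: G' = G.
  apply/setP => e; apply/imsetP/idP => [[e']|eG]; first by rewrite inE => eG ->.
  have eX := GX e eG.
  have E : io @: (io @^-1: val e) = val e.
    apply/setP => x; apply/imsetP/idP => [[i]|xe]; first by rewrite inE => ie ->.
    have : x \in io @: [set: 'I_#|X|] by rewrite ioX (subsetP eX).
    by case/imsetP => i _ xi; exists i => //; rewrite inE -xi.
  have p2 : #|io @^-1: val e| == 2%N by rewrite -(card_imset _ ioi) E (valP e).
  pose e' : edge 'I_#|X| := exist (fun A : {set 'I_#|X|} => #|A| == 2%N) _ p2.
  have eE : eimg ioi e' = e by apply: val_inj.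
  by exists e' => //; rewrite inE eE.
have -> : #|G| = #|G'| by rewrite -GE card_eimg.
move=> big; apply: le_trans (ES _ nX G' big) _.
rewrite ler_nat.
pose up (F : {set 'I_#|X|} * graph 'I_#|X|) := (io @: F.1, eimg ioi @: F.2).
have upi : injective up.
  move=> [A B] [A' B'] [/(imset_inj ioi) -> E]; congr (_, _).
  exact: imset_inj (eimg_inj (fi := ioi)) _ _ E.
rewrite -(card_imset _ upi); apply: subset_leq_card; apply/subsetP => _ /imsetP[F FC ->].
case/copiesP: FC => f [fi [F1 F2 FG]].
rewrite inE; apply/andP; split; last first.
  apply: (@subset_trans _ _ (mem (io @: [set: 'I_#|X|]))); last by rewrite ioX.
  by rewrite imsetS // subsetT.
have ci : injective (io \o f) by apply: inj_comp.
apply/copiesP; exists (io \o f), ci; split=> /=.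
- by rewrite F1 -imset_comp.
- rewrite F2 -imset_comp; apply: eq_imset => e; apply: val_inj => /=.
  by rewrite -imset_comp.
by apply: (subset_trans (imsetS _ FG)); rewrite GE.
Qed.

End Pullback.
(** * Balanced supersaturation *)

Section RandomSubsets.
Variables (R : realType) (T : finType).

Lemma card_draws_sup (Y : {set T}) (m : nat) : (#|Y| <= m)%N ->
  #|[set X : {set T} | (#|X| == m) && (Y \subset X)]| =
  'C(#|T| - #|Y|, m - #|Y|).
Proof.
move=> Ym.
have -> : (#|T| - #|Y|)%N = #|~: Y| by rewrite -(cardsC Y) addKn.
rewrite -cards_draws.
rewrite -(card_in_imset (f := fun X : {set T} => X :\: Y)).
  apply: eq_card => Z; apply/imsetP/idP.
    case=> X; rewrite !inE => /andP[/eqP Xm YX] ->.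
    by rewrite setDE subsetIr /= -setDE cardsD (setIidPr YX) Xm.
  rewrite inE => /andP[ZY /eqP Zm]; exists (Z :|: Y).
    rewrite inE subsetUr andbT cardsU (_ : Z :&: Y = set0) ?cards0 ?subn0 ?Zm ?subnK //.
    by apply/eqP; rewrite setI_eq0 disjoints_subset.
  by rewrite setDUl setDv setU0; apply/esym/setDidPl; rewrite disjoints_subset.
move=> X X'; rewrite !inE => /andP[_ YX] /andP[_ YX'] E.
by rewrite -(setID X Y) -(setID X' Y) E (setIidPr YX) (setIidPr YX').
Qed.

(** The quotient of the binomials is a product of factors (m-i)/(n-i), each at most m/n. *)
Lemma bin_ratio_le (n m v : nat) : (v <= m)%N -> (m <= n)%N ->
  ('C(n - v, m - v) * n ^ v <= m ^ v * 'C(n, m))%N.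
Proof.
elim: v => [|v IH] vm mn; first by rewrite !subn0 !expn0 muln1 mul1n.
have nv : (0 < n - v)%N by rewrite subn_gt0 (leq_trans vm).
rewrite -(leq_pmul2l nv).
have E : ((n - v) * 'C(n - v.+1, m - v.+1) = (m - v) * 'C(n - v, m - v))%N.
  have := mul_bin_diag (n - v) (m - v).-1.
  by rewrite (@prednK (m - v)) ?subn_gt0 // -!subnS.
rewrite mulnA E expnS.
have : ((m - v) * n <= (n - v) * m)%N.
  by rewrite !mulnBl [(n * m)%N]mulnC leq_sub2l // leq_mul2l mn orbT.
have := IH (ltnW vm) mn.
set a := 'C(_, _); set b := 'C(_, _); set x := (n ^ v)%N; set y := (m ^ v)%N.
move=> h1 h2.
by rewrite mulnACA expnS -/y -(mulnA m) [leqRHS]mulnA leq_mul.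
Qed.

(** Against (m/n)^2 the true probability m(m-1)/(n(n-1)) loses at most a factor 2, because m >=
    2. *)
Lemma bin_ratio_ge (n m : nat) : (2 <= m)%N -> (m <= n)%N ->
  (m ^ 2 * 'C(n, m) <= 2 * ('C(n - 2, m - 2) * n ^ 2))%N.
Proof.
case: m => [|[|m]] // _; case: n => [|[|n]] // mn.
have E1 := mul_bin_diag n.+2 m.+1; have E2 := mul_bin_diag n.+1 m.
rewrite /= in E1 E2; rewrite !subSS !subn0.
set a := 'C(n.+2, _) in E1 *; set b := 'C(n.+1, _) in E1 E2; set d := 'C(n, m) in E2 *.
have : (n.+2 * (n.+1 * d) = m.+1 * (m.+2 * a))%N by rewrite E2 mulnCA E1.
move: (a) (d) => {E1 E2 b}{}a {}d E.
apply: (@leq_trans (2 * (m.+1 * (m.+2 * a)))).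
  by rewrite -mulnn -mulnA mulnCA !mulnA leq_mul2r leq_mul2r; lia.
by rewrite -E leq_mul2l /= -mulnn [leqRHS]mulnC -mulnA leq_mul2l /= leq_mul2r leqnSn orbT.
Qed.

Lemma sum_draws_le (Y : {set T}) (m : nat) : (m <= #|T|)%N -> (0 < #|T|)%N ->
  \sum_(X : {set T} | #|X| == m) (Y \subset X)%:R <=
    (m%:R / #|T|%:R) ^+ #|Y| * 'C(#|T|, m)%:R :> R.
Proof.
move=> mT T0.
rewrite (_ : \sum_(X | _) _ =
   #|[set X : {set T} | (#|X| == m) && (Y \subset X)]|%:R); last first.
  rewrite -sum1_card natr_sum big_mkcond [RHS]big_mkcond /=.
  by apply: eq_bigr => X _; rewrite inE; case: (#|X| == m); case: (_ \subset _).
have [Ym|mY] := leqP #|Y| m; last first.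
  rewrite eq_card0 ?mulr_ge0 ?exprn_ge0 ?divr_ge0 // => X; rewrite !inE.
  by apply/negP => /andP[/eqP Xm /subset_leq_card]; rewrite Xm leqNgt mY.
rewrite card_draws_sup // expr_div_n mulrAC ler_pdivlMr ?exprn_gt0 ?ltr0n //.
by rewrite -!natrX -!natrM ler_nat bin_ratio_le.
Qed.

Lemma sum_draws_ge (Y : {set T}) (m : nat) :
  (2 <= m)%N -> (m <= #|T|)%N -> #|Y| = 2%N ->
  (m%:R / #|T|%:R) ^+ 2 / 2 * 'C(#|T|, m)%:R <=
  \sum_(X : {set T} | #|X| == m) (Y \subset X)%:R :> R.
Proof.
move=> m2 mT Y2.
rewrite (_ : \sum_(X | _) _ =
   #|[set X : {set T} | (#|X| == m) && (Y \subset X)]|%:R); last first.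
  rewrite -sum1_card natr_sum big_mkcond [RHS]big_mkcond /=.
  by apply: eq_bigr => X _; rewrite inE; case: (#|X| == m); case: (_ \subset _).
have T0 : (0 < #|T|)%N by rewrite (leq_trans _ mT) // ltnW.
rewrite card_draws_sup ?Y2 // expr_div_n.
rewrite [leLHS](_ : _ = m%:R ^+ 2 * 'C(#|T|, m)%:R / 2 / #|T|%:R ^+ 2); last by ring.
rewrite !ler_pdivrMr ?exprn_gt0 ?ltr0n // -!natrX -!natrM ler_nat.
by rewrite (leq_trans (bin_ratio_ge m2 mT)) // mulnC.
Qed.

End RandomSubsets.
Section Extension.
Variables (R : realType) (V : finType) (H : graph V).

Section Degrees.
Variables (W : finType) (Fam : {set {set W} * graph W}).

Definition fdeg (U : graph W) : nat := #|[set F in Fam | U \subset F.2]|.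

(** Such a [U], inside a copy, determines the copy, so its degree is at most 1. It is set apart
    because the density bound by [m2star] concerns proper subgraphs only. *)
Definition full (U : graph W) : bool := (#|U| == #|H|) && (#|cov U| == #|V|).

Definition sat (thr : nat -> R) (U : graph W) : bool :=
  [&& U != set0, ~~ full U & thr #|cov U| <= (fdeg U)%:R].

Lemma sum_fdeg (G : graph W) : Fam \subset copies H G ->
  \sum_(U : graph W) (fdeg U)%:R = (2 ^ #|H|)%:R * #|Fam|%:R :> R.
Proof.
move=> FG; rewrite -natr_sum -natrM; congr _%:R.
transitivity (\sum_(F in Fam) 2 ^ #|H|)%N; last by rewrite sum_nat_const mulnC.
rewrite /fdeg; under eq_bigr => U _ do rewrite -sum1_card.
rewrite (exchange_big_dep (mem Fam)) /=; last by move=> U F _; rewrite inE => /andP[].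
apply: eq_bigr => F FF; have [_ <- _ _] := copies_card (subsetP FG _ FF).
rewrite -card_powerset -sum1_card; apply: eq_bigl => U.
by rewrite !inE FF.
Qed.

End Degrees.

Variables (C' c alpha : R) (n0 : nat).
Hypothesis ES : forall n : nat, (n0 <= n)%N -> forall G : graph 'I_n,
      C' * n%:R `^ alpha < #|G|%:R ->
      c * (#|G|%:R ^+ #|H| / n%:R `^ (2 * #|H|%:R - #|V|%:R))
        <= #|copies H G|%:R.

(* First-moment argument: a random m-set X satisfies, on average, that few of
   its edges must be deleted to destroy all saturated sets, while the copies
   already in Fam are too few to account for all copies left in X. *)
Lemma unsaturated_copy (W : finType) (G : graph W)
    (Fam : {set {set W} * graph W}) (m : nat) (N0 E q : R) :
  E = #|G|%:R -> q = m%:R / #|W|%:R ->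
  let thr v := 2 ^+ (#|H| + 4) * N0 / E * q ^+ (v - 2) in
  Fam \subset copies H G -> #|Fam|%:R < N0 -> 0 < E ->
  (2 <= m)%N -> (n0 <= m)%N -> (m <= #|W|)%N ->
  C' * m%:R `^ alpha < E * q ^+ 2 / 4 ->
  (forall y, E * q ^+ 2 / 4 <= y ->
     y * (16 * N0 * q ^+ #|V| / (E * q ^+ 2)) <
     c * (y ^+ #|H| / m%:R `^ (2 * #|H|%:R - #|V|%:R))) ->
  exists F, [/\ F \in copies H G, F \notin Fam &
             forall U : graph W, U \subset F.2 -> ~~ sat Fam thr U].
Proof.
move=> EE qE thr FG FN E0 m2 nm mW yC ycount.
have W0 : (0 < #|W|)%N by rewrite (leq_trans _ mW) // ltnW.
have q0 : 0 < q by rewrite qE divr_gt0 ?ltr0n // ltnW.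
have N0p : 0 < N0 by apply: le_lt_trans FN.
pose Cn : R := 'C(#|W|, m)%:R.
have Cn0 : 0 < Cn by rewrite ltr0n bin_gt0.
(* With this scaling the copies of [Fam] inside [X] cost at most [E * q ^+ 2 / 16] on average, as do
   the saturated sets; of the expected [E * q ^+ 2 / 2] edges more than half remain. *)
pose gam := E * q ^+ 2 / (16 * N0 * q ^+ #|V|).
have gam0 : 0 < gam by rewrite /gam; pos.
pose st := sat Fam thr.
pose eX (X : {set W}) : R := \sum_(e in G) (endpoints e \subset X)%:R.
pose bX (X : {set W}) : R := \sum_(U | st U) (cov U \subset X)%:R.
pose fX (X : {set W}) : R := \sum_(F in Fam) (F.1 \subset X)%:R.
have eS : E * q ^+ 2 / 2 * Cn <= \sum_(X : {set W} | #|X| == m) eX X.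
  rewrite /eX exchange_big /=.
  rewrite (_ : E * _ / 2 * Cn = \sum_(e in G) (q ^+ 2 / 2 * Cn)); last first.
    by rewrite sumr_const -[RHS]mulr_natl -EE; ring.
  by apply: ler_sum => e _; rewrite qE sum_draws_ge ?card_endpoints.
have bS : \sum_(X : {set W} | #|X| == m) bX X <= E * q ^+ 2 / 16 * Cn.
  rewrite /bX exchange_big /=.
  apply: (@le_trans _ _ (\sum_(U | st U) q ^+ #|cov U| * Cn)).
    by apply: ler_sum => U _; rewrite qE; apply: sum_draws_le.
  rewrite -mulr_suml ler_pM2r //.
  (* Saturation trades the factor [q ^+ (#|cov U| - 2)] for the degree of [U]. In the constant of
     [thr], [2 ^ #|H|] counts the edge subsets of a copy and [2 ^ 4] is the share 1/16. *)
  apply: (@le_trans _ _ (\sum_(U : graph W) q ^+ 2 * E / (2 ^+ (#|H| + 4) * N0) * (fdeg Fam U)%:R)).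
    rewrite big_mkcond; apply: ler_sum => U _; case: ifP => [/and3P[U0 _ sU]|_]; last first.
      by pos.
    have := cov_ge2 U0 => c2; rewrite -(subnKC c2) exprD.
    rewrite [leRHS](_ : _ = q ^+ 2 * ((fdeg Fam U)%:R / (2 ^+ (#|H| + 4) * N0 / E))).
      rewrite ler_pM2l; last by pos.
      by rewrite ler_pdivlMr; [rewrite mulrC|pos].
    have z0 : 0 < 2 ^+ (#|H| + 4) :> R by pos.
    move: (2 ^+ _) z0 => z z0.
    by field; rewrite !gt_eqF.
  rewrite -mulr_sumr (sum_fdeg FG) natrX exprD.
  rewrite [leLHS](_ : _ = E * q ^+ 2 / 16 * (#|Fam|%:R / N0)).
    by rewrite ler_piMr ?ler_pdivrMr ?mul1r ?(ltW FN) //; pos.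
  have z0 : 0 < 2 ^+ #|H| :> R by pos.
  move: (2 ^+ #|H|) z0 => z z0.
  have -> : 16 = 2 ^+ 4 :> R by rewrite -natrX.
  by field; rewrite !gt_eqF.
have fS : \sum_(X : {set W} | #|X| == m) fX X <= N0 * q ^+ #|V| * Cn.
  rewrite /fX exchange_big /=.
  apply: (@le_trans _ _ (\sum_(F in Fam) q ^+ #|V| * Cn)).
    apply: ler_sum => F /(subsetP FG)/copies_card[<- _ _ _].
    by rewrite qE; apply: sum_draws_le.
  rewrite sumr_const -[leLHS]mulr_natl -mulrA ler_wpM2r ?ltW //.
  by pos.
have [X /eqP Xm HX] : exists2 X : {set W}, #|X| == m &
    E * q ^+ 2 / 4 <= eX X - bX X - gam * fX X.
  have [X HX|none] := pickP (fun X : {set W} => (#|X| == m) &&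
     (E * q ^+ 2 / 4 <= eX X - bX X - gam * fX X)).
    by case/andP: HX => Xm HX; exists X.
  exfalso; have : \sum_(X : {set W} | #|X| == m) (eX X - bX X - gam * fX X)
      < E * q ^+ 2 / 4 * Cn.
    have -> : E * q ^+ 2 / 4 * Cn = \sum_(X : {set W} | #|X| == m) E * q ^+ 2 / 4.
      rewrite sumr_const -[RHS]mulr_natr; congr (_ * _%:R).
      rewrite -card_draws; apply: eq_card => X; by rewrite !inE.
    have [X0 X0m] : exists X0 : {set W}, #|X0| == m.
      have : (0 < #|[set A : {set W} | #|A| == m]|)%N by rewrite card_draws bin_gt0.
      by case/card_gt0P => X0; rewrite inE; exists X0.
    rewrite (bigD1 X0) //= [ltRHS](bigD1 X0) //= ltr_leD //.
      by have := none X0; rewrite X0m /= => /negbT; rewrite -ltNge.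
    apply: ler_sum => X /andP[Xm _].
    by have := none X; rewrite Xm /= => /negbT; rewrite -ltNge => /ltW.
  rewrite !sumrB -mulr_sumr.
  have : gam * (\sum_(X : {set W} | #|X| == m) fX X) <= E * q ^+ 2 / 16 * Cn.
    apply: le_trans (ler_wpM2l (ltW gam0) fS) _.
    rewrite /gam le_eqVlt; apply/orP; left; apply/eqP.
    have z0 : 0 < q ^+ #|V| by pos.
    move: (q ^+ #|V|) z0 => z z0.
    by field; rewrite !gt_eqF.
  have : 0 < E * q ^+ 2 * Cn by pos.
  move: eS bS; move: (\sum_(X | _) eX X) (\sum_(X | _) bX X) (gam * _) => a b d.
  move: (E * q ^+ 2) => x.
  rewrite -!mulrA ![_^-1 * Cn]mulrC !mulrA; move: (x * Cn) => {}x; lra.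
(* One edge is removed from each saturated set inside [X], so copies in [G'] contain no saturated
   set. Since [G'] has more copies inside [X] than [Fam] has, one of them is new. *)
pose pe (U : graph W) : option (edge W) := [pick e in U].
pose G' : graph W := [set e in G | (endpoints e \subset X) &&
  ~~ [exists U : graph W, [&& st U, cov U \subset X & pe U == Some e]]].
have G'big : eX X - bX X <= #|G'|%:R.
  rewrite lerBlDr /bX /eX.
  rewrite (_ : #|G'|%:R = \sum_(e in G) (e \in G')%:R); last first.
    rewrite -sum1_card natr_sum [RHS]big_mkcond [LHS]big_mkcond /=; apply: eq_bigr => e _.
    by rewrite [e \in G']inE; case: (e \in G) => //=; case: ifP.
  apply: (@le_trans _ _ (\sum_(e in G) ((e \in G')%:R +
     \sum_(U | st U) (((cov U \subset X) && (pe U == Some e))%:R : R)))).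
    apply: ler_sum => e eG; rewrite inE eG /=.
    case: (boolP (endpoints e \subset X)) => /= [eX'|_]; last first.
      by rewrite addr_ge0 // sumr_ge0.
    case: (boolP [exists U, _]) => [/existsP[U /and3P[sU cU pU]]|_] /=.
      by rewrite add0r (bigD1 U) //= cU pU lerDl sumr_ge0.
    by rewrite lerDl sumr_ge0.
  rewrite big_split /= lerD2l exchange_big /=; apply: ler_sum => U _.
  case: (cov U \subset X) => /=; last by rewrite big1.
  case pU : (pe U) => [e|]; last by rewrite big1.
  rewrite big_mkcond (bigD1 e) //= big1 ?addr0.
    by case: ifP => _; rewrite ?lern1 ?leq_b1.
  move=> e' ne; case: ifP => // _; case: eqP => // -[E'].
  by rewrite E' eqxx in ne.
have fX0 : 0 <= fX X by apply: sumr_ge0.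
have y4 : E * q ^+ 2 / 4 <= #|G'|%:R.
  apply: le_trans G'big; apply: le_trans HX _.
  by rewrite lerBlDr lerDl mulr_ge0 // ltW.
have fXy : fX X <= #|G'|%:R * (16 * N0 * q ^+ #|V| / (E * q ^+ 2)).
  rewrite (_ : _ / _ = gam^-1); last by rewrite /gam invf_div.
  rewrite ler_pdivlMr // mulrC; apply: le_trans G'big.
  rewrite -subr_ge0; apply: le_trans HX.
  by pos.
have G'G : G' \subset G by apply/subsetP => e; rewrite inE => /andP[].
have cnt : #|[set F in Fam | F.1 \subset X]|%:R <
    #|[set F in copies H G' | F.1 \subset X]|%:R :> R.
  apply: lt_le_trans (ES_subset ES _ _ _); rewrite ?Xm //.
  - apply: le_lt_trans (ycount _ y4); apply: le_trans fXy.
    rewrite /fX -sum1_card natr_sum big_mkcond [leRHS]big_mkcond /=.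
    by apply: ler_sum => F _; rewrite inE; case: (F \in Fam) => //=; case: ifP.
  - by move=> e; rewrite inE => /and3P[].
  - exact: lt_le_trans yC y4.
have [F] : exists F, F \in [set F in copies H G' | F.1 \subset X] :\: 
     [set F in Fam | F.1 \subset X].
  apply/set0Pn; apply: contraTneq cnt => /eqP; rewrite setD_eq0 => /subset_leq_card.
  by rewrite -leNgt ler_nat.
rewrite in_setD => /andP[nA]; rewrite inE => /andP[FG' FX].
have FnF : F \notin Fam by apply: contra nA => FF; rewrite inE FF.
exists F; split=> //; first exact: (subsetP (copiesS _ G'G)).
move=> U UF; apply/negP => sU.
have [_ _ FsG' _] := copies_card FG'.
have UG' := subset_trans UF FsG'.
have [U0 _ _] := and3P sU.
have [e pU eU] : exists2 e, pe U = Some e & e \in U.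
  rewrite /pe; case: pickP => [e eU|no]; first by exists e.
  by case/set0Pn: U0 => e; rewrite no.
have := subsetP UG' _ eU; rewrite inE => /and3P[_ _ /existsP[]]; exists U.
rewrite /st sU pU eqxx andbT /= cov_sub; apply/forall_inP => e' /(subsetP UG').
by rewrite inE => /and3P[].
Qed.

End Extension.
Section BalancedSupersaturation.

Lemma card_edge (V : finType) : #|{: edge V}| = 'C(#|V|, 2).
Proof. by rewrite card_sig -card_draws; apply: eq_card => A; rewrite !inE. Qed.

Lemma card_graph_le (n : nat) (G : graph 'I_n) : (#|G| <= n ^ 2)%N.
Proof.
apply: leq_trans (max_card _) _; rewrite card_edge card_ord bin2 -divn2 -mulnn.
by rewrite (leq_trans (leq_div _ _)) // leq_mul // leq_pred.
Qed.

Variables (R : realType) (V : finType) (H : graph V).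
Local Notation m2 := (m2star R H).

Lemma m2star_ub (U : graph V) : U \subset H -> (2 < #|cov U|)%N -> ~~ full H U ->
  #|U|%:R - 1 <= m2 * (#|cov U|%:R - 2).
Proof.
move=> UH c2 nf.
have c0 : 0 < #|cov U|%:R - 2 :> R by rewrite subr_gt0 ltr_nat.
rewrite -ler_pdivrMr //; apply: ub_le_sup; last first.
  exists (cov U, U); split=> //=.
    rewrite inE UH /=; apply/forall_inP => e; exact: endpoints_cov.
  by case=> cU UE; move: nf; rewrite /full cU cardsT UE !eqxx.
exists #|H|%:R => d [F [FH _ F2 ->]].
have F0 : 1 <= #|F.1|%:R - 2 :> R by rewrite lerBrDr -(natrD _ 1 2) ler_nat.
rewrite ler_pdivrMr ?(lt_le_trans _ F0) //.
have : #|F.2|%:R <= #|H|%:R :> R.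
  by rewrite ler_nat subset_leq_card //; move: FH; rewrite inE => /andP[].
have : 0 <= #|H|%:R :> R by [].
by nra.
Qed.

Lemma fdeg_full (W : finType) (G : graph W) (Fam : {set {set W} * graph W})
   (U : graph W) : Fam \subset copies H G -> full H U -> (fdeg Fam U <= 1)%N.
Proof.
move=> FG /andP[/eqP UH /eqP cU].
apply: (@leq_trans #|[set (cov U, U)]|); last by rewrite cards1.
apply: subset_leq_card; apply/subsetP => -[F1 F2]; rewrite !inE /= => /andP[FF UF].
have [c1 c2 _ cF] := copies_card (subsetP FG _ FF).
have E2 : U = F2 by apply/eqP; rewrite eqEcard UF c2 UH leqnn.
have E1 : cov U = F1 by apply/eqP; rewrite eqEcard E2 cF -E2 c1 cU leqnn.
by rewrite E2 -E2 E1.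
Qed.

(** A largest family with all degrees at most [thr + 1] has at least [N0] members: otherwise
    [unsaturated_copy] supplies a copy that can be added, and the [+ 1] is the room this takes. The
    definition of [m2star] turns the power [#|cov U| - 2] of [q] into the power [(#|U| - 1) / m2],
    and q of order k^(-1/(2-alpha)) makes this a power of k^(-lambda). *)
Lemma balanced_supersaturation (alpha : R) :
  ES_good alpha H -> 0 < alpha -> alpha < 2 -> (1 < #|H|)%N -> 0 < m2 ->
  exists k0 c1 M : R, exists n1 : nat, [/\ 1 <= k0, 0 < c1, 0 < M &
  forall n : nat, (n1 <= n)%N -> forall G : graph 'I_n,
  let E : R := #|G|%:R in let k := E / n%:R `^ alpha in
  let N0 := c1 * (E ^+ #|H| / n%:R `^ (2 * #|H|%:R - #|V|%:R)) in
  k0 * n%:R `^ alpha <= E ->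
  exists Fam : {set {set 'I_n} * graph 'I_n}, [/\ Fam \subset copies H G, N0 <= #|Fam|%:R &
    forall U : graph 'I_n, U != set0 ->
    (fdeg Fam U)%:R <=
       M * (N0 / E) * (k `^ (- lambdastar alpha H)) ^+ #|U|.-1 + 1] ].
Proof.
case=> [C' [c [C'0 c0 [n0 ES]]]] a0 a2 l1 m20.
have b0 : 0 < 2 - alpha by rewrite subr_gt0.
pose be := (2 - alpha)^-1; have be0 : 0 < be by rewrite invr_gt0.
(* The first entry gives the random vertex set at least [n0 + 2] elements. In the second, one factor
   4 pays for the rounding [x / 2 <= q] and the other for keeping only a quarter of [E * q ^+ 2]. *)
pose Cq : R := Num.max ((n0 + 2)%:R `^ (2 - alpha)) (16 * C' + 1).
have Cq1 : 1 <= Cq.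
  by rewrite le_max; apply/orP; right; rewrite lerDr; pos.
have Cq0 : 0 < Cq by apply: lt_le_trans Cq1.
pose l := #|H|; pose l' := l.-1; pose h := #|V|.
have lE : l = l'.+1 by rewrite /l' prednK // ltnW.
(* [4 ^+ l'] matches the lower bound [E * q ^+ 2 / 4] on [y], and 32 is the 16 of [H2] with a factor
   2 to make it strict. *)
pose c1 := c / (32 * 4 ^+ l').
have c10 : 0 < c1 by rewrite /c1; pos.
pose lam := lambdastar alpha H.
have lamE : lam = be / m2 by rewrite /lam /lambdastar /be; field; rewrite !gt_eqF.
have lam0 : 0 < lam by rewrite lamE; pos.
exists Cq, c1, (2 ^+ (l + 4) * (Cq `^ lam) ^+ l), 1%N; split=> //; first by pos.
move=> n n1 G E k N0 kE.
have n0R : 0 < n%:R :> R by rewrite ltr0n.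
have na0 : 0 < n%:R `^ alpha :> R by pos.
have E0 : 0 < E by apply: lt_le_trans kE; pos.
have k0 : Cq <= k by rewrite /k ler_pdivlMr.
have kp : 0 < k by apply: lt_le_trans k0.
have kn : k <= n%:R `^ (2 - alpha).
  rewrite /k ler_pdivrMr // -powRD ?subrK; last by rewrite gt_eqF ?implybT.
  rewrite powR_mulrn ?ler0n // -natrX ler_nat.
  exact: card_graph_le.
have EE : E = k * n%:R `^ alpha by rewrite /k divfK ?gt_eqF.
pose x := (Cq / k) `^ be.
have x0 : 0 < x by rewrite /x; pos.
have x1 : x <= 1.
  rewrite /x [leRHS](_ : 1 = 1 `^ be); last by rewrite powR1.
  apply: ge0_ler_powR; rewrite ?nnegrE; try by pos.
  by rewrite ler_pdivrMr ?mul1r.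
have xb : x `^ (2 - alpha) = Cq / k.
  by rewrite /x -powRrM mulVf ?gt_eqF // powRr1 //; pos.
have nx : (n0 + 2)%:R <= n%:R * x.
  have -> : n%:R * x = (n%:R `^ (2 - alpha) * (Cq / k)) `^ be.
    rewrite powRM; try by pos.
    by rewrite -powRrM mulfV ?gt_eqF // powRr1.
  have -> : (n0 + 2)%:R = ((n0 + 2)%:R `^ (2 - alpha)) `^ be :> R.
    by rewrite -powRrM mulfV ?gt_eqF // powRr1.
  apply: ge0_ler_powR; rewrite ?nnegrE; try by pos.
  apply: (@le_trans _ _ Cq); first by rewrite le_max lexx.
  by rewrite mulrCA ler_peMr ?(ltW Cq0) // ler_pdivlMr ?mul1r.
pose m := Num.truncn (n%:R * x).
have nx0 : 0 <= n%:R * x by pos.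
have mle : m%:R <= n%:R * x by rewrite truncn_le.
have mge : (n0 + 2 <= m)%N by rewrite truncn_ge_nat.
have mn : (m <= n)%N by rewrite -(ler_nat R) (le_trans mle) // ler_piMr.
have m2' : (2 <= m)%N by rewrite (leq_trans _ mge) // leq_addl.
pose q : R := m%:R / n%:R.
have q0 : 0 < q by rewrite divr_gt0 ?ltr0n // ltnW.
have qx : q <= x by rewrite ler_pdivrMr // mulrC.
have q1 : q <= 1 by apply: le_trans x1.
have xq : x / 2 <= q.
  rewrite ler_pdivlMr // mulrAC ler_pdivrMr // [x * _]mulrC.
  have := truncnS_gt (n%:R * x); rewrite -/m -natr1 => /ltW.
  have : 1 <= m%:R :> R by rewrite ler1n ltnW.
  by clear; move: (n%:R * x) m%:R => u v; lra.
have mE : m%:R = n%:R * q by rewrite /q mulrC divfK ?gt_eqF.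
have N00 : 0 < N0 by rewrite /N0; pos.
have H1 : C' * m%:R `^ alpha < E * q ^+ 2 / 4.
  rewrite mE powRM ?(ltW q0) // EE.
  have -> : q ^+ 2 = q `^ (2 - alpha) * q `^ alpha.
    by rewrite -powRD ?subrK ?powR_mulrn ?(ltW q0) // gt_eqF ?implybT.
  rewrite [ltRHS](_ : _ = (k * q `^ (2 - alpha) / 4) * (n%:R `^ alpha * q `^ alpha)); last by ring.
  rewrite ltr_pM2r; last by pos.
  rewrite ltr_pdivlMr // mulrC.
  have : Cq / 4 <= k * q `^ (2 - alpha).
    apply: (@le_trans _ _ (k * (x / 2) `^ (2 - alpha))); last first.
      by rewrite ler_pM2l //; apply: ge0_ler_powR; rewrite ?nnegrE ?(ltW b0) //; pos.
    rewrite powRM; try by pos.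
    rewrite xb mulrCA [X in _ <= X](_ : _ = Cq * 2^-1 `^ (2 - alpha)); last first.
      by field; rewrite gt_eqF.
    rewrite ler_pM2l //.
    have -> : 4^-1 = 2^-1 `^ 2 :> R by rewrite powR_mulrn ?invr_ge0 // exprVn -natrX.
    by apply: ger_powR; clear -a0 a2; lra.
  have : 16 * C' + 1 <= Cq by rewrite le_max lexx orbT.
  lra.
have H2 y : E * q ^+ 2 / 4 <= y ->
     y * (16 * N0 * q ^+ h / (E * q ^+ 2)) <
     c * (y ^+ l / m%:R `^ (2 * l%:R - h%:R)).
  set w := E * q ^+ 2 / 4 => yw.
  have w0 : 0 < w by rewrite /w; pos.
  have y0 : 0 < y by apply: lt_le_trans yw.
  have -> : m%:R `^ (2 * l%:R - h%:R) =
      n%:R `^ (2 * l%:R - h%:R) * (q ^+ 2 * (q ^+ 2) ^+ l' / q ^+ h) :> R.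
    rewrite mE powRM ?(ltW q0) //; congr (_ * _).
    rewrite powRB; last by rewrite (gt_eqF q0) implybT.
    rewrite -natrM !powR_mulrn ?(ltW q0) //.
    by rewrite exprM lE exprS.
  rewrite lE (exprS y) -(mulrA y) [ltRHS]mulrCA.
  rewrite ltr_pM2l //.
  apply: (@lt_le_trans _ _ (c * (w ^+ l' / (n%:R `^ (2 * l'.+1%:R - h%:R) * (q ^+ 2 * (q ^+ 2) ^+ l' / q ^+ h))))); last first.
    rewrite ler_pM2l // ler_pM2r; last by pos.
    by rewrite lerXn2r ?nnegrE ?(ltW w0) ?(ltW y0).
  rewrite /N0 -/l -/h /w lE.
  have nl0 : 0 < n%:R `^ (2 * l'.+1%:R - h%:R) :> R by pos.
  have Q2 : 0 < q ^+ 2 by pos.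
  have Qh : 0 < q ^+ h by pos.
  have El : 0 < E ^+ l' by pos.
  have F4 : 0 < 4 ^+ l' :> R by pos.
  rewrite (exprS E) /c1.
  move: (n%:R `^ _) (q ^+ 2) (q ^+ h) nl0 Q2 Qh => N2 u v nl0 Q2 Qh.
  have Ql : 0 < u ^+ l' by pos.
  rewrite !exprMn exprVn.
  move: (E ^+ l') (u ^+ l') (4 ^+ l') El Ql F4 => a b d El Ql F4.
  rewrite [ltLHS](_ : _ = c * a * v / (2 * d * N2 * u)); last by field; rewrite !gt_eqF.
  rewrite [ltRHS](_ : _ = (c * a * v / (2 * d * N2 * u)) * 2); last by field; rewrite !gt_eqF.
  have : 0 < c * a * v / (2 * d * N2 * u) by pos.
  by clear; move: (_ / _) => t; lra.
pose thr v : R := 2 ^+ (l + 4) * N0 / E * q ^+ (v - 2).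
have thr0 v : 0 < thr v by rewrite /thr; pos.
pose ok (Fam : {set {set 'I_n} * graph 'I_n}) := (Fam \subset copies H G) &&
  [forall U : graph 'I_n, (U != set0) && ~~ full H U ==>
     ((fdeg Fam U)%:R <= thr #|cov U| + 1)].
have ok0 : ok set0.
  rewrite /ok sub0set; apply/forallP => U; apply/implyP => _.
  rewrite /fdeg (_ : [set _ in _ | _] = set0) ?cards0 ?addr_ge0 ?(ltW (thr0 _)) //.
  by apply/setP => F; rewrite !inE.
have [Fam /andP[FG /forallP Fdeg] Fmax] := arg_maxnP (fun Fam : {set {set 'I_n} * graph 'I_n} => #|Fam|) ok0.
exists Fam; split=> //.
  rewrite leNgt; apply/negP => FN.
  have qE : q = m%:R / #|'I_n|%:R by rewrite card_ord.
  have [] := unsaturated_copy ES (erefl E) qE FG FN E0 m2' _ _ H1 H2.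
  - by rewrite (leq_trans _ mge) // leq_addr.
  - by rewrite card_ord.
  move=> F [FH FnF Fsat].
  have : ok (F |: Fam).
    rewrite /ok subUset sub1set FH FG /=; apply/forallP => U.
    apply/implyP => HU; have /andP[U0 Uf] := HU.
    have le1 : (fdeg (F |: Fam) U <= (U \subset F.2) + fdeg Fam U)%N.
      rewrite /fdeg (_ : [set _ in F |: Fam | _] =
        [set F' in [set F] | U \subset F'.2] :|: [set F' in Fam | U \subset F'.2]).
        rewrite (leq_trans (leq_card_setU _ _)) // leq_add2r.
        case: (boolP (U \subset F.2)) => UF.
          apply: (@leq_trans #|[set F]|); last by rewrite cards1.
          apply: subset_leq_card.
          by apply/subsetP => F'; rewrite !inE => /andP[].
        rewrite leqn0 cards_eq0; apply/eqP/setP => F'; rewrite !inE.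
        by apply/negP => /andP[/eqP -> UF']; rewrite UF' in UF.
      by apply/setP => F'; rewrite !inE andb_orl.
    case: (boolP (U \subset F.2)) le1 => UF le1; last first.
      by apply: le_trans (implyP (Fdeg U) HU); rewrite ler_nat.
    apply: (@le_trans _ _ (1 + (fdeg Fam U)%:R)); first by rewrite nat1r ler_nat.
    rewrite addrC lerD2r ltW //.
    by have := Fsat U UF; rewrite /sat U0 Uf /= -ltNge.
  by move/Fmax; rewrite cardsU1 FnF /= add1n ltnn.
move=> U U0.
have [fU|nf] := boolP (full H U).
  apply: (@le_trans _ _ 1); first by rewrite lern1 (fdeg_full FG).
  by rewrite lerDr; pos.
have := implyP (Fdeg U); rewrite U0 nf => /(_ isT).
have [->|] := eqVneq (fdeg Fam U) 0%N; first by move=> _; pos.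
rewrite -lt0n => /card_gt0P[F]; rewrite inE => /andP[/(subsetP FG) FH UF].
move/le_trans; apply; rewrite lerD2r /thr.
have -> : 2 ^+ (l + 4) * (Cq `^ lam) ^+ l * (N0 / E) = 2 ^+ (l + 4) * N0 / E * (Cq `^ lam) ^+ l.
  by rewrite mulrAC mulrA.
rewrite -(mulrA _ ((Cq `^ lam) ^+ l)).
rewrite ler_pM2l; last by pos.
have [U' [U'H cU' covU']] := copies_sub FH UF.
have Ul : (#|U| <= l)%N by rewrite -cU' subset_leq_card.
have Cl1 : 1 <= Cq `^ lam.
  by rewrite -[leLHS](powRr0 Cq) ler_powR // ltW.
have [U1|U2] := leqP #|U| 1.
  have -> : (#|U|.-1 = 0)%N by move: U1; case: #|U| => [|[|]].
  rewrite expr0 mulr1 (le_trans _ (exprn_ege1 _ Cl1)) // exprn_ile1 //.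
  exact: ltW.
have nf' : ~~ full H U' by rewrite /full cU' covU'.
have c2 := cov_gt2 U2.
have := m2star_ub U'H; rewrite covU' cU' => /(_ c2 nf').
have -> : #|U|%:R - 1 = #|U|.-1%:R :> R by rewrite -[in LHS](@prednK #|U|) ?(ltnW U2) // -natr1 addrK.
have -> : #|cov U|%:R - 2 = (#|cov U| - 2)%:R :> R by rewrite natrB // ltnW.
rewrite mulrC -ler_pdivrMr // => vle.
rewrite -powR_mulrn ?(ltW q0) //.
apply: (@le_trans _ _ (q `^ (#|U|.-1%:R / m2))).
  by apply: ger_powR => //; rewrite q0.
apply: (@le_trans _ _ (x `^ (#|U|.-1%:R / m2))).
  by apply: ge0_ler_powR; rewrite ?nnegrE ?(ltW q0) ?(ltW x0) //; pos.
have -> : x `^ (#|U|.-1%:R / m2) = (Cq `^ lam * k `^ (- lam)) ^+ #|U|.-1.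
  have -> : Cq `^ lam * k `^ (- lam) = (Cq / k) `^ lam.
    rewrite powRM; [|by pos..].
    by rewrite -(powR_inv1 (ltW kp)) -powRrM mulN1r.
  rewrite /x -powRrM -powR_mulrn; last by pos.
  by rewrite -powRrM; congr (_ `^ _); rewrite lamE; ring.
rewrite exprMn ler_pM2r; last by pos.
by rewrite ler_weXn2l // (leq_trans (leq_pred _)).
Qed.
End BalancedSupersaturation.
(** * Containers for H-free graphs *)

Section ContainerStep.
Variables (R : realType) (V : finType) (H : graph V) (alpha : R).
Local Notation lam := (lambdastar alpha H).
Local Notation ph := (phi alpha H).

(** The container lemma is applied to the balanced family with [p] the larger of k^(-lambda) and
    [s]. The first handles the main term of the degree bound; [s] is the least value for which the
    additive 1 is still dominated for whole copies. Multiplied by [#|G|], they give the two terms of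
    the fingerprint size. *)
Lemma container_step :
  ES_good alpha H -> 0 < alpha -> alpha < 2 -> (1 < #|H|)%N -> 1 <= m2star R H ->
  1 < lam -> 0 <= ph ->
  exists k0 C rho : R, exists n1 : nat, [/\ 1 <= k0, 0 < C, 0 < rho < 1 &
  forall n : nat, (n1 <= n)%N -> forall G : graph 'I_n,
  let k : R := #|G|%:R / n%:R `^ alpha in
  k0 * n%:R `^ alpha <= #|G|%:R ->
  exists SF, is_container (is_free H) G
    (C * n%:R `^ alpha * (k `^ (1 - lam) + n%:R `^ (- ph))) (rho * #|G|%:R) SF].
Proof.
move=> good a0 a2 l1 m21 lam1 ph0.
have m20 : 0 < m2star R H by apply: lt_le_trans m21.
have [k0 [c1 [M [n1 [k01 c10 M0 bal]]]]] := balanced_supersaturation good a0 a2 l1 m20.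
pose l' := #|H|.-1; have lE : #|H| = l'.+1 by rewrite /l' prednK // ltnW.
(* [M] comes from the main term of the degrees and [c1^-1] from the additive 1. *)
pose kap := (M + c1^-1)^-1.
have kap0 : 0 < kap by rewrite /kap; pos.
have [del /andP[del0 del1] cont] := container_lemma l' kap0.
exists k0, (2 * l'.+1%:R), (1 - del), (maxn n1 1); split=> //; first by pos.
  by rewrite subr_gt0 del1 gtrBl.
move=> n; rewrite geq_max => /andP[nn1 n1'] G k kG.
have n0R : 1 <= n%:R :> R by rewrite ler1n.
have n0 : 0 < n%:R :> R by apply: lt_le_trans n0R.
set na := n%:R `^ alpha in k kG *.
have na0 : 0 < na by rewrite /na; pos.
have [Fam [FG N0F Fdeg]] := bal n nn1 G kG.
pose E : R := #|G|%:R; rewrite -/E in kG N0F Fdeg *.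
have k1 : 1 <= k by rewrite /k ler_pdivlMr // mul1r (le_trans _ kG) // ler_peMl // ltW.
have kp : 0 < k by apply: lt_le_trans k1.
have EE : E = k * na by rewrite /k divfK ?gt_eqF.
have E0 : 0 < E by rewrite EE; pos.
pose s := (k * n%:R `^ ph)^-1.
have s0 : 0 < s by rewrite /s; pos.
set N0 := c1 * _ in N0F Fdeg.
pose D := N0 / E.
(* This is where the formula for [phi] comes from: the average degree N0/E is c1 times the (l-1)-st
   power of k n^phi. *)
have DE : D = c1 * s ^- l'.
  have phE : ph * l'%:R = alpha * l'%:R - (2 * #|H|%:R - #|V|%:R).
    have l'0 : l'%:R != 0 :> R by rewrite pnatr_eq0 -lt0n -ltnS -lE.
    rewrite /phi lE -!natr1 !addrK.
    by move: (l'%:R) l'0 (#|V|%:R) => x x0 y; clear -x0; field.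
  have nph : (n%:R `^ ph) ^+ l' = na ^+ l' / n%:R `^ (2 * #|H|%:R - #|V|%:R).
    rewrite -powR_mulrn ?powR_ge0 // -powRrM phE powRB; last first.
      by rewrite (gt_eqF n0) implybT.
    by rewrite powRrM powR_mulrn ?powR_ge0.
  rewrite /D /N0 /s exprVn invrK exprMn nph EE; clearbody k na.
  move: (n%:R `^ _) (powR_gt0 (2 * #|H|%:R - #|V|%:R) n0) => z z0.
  have ka0 : 0 < k ^+ l' by pos.
  have na'0 : 0 < na ^+ l' by pos.
  rewrite lE exprS exprMn.
  move: (k ^+ l') (na ^+ l') ka0 na'0 => a b a0' b0'.
  by clear -kp na0 z0; field; rewrite !gt_eqF.
have D0 : 0 < D by rewrite DE; pos.
pose p := Num.max (k `^ (- lam)) s.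
have kl0 : 0 < k `^ (- lam) by pos.
have p0 : 0 < p by rewrite lt_max kl0.
have p1 : p <= 1.
  rewrite ge_max; apply/andP; split.
    by rewrite -(powRr0 k) ler_powR // oppr_le0 ltW // (lt_trans _ lam1).
  rewrite invf_le1; last by pos.
  rewrite mulr_ege1 //.
  by have := ler_powR n0R ph0; rewrite powRr0.
have pE : p * E <= na * (k `^ (1 - lam) + n%:R `^ (- ph)).
  have -> : na * (k `^ (1 - lam) + n%:R `^ (- ph)) = (k `^ (- lam) + s) * E.
    rewrite powRD ?(gt_eqF kp) ?implybT // powRr1 ?(ltW kp) // EE /s invfM -powRN.
    by field; rewrite gt_eqF.
  by rewrite ler_pM2r // ge_max lerDl lerDr !ltW.
(* Rounding [p * E] up to the integer [b] then costs at most a factor 2. *)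
have pE1 : 1 <= p * E.
  apply: (@le_trans _ _ (k `^ (- lam) * E)); last by rewrite ler_pM2r // le_max lexx.
  have kn : k <= n%:R `^ (2 - alpha).
    rewrite /k ler_pdivrMr // -powRD ?subrK; last by rewrite (gt_eqF n0) implybT.
    by rewrite powR_mulrn ?ler0n // -natrX ler_nat card_graph_le.
  have -> : k `^ (- lam) * E = na / k `^ (lam - 1).
    rewrite powRB ?(gt_eqF kp) ?implybT // powRr1 ?(ltW kp) // powRN EE.
    by field; rewrite !gt_eqF ?powR_gt0.
  rewrite ler_pdivlMr ?mul1r; last by pos.
  apply: (@le_trans _ _ ((n%:R `^ (2 - alpha)) `^ (lam - 1))).
    by apply: ge0_ler_powR; rewrite ?nnegrE ?subr_ge0 ?(ltW lam1) //; pos.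
  rewrite -powRrM; apply: ler_powR => //.
  have -> : (2 - alpha) * (lam - 1) = (m2star R H)^-1 - 2 + alpha.
    by rewrite /lambdastar; field; rewrite gt_eqF // gt_eqF // subr_gt0.
  have : (m2star R H)^-1 <= 1 by rewrite invf_le1.
  clear; lra.
(* When [H] has isolated vertices, several copies can share an edge set; weights keep their
   multiplicity. *)
pose w (e : graph 'I_n) : R := #|[set F in Fam | F.2 == e]|%:R.
have wdegE U : wdeg w U = (fdeg Fam U)%:R.
  rewrite /wdeg /w -natr_sum; congr _%:R.
  rewrite /fdeg -sum1_card (partition_big (fun F : {set 'I_n} * graph 'I_n => F.2) (fun e => U \subset e)) /=; last first.
    by move=> F; rewrite inE => /andP[].
  apply: eq_bigr => e Ue; rewrite -sum1_card; apply: eq_bigl => F.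
  by rewrite !inE; case: eqP => [->|]; rewrite ?Ue ?andbT ?andbF.
have wpos e : w e != 0 -> exists2 F, F \in Fam & F.2 = e.
  rewrite pnatr_eq0 -lt0n => /card_gt0P[F]; rewrite inE => /andP[FF /eqP <-].
  by exists F.
pose b := (Num.truncn (p * E)).+1.
have bE : b%:R <= 2 * (p * E).
  rewrite /b -natr1; have : (Num.truncn (p * E))%:R <= p * E.
    by rewrite truncn_le; pos.
  by move: pE1; clear; lra.
have [|||||||SF HSF] := cont _ G p ((M + c1^-1) * D) b w.
- by rewrite p0.
- by pos.
- exact/ltW/truncnS_gt.
- by move=> e; rewrite /w.
- move=> e /wpos [F FF <-]; have [_ -> FsG _] := copies_card (subsetP FG _ FF).
  by rewrite lE.
- move=> U U0; rewrite wdegE.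
  have [->|] := eqVneq (fdeg Fam U) 0%N; first by pos.
  rewrite -lt0n => /card_gt0P[F]; rewrite inE => /andP[FF UF].
  have [_ F2 _ _] := copies_card (subsetP FG _ FF).
  have Ul : (#|U|.-1 <= l')%N by rewrite /l' -F2 -!subn1 leq_sub2r // subset_leq_card.
  apply: le_trans (Fdeg U U0) _; rewrite -/D 2!mulrDl; apply: lerD.
    rewrite ler_pM2l; last by pos.
    rewrite lerXn2r ?nnegrE ?(ltW kl0) ?(ltW p0) //.
    by rewrite le_max lexx.
  apply: (@le_trans _ _ (c1^-1 * (D * s ^+ l'))).
    by rewrite DE mulrA mulrA mulVf ?gt_eqF // mul1r mulVf // gt_eqF //; pos.
  rewrite mulrA ler_pM2l; last by pos.
  apply: (@le_trans _ _ (p ^+ l')).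
    by rewrite lerXn2r ?nnegrE ?(ltW s0) ?(ltW p0) // le_max lexx orbT.
  by rewrite ler_wiXn2l // ltW.
- rewrite /kap mulrA mulVf ?mul1r ?gt_eqF //; last by pos.
  rewrite /D divfK ?gt_eqF // (le_trans N0F) //.
  have -> : wtot w = wdeg w set0.
    by rewrite /wtot /wdeg; apply: eq_bigl => e; rewrite sub0set.
  rewrite wdegE ler_nat /fdeg; apply: subset_leq_card; apply/subsetP => F FF.
  by rewrite inE FF sub0set.
exists SF => I IG If.
have wI : `[< windep w I >].
  apply/asboolP => e eI; apply/eqP/negPn/negP => /wpos [F FF Fe].
  have /copiesP [f [fi [F1 F2 _]]] := subsetP FG _ FF.
  have : F \in copies H I by apply/copiesP; exists f, fi; split=> //; rewrite Fe.
  by move: If; rewrite /is_free cards_eq0 => /eqP ->; rewrite inE.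
have [SI cS cov [FI cF] cons] := HSF I IG wI.
split=> //; apply: le_trans cS _.
rewrite natrM -mulrA (mulrC 2) -mulrA.
apply: (@le_trans _ _ (l'.+1%:R * (2 * (p * E)))).
  by rewrite ler_pM ?ler_nat.
rewrite ler_pM2l ?ltr0n //; move: pE; clear; move: (na * _) (p * E) => x y; lra.
Qed.

End ContainerStep.

(** * Iterated containers and the generating function of their fingerprints *)

Section Iteration.
Variables (R : realType) (T : finType) (P : pred {set T}).

Definition fingerprints (G : {set T}) (SF : {set T} -> {set T} * {set T}) :
    {set {set T}} :=
  [set (SF I).1 | I in [set I : {set T} | (I \subset G) && P I]].

(** The sum is (1+y)^|G| by the binomial theorem. *)
Lemma sum_subset_pow (G : {set T}) (y : R) : 0 <= y ->
  \sum_(A : {set T} | A \subset G) y ^+ #|A| <= expR (y * #|G|%:R).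
Proof.
move=> y0.
apply: (@le_trans _ _ (\prod_(i in G) (y + 1))); last first.
  rewrite prodr_const mulrC expRM_natl lerXn2r ?nnegrE ?expR_ge0 ?addr_ge0 //.
  by rewrite addrC expR_ge1Dx.
rewrite le_eqVlt; apply/orP; left; apply/eqP.
transitivity (\prod_i ((if i \in G then y else 0) + 1)); last first.
  rewrite [RHS]big_mkcond; apply: eq_bigr => i _.
  by case: ifP => //; rewrite add0r.
rewrite (@bigA_distr _ 0 1) [LHS]big_mkcond; apply: eq_bigr => A _.
case: ifP => [AG|/negbT/subsetPn[i iA iG]]; last first.
  by rewrite (bigD1 i) //= iA (negPf iG) mul0r.
rewrite -big_mkcond /= -[LHS]prodr_const; apply: eq_bigr => i iA.
by rewrite (subsetP AG).
Qed.

Lemma sum_cover_le (I J : finType) (D : {set J}) (Q : {set I}) (u : I -> J) (f : J -> R) :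
  (forall j, 0 <= f j) -> (forall j, j \in D -> exists2 i, i \in Q & u i = j) ->
  \sum_(j in D) f j <= \sum_(i in Q) f (u i).
Proof.
move=> f0 DQ; rewrite (partition_big u predT) //= [leLHS]big_mkcond.
apply: ler_sum => j _; case: ifP => [/DQ [i iQ uij]|_]; last by rewrite sumr_ge0.
by rewrite (bigD1 i) /= ?iQ ?uij ?eqxx // lerDl sumr_ge0.
Qed.

Hypothesis Pmono : forall I J : {set T}, J \subset I -> P I -> P J.

Variables (rho z M : R) (t : nat -> R).
Hypotheses (rho0 : 0 < rho) (rho1 : rho < 1) (z0 : 0 < z) (M0 : 0 < M).
Hypothesis t0 : forall r, 0 <= t r.
Hypothesis step : forall r (G : {set T}), M * rho ^- r < #|G|%:R ->
  exists SF, is_container P G (t r) (rho * #|G|%:R) SF.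

(* In round i each chosen element gets weight z rho^(2i), so that the choices among
   the M rho^-(i+1) available elements contribute a geometric sum. *)
Definition log_weight r : R :=
  \sum_(i < r) (- (2 * i%:R * t i * ln rho) + z * M * rho ^+ i / rho).

Lemma log_weightS_ge r : log_weight r <= log_weight r.+1.
Proof.
rewrite /log_weight big_ord_recr /= lerDl addr_ge0 //; last by pos.
rewrite -mulrN mulr_ge0 ?oppr_ge0 ?mulr_ge0 ?ler0n ?t0 //.
by rewrite ltW // ln_lt0 // rho0.
Qed.

(** One step shrinks [G] by [rho], and induction treats what is left of [I] in the new container. A
    pair of fingerprints from the two stages determines the final one, and the sizes of the two add
    up, so the weighted sum is at most the product of the sums of the stages. *)
Lemma container_iter r (G : {set T}) : #|G|%:R <= M * rho ^- r ->
  exists SF, is_container P G (\sum_(i < r) t i) M SF /\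
    \sum_(J in fingerprints G SF) z ^+ #|J| <= expR (log_weight r).
Proof.
elim: r G => [|r IH] G Gr.
  exists (fun=> (set0, G)); split.
    move=> I IG _; split=> //=.
    - exact: sub0set.
    - by rewrite cards0 big_ord0.
    - by rewrite set0U.
    by split=> //; rewrite expr0 invr1 mulr1 in Gr.
  rewrite /log_weight big_ord0 expR0.
  apply: (@le_trans _ _ (\sum_(J in [set (set0 : {set T})]) z ^+ #|J|)).
    rewrite big_mkcond [leRHS]big_mkcond /=; apply: ler_sum => J _.
    case: ifP => [/imsetP[I _ ->]|_]; first by rewrite inE eqxx.
    by case: ifP => // _; pos.
  by rewrite big_set1 cards0.
have [small|big] := leP #|G|%:R (M * rho ^- r).
  have [SF [contSF wSF]] := IH G small; exists SF; split; last first.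
    by apply: le_trans wSF _; rewrite ler_expR log_weightS_ge.
  move=> I IG PI; have [h1 h2 h3 h4 h5] := contSF I IG PI; split=> //.
  by rewrite big_ord_recr /= (le_trans h2) // lerDl.
have [SF1 cont1] := step big.
have IHall (G' : {set T}) : exists SF : {set T} -> {set T} * {set T},
    #|G'|%:R <= M * rho ^- r ->
    is_container P G' (\sum_(i < r) t i) M SF /\
    \sum_(J in fingerprints G' SF) z ^+ #|J| <= expR (log_weight r).
  have [le|gt] := leP #|G'|%:R (M * rho ^- r); last by exists (fun=> (set0, set0)).
  by have [SF HSF] := IH G' le; exists SF.
have [SF2 HSF2] := fin_all_exists IHall.
(* Removing the fingerprint from the container makes the fingerprints of different rounds disjoint,
   hence their weights multiplicative. *)
pose G1 (I : {set T}) := (SF1 I).2 :\: (SF1 I).1.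
have G1small (I : {set T}) : I \subset G -> P I -> #|G1 I|%:R <= M * rho ^- r.
  move=> IG PI; have [_ _ _ [_ c1] _] := cont1 I IG PI.
  apply: (@le_trans _ _ #|(SF1 I).2|%:R).
    by rewrite ler_nat subset_leq_card // subsetDl.
  apply: (le_trans c1); rewrite mulrC -ler_pdivlMr //.
  by rewrite -mulrA -invfM -exprSr.
exists (fun I => ((SF1 I).1 :|: (SF2 (G1 I) (I :&: G1 I)).1,
                  (SF2 (G1 I) (I :&: G1 I)).2)); split.
  move=> I IG PI.
  have [S1I cS1 cov1 [F1G _] cons1] := cont1 I IG PI.
  have PI1 : P (I :&: G1 I) by apply: Pmono PI; apply: subsetIl.
  have [cont2 _] := HSF2 _ (G1small I IG PI).
  have [S2I cS2 cov2 [F2G cF2] cons2] := cont2 _ (subsetIr _ _) PI1.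
  have S2sub : (SF2 (G1 I) (I :&: G1 I)).1 \subset I.
    exact: subset_trans S2I (subsetIl _ _).
  split=> /=.
  - by rewrite subUset S1I.
  - rewrite big_ord_recr /= addrC (le_trans _ (lerD cS1 cS2)) // -natrD ler_nat.
    exact: leq_card_setU.
  - apply/subsetP => x xI; rewrite -setUA inE; case: (boolP (x \in (SF1 I).1)) => //= xS.
    apply: (subsetP cov2); rewrite !inE xI xS /=.
    by have := subsetP cov1 _ xI; rewrite inE (negPf xS).
  - split=> //; apply: subset_trans F2G _; apply: subset_trans F1G.
    exact: subsetDl.
  move=> J /[!subUset] /andP[S1J S2J] JI.
  have E1 := cons1 J S1J JI.
  have G1E : G1 J = G1 I by rewrite /G1 E1.
  rewrite G1E E1 (cons2 (J :&: G1 I)) //.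
    by rewrite subsetI S2J; apply: subset_trans S2I (subsetIr _ _).
  exact: setSI.
set SF := (X in fingerprints G X).
pose Q := [set q : {set T} * {set T} | (q.1 \in fingerprints G SF1) &&
   (q.2 \in fingerprints (G1 q.1) (SF2 (G1 q.1)))].
have fp1 (A : {set T}) : A \in fingerprints G SF1 -> [/\ A \subset G, P A, SF1 A = (A, (SF1 A).2) & #|A|%:R <= t r].
  case/imsetP => I; rewrite inE => /andP[IG PI] ->.
  have [S1I cS1 _ _ cons1] := cont1 I IG PI.
  have E := cons1 _ (subxx _) S1I.
  split=> //; first exact: subset_trans IG.
    exact: Pmono PI.
  by rewrite E; case: (SF1 I).
have fp2 (A B : {set T}) : A \in fingerprints G SF1 ->
    B \in fingerprints (G1 A) (SF2 (G1 A)) -> #|A :|: B| = (#|A| + #|B|)%N.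
  move=> /fp1 [AG PA E _] /imsetP[I]; rewrite inE => /andP[IG PI] BE.
  have [cont2 _] := HSF2 _ (G1small A AG PA).
  have [S2I _ _ _ _] := cont2 _ IG PI.
  rewrite cardsU (_ : A :&: B = set0) ?cards0 ?subn0 //.
  apply/eqP; rewrite setI_eq0 disjoint_sym disjoints_subset BE.
  apply: subset_trans S2I _; apply: subset_trans IG _.
  by rewrite /G1 E /= setDE subsetIr.
apply: (@le_trans _ _ (\sum_(q in Q) z ^+ #|q.1 :|: q.2|)).
  apply: (@sum_cover_le _ _ _ Q (fun q => q.1 :|: q.2) (fun J => z ^+ #|J|)).
    by move=> J; pos.
  move=> J /imsetP[I]; rewrite inE => /andP[IG PI] ->.
  have [S1I cS1 _ _ cons1] := cont1 I IG PI.
  have E := cons1 _ (subxx _) S1I.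
  have G1E : G1 (SF1 I).1 = G1 I by rewrite /G1 E.
  exists ((SF1 I).1, (SF2 (G1 I) (I :&: G1 I)).1) => //.
  rewrite inE /= G1E; apply/andP; split; apply/imsetP.
    by exists I; rewrite // inE IG.
  exists (I :&: G1 I) => //; rewrite inE subsetIr /=.
  by apply: Pmono PI; apply: subsetIl.
rewrite (eq_bigl (fun q => (q.1 \in fingerprints G SF1) &&
   (q.2 \in fingerprints (G1 q.1) (SF2 (G1 q.1))))); last by move=> q; rewrite inE.
rewrite -(pair_big_dep (mem (fingerprints G SF1)) (fun A B => B \in fingerprints (G1 A) (SF2 (G1 A)))
   (fun A B => z ^+ #|A :|: B|)) /=.
apply: (@le_trans _ _ (\sum_(A in fingerprints G SF1) z ^+ #|A| * expR (log_weight r))).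
  apply: ler_sum => A A1; have [AG PA _ _] := fp1 A A1.
  have [_ w2] := HSF2 _ (G1small A AG PA).
  rewrite (eq_bigr (fun B : {set T} => z ^+ #|A| * z ^+ #|B|)); last first.
    by move=> B B2; rewrite (fp2 A B) // exprD.
  by rewrite -mulr_sumr ler_pM2l //; pos.
rewrite -mulr_suml [log_weight r.+1]/log_weight big_ord_recr /= -/(log_weight r).
rewrite addrC expRD ler_pM2r ?expR_gt0 //.
set L := expR (- (2 * r%:R * t r * ln rho)).
rewrite expRD -/L.
(* Untilted, the exponent of this round would be [z * #|G|], which can grow with [r]. Tilting each
   element by [rho ^+ (2 * r)] costs the factor [L], thanks to [#|A| <= t r], and leaves the
   exponent [z * M * rho ^+ r / rho]. *)
apply: (@le_trans _ _ (\sum_(A : {set T} | A \subset G) L * (z * rho ^+ (2 * r)) ^+ #|A|)).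
  rewrite [leLHS]big_mkcond [leRHS]big_mkcond; apply: ler_sum => A _.
  case: ifP => [/fp1 [-> _ _ cA]|_]; last by case: ifP => // _; rewrite /L; pos.
  rewrite exprMn mulrCA -[leLHS]mulr1 ler_pM2l; last by pos.
  rewrite -ler_pdivrMr; last by pos.
  rewrite mul1r -exprM -exprVn.
  have -> : rho^-1 ^+ (2 * r * #|A|) = expR (- (2 * r%:R * #|A|%:R * ln rho)).
    rewrite -[in LHS](lnK (_ : rho \in Num.pos)) // -expRN -expRM_natl !natrM.
    by congr expR; ring.
  rewrite /L ler_expR lerN2.
  have lr : ln rho <= 0 by rewrite ltW // ln_lt0 // rho0.
  by rewrite ler_wnM2r // ler_wpM2l // mulr_ge0.
rewrite -mulr_sumr ler_pM2l; last by rewrite /L; pos.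
apply: le_trans (sum_subset_pow _ _) _; first by pos.
rewrite ler_expR -!mulrA ler_pM2l //.
rewrite (mulrCA M) mulnC exprM expr2 -mulrA ler_pM2l; last by pos.
have := ler_wpM2l (ltW (exprn_gt0 r rho0)) Gr; move/le_trans; apply.
rewrite mulrCA ler_pM2l // exprSr invfM mulrA mulfV ?mul1r // gt_eqF //; pos.
Qed.

End Iteration.

(** * The round schedule and the two logarithms *)

Section ContainerFamily.
Variable R : realType.

Lemma sum_geom_le (x : R) r : 0 <= x < 1 -> \sum_(i < r) x ^+ i <= (1 - x)^-1.
Proof.
move=> /andP[x0 x1]; have h : 0 < 1 - x by rewrite subr_gt0.
rewrite -[leRHS]mul1r ler_pdivlMr // mulrC.
elim: r => [|r IH]; first by rewrite big_ord0 mulr0.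
suff -> : (1 - x) * (\sum_(i < r.+1) x ^+ i) = 1 - x ^+ r.+1.
  by rewrite gerBl exprn_ge0.
elim: r {IH} => [|r IH]; first by rewrite big_ord1 expr0 expr1 mulr1.
by rewrite big_ord_recr /= mulrDr IH (exprS _ r.+1); ring.
Qed.

Lemma sum_arith_geom_le (x : R) r : 0 <= x < 1 ->
  \sum_(i < r) i%:R * x ^+ i <= (1 - x)^-1 ^+ 2.
Proof.
move=> /andP[x0 x1]; have h : 0 < 1 - x by rewrite subr_gt0.
have tail : \sum_(i < r) i%:R * x ^+ i + (r%:R * x ^+ r / (1 - x) + x ^+ r * x / (1 - x) ^+ 2)
    = x / (1 - x) ^+ 2.
  elim: r => [|r <-]; first by rewrite big_ord0 expr0 !mul0r mul1r !add0r.
  rewrite big_ord_recr /= -natr1 exprS; move: (x ^+ r) (r%:R) (\sum_(i < r) _) => a b s.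
  by field; rewrite gt_eqF.
apply: (@le_trans _ _ (x / (1 - x) ^+ 2)).
  rewrite -tail lerDl addr_ge0 // ?divr_ge0 ?mulr_ge0 ?exprn_ge0 //; exact: ltW.
by rewrite exprVn ler_piMl ?invr_ge0 ?exprn_ge0 // ltW.
Qed.

Variables (V : finType) (H : graph V) (alpha : R).
Local Notation lam := (lambdastar alpha H).
Local Notation ph := (phi alpha H).

(** A container with k rho^(-r) n^alpha edges costs a fingerprint of order n^alpha (a th^r + eps),
    where eps = n^(-phi). The first terms form a geometric series. The sum of eps over the rounds
    needs only one logarithm; the second one pays for the tilting of the weights, which sums r
    eps. *)
Lemma container_family :
  ES_good alpha H -> 0 < alpha -> alpha < 2 -> (1 < #|H|)%N -> 1 <= m2star R H ->
  1 < lam -> 0 <= ph ->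
  exists k0 C : R, exists n1 : nat, [/\ 1 <= k0, 0 < C &
  forall n : nat, (n1 <= n)%N -> forall k : R, k0 <= k ->
  k `^ (lam - 1) <= n%:R `^ ph / ln n%:R ^+ 2 ->
  let a := k `^ (1 - lam) in
  exists SF, is_container (is_free H) [set: edge 'I_n] (C * a * n%:R `^ alpha)
      (k * n%:R `^ alpha) SF /\
    \sum_(J in fingerprints (is_free H) [set: edge 'I_n] SF) (a / k) ^+ #|J|
      <= expR (C * a * n%:R `^ alpha)].
Proof.
move=> good a0 a2 l1 m21 lam1 ph0.
have [k0 [C1 [rho [n1 [k01 C10 /andP[rho0 rho1] step]]]]] :=
  container_step good a0 a2 l1 m21 lam1 ph0.
pose L := - ln rho; have L0 : 0 < L by rewrite /L oppr_gt0 ln_lt0 // rho0.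
pose th := rho `^ (lam - 1).
have th0 : 0 < th by rewrite /th; pos.
have lam1' : 0 < lam - 1 by rewrite subr_gt0.
have th1 : th < 1.
  have := @gt0_ltr_powR _ (lam - 1) lam1' rho 1; rewrite powR1; apply=> //.
  - by rewrite nnegrE ltW.
  - by rewrite nnegrE.
pose C2 := 2 / L + 1; have C20 : 0 < C2 by rewrite /C2; pos.
pose g1 := (1 - th)^-1; pose g2 := (1 - rho)^-1.
have g10 : 0 < g1 by rewrite invr_gt0 subr_gt0.
have g20 : 0 < g2 by rewrite invr_gt0 subr_gt0.
pose C := C1 * (g1 + C2) + (2 * L * C1 * (g1 ^+ 2 + C2 ^+ 2) + g2 / rho).
exists k0, C, (maxn n1 (Num.truncn (expR 1 : R)).+1); split=> //; first by rewrite /C; pos.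
move=> n; rewrite geq_max => /andP[nn1 n3] k kk0 kle a.
have n0 : 0 < n%:R :> R by rewrite ltr0n (leq_ltn_trans _ n3).
have ln1 : 1 <= ln n%:R :> R.
  rewrite -[leLHS](@expRK R) ler_ln ?posrE ?expR_gt0 //.
  by rewrite (le_trans (ltW (truncnS_gt _))) // ler_nat.
have k1 : 1 <= k by apply: le_trans kk0.
have kp : 0 < k by apply: lt_le_trans k1.
pose na := n%:R `^ alpha; have na0 : 0 < na :> R by rewrite /na; pos.
rewrite -/na.
have ap : 0 < a by rewrite /a; pos.
pose eps := n%:R `^ (- ph) : R.
have eps0 : 0 < eps by rewrite /eps; pos.
have epsa : eps * ln n%:R ^+ 2 <= a.
  rewrite /a -(opprB lam) powRN /eps powRN -[leLHS]invrK lef_pV2 ?posrE; try pos.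
    by rewrite invfM invrK.
  by rewrite invr_gt0 mulr_gt0 ?invr_gt0 ?powR_gt0 // exprn_gt0 // (lt_le_trans _ ln1).
pose t r := C1 * na * (a * th ^+ r + eps).
have t0 r : 0 <= t r by rewrite /t; pos.
pose M := k * na; have M0 : 0 < M by rewrite /M; pos.
have z0 : 0 < a / k by pos.
have Pmono (I J : graph 'I_n) : J \subset I -> is_free H I -> is_free H J.
  exact: is_freeS.
have stp r (G : graph 'I_n) : M * rho ^- r < #|G|%:R ->
    exists SF, is_container (is_free H) G (t r) (rho * #|G|%:R) SF.
  move=> Gr.
  have rr1 : 1 <= rho ^- r by rewrite -exprVn exprn_ege1 // invf_ge1 // ltW.
  have GM : M <= #|G|%:R by rewrite (le_trans _ (ltW Gr)) // ler_peMr // ltW.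
  have [|SF HSF] := step n nn1 G.
    by apply: le_trans GM; rewrite /M ler_pM2r.
  exists SF => I IG If; have [h1 h2 h3 h4 h5] := HSF I IG If; split=> //.
  apply: (le_trans h2); rewrite /t -/na ler_pM2l; last by pos.
  rewrite -/eps lerD2r.
  have -> : a * th ^+ r = (k * rho ^- r) `^ (1 - lam).
    rewrite powRM; [|by pos|by pos].
    have -> : rho ^- r = rho `^ (- r%:R) by rewrite powRN powR_mulrn // ltW.
    rewrite /a /th -powR_mulrn; last by pos.
    by rewrite -!powRrM; congr (_ * _ `^ _); ring.
  rewrite -(opprB lam 1) !powRN lef_pV2 ?posrE; [| |by pos].
    apply: ge0_ler_powR; rewrite ?nnegrE ?(ltW lam1') //; try by pos.
    by rewrite ler_pdivlMr // mulrAC -/M ltW.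
  by apply: powR_gt0; rewrite divr_gt0 // (lt_le_trans M0).
(* So many rounds give [rho ^- R0 >= n ^ 2], more than the number of pairs, and [C2] was chosen to
   bound [R0] by [C2 * ln n]. *)
pose R0 := (Num.truncn (2 * ln n%:R / L)).+1.
have R0le : R0%:R <= C2 * ln n%:R.
  rewrite (_ : C2 * _ = 2 * ln n%:R / L + ln n%:R); last by rewrite /C2; ring.
  rewrite /R0 -natr1; apply: lerD => //.
  by rewrite truncn_le divr_ge0 ?mulr_ge0 ?(ltW L0) // (le_trans _ ln1).
have R0ge : 2 * ln n%:R <= R0%:R * L.
  by rewrite -ler_pdivrMr // ltW // truncnS_gt.
have Gtop : #|[set: edge 'I_n]|%:R <= M * rho ^- R0.
  apply: (@le_trans _ _ (n ^ 2)%:R); first by rewrite ler_nat card_graph_le.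
  apply: (@le_trans _ _ (rho ^- R0)).
    rewrite natrX -exprVn -[n%:R]lnK ?posrE // -[rho]lnK ?posrE // -expRN -!expRM_natl.
    by rewrite ler_expR.
  rewrite ler_peMl //; first by pos.
  rewrite mulr_ege1 //.
  have n1R : 1 <= n%:R :> R by rewrite ler1n -(ltr0n R).
  by have := ler_powR n1R (ltW a0); rewrite powRr0.
have [SF [cont wt]] := container_iter Pmono rho0 rho1 z0 M0 t0 stp Gtop.
have sgeom : \sum_(i < R0) th ^+ i <= g1.
  by apply: sum_geom_le; rewrite th1 ltW.
have sag : \sum_(i < R0) i%:R * th ^+ i <= g1 ^+ 2.
  by apply: sum_arith_geom_le; rewrite th1 ltW.
have sgr : \sum_(i < R0) rho ^+ i <= g2.
  by apply: sum_geom_le; rewrite rho1 ltW.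
have R0eps : R0%:R * eps <= C2 * a.
  apply: (@le_trans _ _ (C2 * (ln n%:R * eps))).
    by rewrite mulrA ler_pM2r.
  rewrite ler_pM2l // (le_trans _ epsa) // mulrC ler_pM2l // expr2 ler_peMl //.
  exact: le_trans ln1.
have R0eps2 : R0%:R ^+ 2 * eps <= C2 ^+ 2 * a.
  apply: (@le_trans _ _ (C2 ^+ 2 * (ln n%:R ^+ 2 * eps))).
    rewrite mulrA ler_pM2r // -exprMn lerXn2r ?nnegrE //.
    by rewrite mulr_ge0 ?(ltW C20) // (le_trans _ ln1).
  by rewrite ler_pM2l ?exprn_gt0 // mulrC.
have size_le : \sum_(i < R0) t i <= C * a * na.
  have -> : \sum_(i < R0) t i = C1 * na * (a * \sum_(i < R0) th ^+ i + R0%:R * eps).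
    by rewrite -mulr_sumr big_split /= -mulr_sumr sumr_const card_ord mulr_natl.
  apply: (@le_trans _ _ (C1 * na * (a * g1 + C2 * a))).
    by rewrite ler_pM2l ?lerD // ?ler_pM2l //; pos.
  rewrite [leLHS](_ : _ = C1 * (g1 + C2) * a * na); last by ring.
  by rewrite ler_pM2r // ler_pM2r // /C lerDl; pos.
exists SF; split.
  by move=> I IG If; have [h1 h2 h3 h4 h5] := cont I IG If; split=> //; apply: le_trans size_le.
apply: (le_trans wt); rewrite ler_expR /log_weight.
have -> : \sum_(i < R0) (- (2 * i%:R * t i * ln rho) + a / k * M * rho ^+ i / rho) =
  2 * L * C1 * na * (a * \sum_(i < R0) i%:R * th ^+ i + eps * \sum_(i < R0) i%:R)
    + a * na * (\sum_(i < R0) rho ^+ i) / rho.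
  rewrite big_split /=; congr (_ + _).
    rewrite !mulr_sumr -big_split /= mulr_sumr; apply: eq_bigr => i _.
    by rewrite /t /L; ring.
  rewrite mulr_sumr mulr_suml; apply: eq_bigr => i _.
  by rewrite /M; field; rewrite !gt_eqF.
have sumi : \sum_(i < R0) i%:R <= R0%:R ^+ 2 :> R.
  rewrite expr2 mulr_natl -[X in _ *+ X](card_ord R0) -sumr_const.
  by apply: ler_sum => i _; rewrite ler_nat ltnW.
apply: (@le_trans _ _ (2 * L * C1 * na * (a * g1 ^+ 2 + C2 ^+ 2 * a) + a * na * g2 / rho)).
  apply: lerD.
    rewrite ler_pM2l; last by pos.
    apply: lerD; first by rewrite ler_pM2l.
    by rewrite (le_trans _ R0eps2) // mulrC ler_pM2r.
  by rewrite ler_pM2r ?invr_gt0 // ler_pM2l //; pos.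
rewrite /C [leLHS](_ : _ = (2 * L * C1 * (g1 ^+ 2 + C2 ^+ 2) + g2 / rho) * a * na); last by ring.
by rewrite ler_pM2r // ler_pM2r // lerDr; pos.
Qed.

End ContainerFamily.

(** * From fingerprints to colored graphs, and crude counts of H-free graphs *)

Section Assembly.
Variables (R : realType) (V : finType) (H : graph V).

(* A fingerprint determines its container by itself, so one color suffices. *)
Definition monochrome (W : finType) (I : graph W) : colored_graph W :=
  [ffun e => if e \in I then Some 0%N else None].

Lemma uncolorK (W : finType) : cancel (@monochrome W) (@uncolor W).
Proof. by move=> I; apply/setP => e; rewrite inE ffunE; case: (e \in I). Qed.

Definition frees n : {set graph 'I_n} := [set I | is_free H I].

Lemma assemble n (f hh : graph 'I_n -> graph 'I_n) (B1 B2 : R) (B3 : nat -> R) :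
  (forall I, is_free H I -> #|f I|%:R <= B1) ->
  (forall I, is_free H I -> #|hh (f I)|%:R <= B2) ->
  (forall s, (1 <= s)%N -> #|[set J in f @: frees n | #|J| == s]|%:R <= B3 s) ->
  (forall I, is_free H I -> f I \subset I /\ I \subset hh (f I) :|: f I) ->
  exists (S : {fset colored_graph 'I_n})
         (g : graph 'I_n -> colored_graph 'I_n)
         (h : colored_graph 'I_n -> graph 'I_n),
  [/\ forall J, J \in S -> #|uncolor J|%:R <= B1,
      forall I, is_free H I -> g I \in S,
      forall J, J \in S -> #|h J|%:R <= B2,
      forall s : nat, (1 <= s)%N ->
        #|` [fset J in S | #|uncolor J| == s]%fset |%:R <= B3 s &
      forall I, is_free H I ->
        uncolor (g I) \subset I /\
        I \subset (h (g I) :|: uncolor (g I))].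
Proof.
move=> fB1 hB2 cnt sub.
pose S := [fset monochrome J | J in f @: frees n]%fset.
have SP J : J \in S -> exists2 I, is_free H I & J = monochrome (f I).
  by case/imfsetP => J' /= /imsetP[I]; rewrite inE => If -> ->; exists I.
exists S, (fun I => monochrome (f I)), (fun J => hh (uncolor J)); split.
- by move=> J /SP[I If ->]; rewrite uncolorK fB1.
- move=> I If; apply/imfsetP; exists (f I) => //=.
  by apply: imset_f; rewrite inE.
- by move=> J /SP[I If ->]; rewrite uncolorK hB2.
- move=> s s1; apply: le_trans (cnt s s1); rewrite ler_nat.
  rewrite [leqRHS]cardE -(size_map (@monochrome _)).
  apply: uniq_leq_size; first exact: fset_uniq.
  move=> J JS; have : J \in [fset J in S | #|uncolor J| == s]%fset by [].
  case/imfsetP => J' /=; rewrite inE => /andP[/SP[I If ->]] fs ->.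
  rewrite uncolorK in fs.
  by apply: map_f; rewrite mem_enum inE fs andbT imset_f // inE.
by move=> I If; rewrite !uncolorK; apply: sub.
Qed.

(** Each term of the weighted sum is at least z^b, because z <= 1. *)
Lemma card_le_weight (T : finType) (D : {set {set T}}) (z b X : R) :
  0 < z -> z <= 1 -> (forall J, J \in D -> #|J|%:R <= b) ->
  \sum_(J in D) z ^+ #|J| <= expR X -> #|D|%:R <= expR (X - b * ln z).
Proof.
move=> z0 z1 Db sX; rewrite expRD expRN -ler_pdivrMr ?invr_gt0 ?expR_gt0 // invrK.
apply: le_trans sX; rewrite mulrC mulr_natr -sumr_const; apply: ler_sum => J JD.
rewrite -[in leRHS](@lnK _ z) ?posrE // -expRM_natl ler_expR.
have : ln z <= 0 by rewrite ln_le0.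
by move=> l0; rewrite ler_wnM2r // Db.
Qed.

Lemma free_le n (A alpha : R) (I : graph 'I_n) :
  (turan n H)%:R <= A * n%:R `^ alpha -> is_free H I -> #|I|%:R <= A * n%:R `^ alpha.
Proof.
move=> ex If; apply: le_trans ex; rewrite ler_nat.
by apply: (@leq_bigmax_cond _ _ (fun I : graph 'I_n => #|I|)).
Qed.

Lemma powR_base_ge (x y r : R) (s : nat) : 1 <= x -> x <= y -> 0 <= r ->
  x `^ (r * s%:R) <= y `^ (r * s%:R).
Proof.
move=> x1 xy r0; have y0 : 0 <= y by apply: le_trans xy; apply: le_trans x1.
apply: ge0_ler_powR; rewrite ?nnegrE ?mulr_ge0 //.
exact: le_trans x1.
Qed.

(* All H-free graphs serve as their own fingerprints once they are few. *)
Lemma trivial_family n (A alpha C a k lam : R) :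
  (turan n H)%:R <= A * n%:R `^ alpha -> 0 < n%:R :> R -> A <= C -> A <= C * a ->
  1 < lam -> 0 < k ->
  #|frees n|%:R <= expR (C * a * n%:R `^ alpha) ->
  exists (S : {fset colored_graph 'I_n})
         (g : graph 'I_n -> colored_graph 'I_n)
         (h : colored_graph 'I_n -> graph 'I_n),
  [/\ forall J, J \in S -> #|uncolor J|%:R <= C * a * n%:R `^ alpha,
      forall I, is_free H I -> g I \in S,
      forall J, J \in S -> #|h J|%:R <= k * n%:R `^ alpha,
      forall s : nat, (1 <= s)%N ->
        #|` [fset J in S | #|uncolor J| == s]%fset |%:R <=
          (C * n%:R `^ alpha / s%:R) `^ (lam / (lam - 1) * s%:R) *
          expR (C * a * n%:R `^ alpha) &
      forall I, is_free H I ->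
        uncolor (g I) \subset I /\
        I \subset (h (g I) :|: uncolor (g I))].
Proof.
move=> ex n0 AC ACa lam1 k0 cf.
have na0 : 0 < n%:R `^ alpha by pos.
apply: (@assemble n id (fun=> set0)) => [I If|I If|s s1|I If].
- by apply: le_trans (free_le ex If) _; rewrite ler_pM2r.
- by rewrite cards0; pos.
- have [->|/set0Pn[I]] := eqVneq [set J in id @: frees n | #|J| == s] set0.
    by rewrite cards0; pos.
  rewrite inE => /andP[/imsetP[I' I'f ->] /eqP Is].
  rewrite -[leLHS]mul1r ler_pM //; last first.
    apply: le_trans cf; rewrite ler_nat; apply: subset_leq_card.
    by apply/subsetP => J; rewrite inE => /andP[/imsetP[J' J'f ->]].
  have b1 : 1 <= C * n%:R `^ alpha / s%:R.
    rewrite ler_pdivlMr ?ltr0n // mul1r -Is.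
    move: I'f; rewrite inE => /(free_le ex)/le_trans; apply.
    by rewrite ler_pM2r.
  have r0 : 0 <= lam / (lam - 1).
    by rewrite divr_ge0 ?subr_ge0 ?ltW // (lt_trans _ lam1).
  by have := powR_base_ge s (lexx 1) b1 r0; rewrite powR1.
by split=> //; apply: subsetUr.
Qed.

Variables (A alpha : R).
Local Notation lam := (lambdastar alpha H).
Local Notation ph := (phi alpha H).

Lemma large_power_log (x y : R) : 0 < x -> exists n0 : nat, forall n, (n0 <= n)%N ->
  1 <= ln n%:R :> R /\ y <= n%:R `^ x / ln n%:R ^+ 2.
Proof.
move=> x0; pose y' := Num.max 1 y.
(* The exponent [x] is split in halves: one absorbs the squared logarithm, and beyond [w] the other
   absorbs [y'] and the constant. *)
pose w := (16 * y' / x ^+ 2) `^ (2 / x).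
exists (Num.truncn (w + expR 1)).+1 => n nn.
have nw : w + expR 1 <= n%:R.
  by rewrite (le_trans (ltW (truncnS_gt _))) // ler_nat.
have y'1 : 1 <= y' by rewrite le_max lexx.
have y'0 : 0 < y' by apply: lt_le_trans y'1.
have w0 : 0 <= w by pos.
have e0 : 0 < expR 1 :> R by pos.
have n0 : 0 < n%:R :> R by move: nw w0 e0; clear; move: (expR 1) n%:R => a b; lra.
have ln1 : 1 <= ln n%:R :> R.
  rewrite -[leLHS](@expRK R) ler_ln ?posrE // (le_trans _ nw) // lerDr //.
split=> //; rewrite ler_pdivlMr; last by rewrite exprn_gt0 // (lt_le_trans _ ln1).
have h : ln n%:R <= 4 / x * n%:R `^ (x / 4).
  have := ln_sublinear (powR_gt0 (x / 4) n0); rewrite ln_powR => /ltW.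
  rewrite -(ler_pM2l (_ : 0 < 4 / x)); last by pos.
  by rewrite mulrA (_ : 4 / x * (x / 4) = 1) ?mul1r //; field; rewrite gt_eqF.
have h2 : ln n%:R ^+ 2 <= 16 / x ^+ 2 * n%:R `^ (x / 2).
  have -> : 16 / x ^+ 2 * n%:R `^ (x / 2) = (4 / x * n%:R `^ (x / 4)) ^+ 2.
    rewrite exprMn -[(_ `^ _) ^+ 2]powR_mulrn ?powR_ge0 // -powRrM.
    congr (_ * _ `^ _); first by field; rewrite gt_eqF.
    by field.
  by rewrite lerXn2r ?nnegrE //; [apply: le_trans ln1|pos].
have h3 : 16 * y' / x ^+ 2 <= n%:R `^ (x / 2).
  have -> : 16 * y' / x ^+ 2 = w `^ (x / 2).
    rewrite /w -powRrM (_ : 2 / x * (x / 2) = 1) ?powRr1 //; first by pos.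
    by field; rewrite gt_eqF.
  apply: ge0_ler_powR; rewrite ?nnegrE; try by pos.
  by rewrite (le_trans _ nw) // lerDl ltW.
have -> : n%:R `^ x = n%:R `^ (x / 2) * n%:R `^ (x / 2).
  rewrite -powRD ?(gt_eqF n0) ?implybT //; congr (_ `^ _).
  by field.
apply: (@le_trans _ _ (y' * (16 / x ^+ 2 * n%:R `^ (x / 2)))).
  apply: (@le_trans _ _ (y' * ln n%:R ^+ 2)); last by rewrite ler_pM2l.
  by rewrite ler_wpM2r ?sqr_ge0 // le_max lexx orbT.
by rewrite mulrA ler_pM2r ?powR_gt0 // mulrCA mulrA.
Qed.

End Assembly.
Section MainCase.
Variables (R : realType) (V : finType) (H : graph V) (A alpha : R).
Local Notation lam := (lambdastar alpha H).
Local Notation ph := (phi alpha H).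
Hypotheses (A0 : 0 < A) (a0 : 0 < alpha) (lam1 : 1 < lam).
Hypothesis exH : forall n : nat, (turan n H)%:R <= A * n%:R `^ alpha.

(** With z = n^(-2) the weights z^|J| of all graphs sum to at most e, and an H-free graph has at
    most A n^alpha edges. *)
Lemma frees_crude n : (0 < n)%N -> 1 <= ln n%:R :> R ->
  #|frees H n|%:R <= expR ((2 * A + 1) * ln n%:R * n%:R `^ alpha).
Proof.
move=> n1 ln1; have n1R : 1 <= n%:R :> R by rewrite ler1n.
have n0 : 0 < n%:R :> R by apply: lt_le_trans n1R.
have na1 : 1 <= n%:R `^ alpha :> R.
  by have := ler_powR n1R (ltW a0); rewrite powRr0.
have ln0 : 0 < ln n%:R :> R by apply: lt_le_trans ln1.
pose z := expR (- (2 * ln n%:R)) : R.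
have z0 : 0 < z by rewrite expR_gt0.
have z1 : z <= 1 by rewrite expR_le1 oppr_le0 mulr_ge0 // ltW.
have zn : z * (n ^ 2)%:R = 1.
  rewrite /z natrX -[in X in _ * X](@lnK _ n%:R) ?posrE // -expRM_natl -expRD.
  by rewrite addNr expR0.
have sz : \sum_(J in frees H n) z ^+ #|J| <= expR 1.
  apply: (@le_trans _ _ (\sum_(J : graph 'I_n | J \subset [set: edge 'I_n]) z ^+ #|J|)).
    rewrite big_mkcond [leRHS]big_mkcond /=; apply: ler_sum => J _.
    by rewrite subsetT; case: ifP => // _; pos.
  apply: le_trans (sum_subset_pow _ (ltW z0)) _.
  rewrite ler_expR -[leRHS]zn ler_pM2l // ler_nat; exact: card_graph_le.
apply: le_trans (@card_le_weight R _ (frees H n) z (A * n%:R `^ alpha) 1 z0 z1 _ sz) _.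
  by move=> J; rewrite inE; apply: free_le.
rewrite ler_expR /z expRK.
rewrite [leRHS](_ : _ = 2 * A * ln n%:R * n%:R `^ alpha + ln n%:R * n%:R `^ alpha); last by ring.
have : 1 <= ln n%:R * n%:R `^ alpha :> R by rewrite mulr_ege1.
move: (n%:R `^ alpha) (ln n%:R) => x y; lra.
Qed.

(** Containers serve for k >= k0. For smaller k the factor k^(1-lambda) is bounded below by a
    constant, so C can absorb the logarithm of the number of H-free graphs divided by n^alpha; for
    phi <= 0 the bound on k makes this factor at least ln n, which suffices for the crude count. *)
Lemma main_case :
  ES_good alpha H -> alpha < 2 -> (1 < #|H|)%N -> 1 <= m2star R H ->
  exists2 C : R, 0 < C & exists n0 : nat,
  forall n : nat, (n0 <= n)%N -> forall k : R, 0 < k ->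
  k <= n%:R `^ (ph / (lam - 1)) / ln n%:R `^ (2 / (lam - 1)) ->
  exists (S : {fset colored_graph 'I_n})
         (g : graph 'I_n -> colored_graph 'I_n)
         (h : colored_graph 'I_n -> graph 'I_n),
  [/\ forall J, J \in S ->
        #|uncolor J|%:R <= C * k `^ (1 - lam) * n%:R `^ alpha,
      forall I, is_free H I -> g I \in S,
      forall J, J \in S -> #|h J|%:R <= k * n%:R `^ alpha,
      forall s : nat, (1 <= s)%N ->
        #|` [fset J in S | #|uncolor J| == s]%fset |%:R <=
          (C * n%:R `^ alpha / s%:R) `^ (lam / (lam - 1) * s%:R) *
          expR (C * k `^ (1 - lam) * n%:R `^ alpha) &
      forall I, is_free H I ->
        uncolor (g I) \subset I /\
        I \subset (h (g I) :|: uncolor (g I))].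
Proof.
move=> good a2 l1 m21.
have lam1' : 0 < lam - 1 by rewrite subr_gt0.
have [nl lnl] := @large_power_log R 1 1 ltr01.
have kpow n k : 1 <= ln n%:R :> R -> 0 < k ->
    k <= n%:R `^ (ph / (lam - 1)) / ln n%:R `^ (2 / (lam - 1)) ->
    k `^ (lam - 1) <= n%:R `^ ph / ln n%:R ^+ 2.
  move=> ln1 k0 kle; have ln0 : 0 < ln n%:R :> R by apply: lt_le_trans ln1.
  have -> : n%:R `^ ph / ln n%:R ^+ 2 =
     (n%:R `^ (ph / (lam - 1)) / ln n%:R `^ (2 / (lam - 1))) `^ (lam - 1).
    rewrite powRM ?invr_ge0 ?powR_ge0 // -powRrM divfK ?gt_eqF //; congr (_ * _).
    rewrite -[(_ `^ (2 / _))^-1]powRN -powRrM mulNr divfK ?gt_eqF //.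
    by rewrite powRN powR_mulrn // ltW.
  by apply: ge0_ler_powR; rewrite ?nnegrE; pos.
have [ph0|ph0] := leP ph 0.
  (* k is so small that listing all H-free graphs is cheap enough. *)
  exists (2 * A + 1); first by pos.
  exists (maxn nl 1) => n; rewrite geq_max => /andP[nnl n1] k k0 kle.
  have [ln1 _] := lnl n nnl.
  have n1R : 1 <= n%:R :> R by rewrite ler1n.
  have aln : ln n%:R <= k `^ (1 - lam).
    have kl := kpow n k ln1 k0 kle.
    have lnp : 0 < ln n%:R ^+ 2 :> R by rewrite exprn_gt0 // (lt_le_trans _ ln1).
    apply: (@le_trans _ _ (ln n%:R ^+ 2)).
      by rewrite expr2 ler_peMr // (le_trans _ ln1).
    rewrite -(opprB lam) powRN -[leLHS]invrK lef_pV2 ?posrE ?invr_gt0 ?powR_gt0 //.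
    apply: le_trans kl _; rewrite -[leRHS]mul1r ler_pM2r ?invr_gt0 //.
    by have := ler_powR n1R ph0; rewrite powRr0.
  have a1 : 1 <= k `^ (1 - lam) by apply: le_trans aln.
  apply: (@trivial_family _ _ _ _ A) => //.
  - by rewrite ltr0n.
  - by move: A0; lra.
  - by rewrite -[leLHS]mulr1 ler_pM // ?(ltW A0) //; move: A0; lra.
  apply: le_trans (frees_crude n1 ln1) _; rewrite ler_expR ler_pM2r ?powR_gt0 ?ltr0n //.
  by rewrite ler_pM2l //; pos.
have [k0 [C [n1 [k01 C0 cont]]]] := container_family good a0 a2 l1 m21 lam1 (ltW ph0).
have k0p : 0 < k0 by apply: lt_le_trans k01.
pose b := k0 `^ (1 - lam); have b0 : 0 < b by rewrite /b; pos.
have b1 : b <= 1.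
  by have := ler_powR k01 (_ : 1 - lam <= 0); rewrite powRr0 => ->//; rewrite subr_le0 ltW.
have [n2 large] := large_power_log (k0 `^ (lam - 1)) ph0.
(* D n^alpha bounds the logarithm of the number of H-free graphs. The terms are the weighted sum of
   fingerprints, the passage from weights to cardinality, and the subsets of a container. *)
pose D := C * b - C * b * ln (b / k0) + k0.
have bk0 : 0 < b / k0 by pos.
have bk1 : b / k0 <= 1 by rewrite ler_pdivrMr // mul1r (le_trans b1).
have D0 : 0 < D.
  rewrite /D ltr_pwDr // subr_ge0 mulrC.
  by apply: (@le_trans _ _ 0); rewrite ?mulr_le0_ge0 ?ln_le0 //; pos.
(* The summands serve, in order, the containers for [k >= k0], the size of H-free graphs listed for
   [k < k0], their number, and a base at least 1 in (a). *)
pose C' := C + A / b + D / b + A.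
have C'0 : 0 < C' by rewrite /C'; pos.
exists C'; first by [].
exists (maxn (maxn n1 n2) 1) => n; rewrite !geq_max => /andP[/andP[nn1 nn2] n1'] k kp kle.
have n0 : 0 < n%:R :> R by rewrite ltr0n.
have na0 : 0 < n%:R `^ alpha :> R by pos.
have [ln1 k0le] := large n nn2.
have [kk0|kk0] := leP k0 k.
  have [SF [contSF wSF]] := cont n nn1 k kk0 (kpow n k ln1 kp kle).
  set a := k `^ (1 - lam) in contSF wSF *.
  have ap : 0 < a by rewrite /a; pos.
  have k1 : 1 <= k by apply: le_trans kk0.
  have CC' : C * a * n%:R `^ alpha <= C' * a * n%:R `^ alpha.
    rewrite ler_pM2r // ler_pM2r // /C' -!addrA lerDl; pos.
  have SFK I : is_free H I -> SF (SF I).1 = SF I.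
    move=> If; have [S1 _ _ _ cons] := contSF I (subsetT _) If.
    exact: cons.
  apply: (@assemble _ _ _ _ (fun I => (SF I).1) (fun J => (SF J).2)) => [I If|I If|s s1|I If].
  - by have [_ h _ _ _] := contSF I (subsetT _) If; apply: le_trans h CC'.
  - by rewrite SFK //; have [_ _ _ [_ h] _] := contSF I (subsetT _) If.
  - set Fs := [set J in _ | _].
    have FsP J : J \in Fs -> J \in fingerprints (is_free H) [set: edge 'I_n] SF /\ #|J| = s.
      rewrite inE => /andP[/imsetP[I]]; rewrite inE => If -> /eqP sE; split=> //.
      by apply/imsetP; exists I; rewrite // inE subsetT.
    have [Fs0|/set0Pn[I /FsP[If sE]]] := eqVneq Fs set0; first by rewrite Fs0 cards0; pos.
    have sle : s%:R <= C * a * n%:R `^ alpha.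
      rewrite -sE; case/imsetP: If => I' /[!inE] /andP[_ I'f] ->.
      by have [_ h _ _ _] := contSF I' (subsetT _) I'f.
    have z0 : 0 < a / k by pos.
    have cFs : #|Fs|%:R * (a / k) ^+ s <= expR (C * a * n%:R `^ alpha).
      apply: le_trans wSF; rewrite mulr_natl -sumr_const.
      rewrite big_mkcond [leRHS]big_mkcond /=; apply: ler_sum => J _.
      case: ifP => [/FsP[-> ->] //|_]; case: ifP => // _; pos.
    rewrite -ler_pdivlMr ?exprn_gt0 // in cFs.
    apply: (le_trans cFs); rewrite mulrC ler_pM //; try by pos.
      (* As a/k = k^(-lambda) and a = k^(1-lambda), the power lambda/(lambda-1) of 1/a appears; then
         [sle] replaces 1/a by C' n^alpha / s. *)
      have -> : (a / k) ^- s = (a^-1) `^ (lam / (lam - 1) * s%:R).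
        have -> : a / k = k `^ (- lam).
          rewrite /a powRD ?(gt_eqF kp) ?implybT // powRr1 ?ltW //.
          by rewrite mulrC mulKf // gt_eqF.
        rewrite -exprVn -powRN opprK -powR_mulrn ?powR_ge0 // -powRrM.
        rewrite /a -powRN opprB -powRrM; congr (_ `^ _).
        by field; rewrite gt_eqF.
      apply: powR_base_ge.
      - have l0 : 1 - lam <= 0 by rewrite subr_le0 ltW.
        by rewrite invf_ge1 // /a; have := ler_powR k1 l0; rewrite powRr0.
      - rewrite ler_pdivlMr ?ltr0n // mulrC ler_pdivrMr // (le_trans sle) //.
        by rewrite (le_trans CC') // mulrAC.
      by rewrite divr_ge0 ?subr_ge0 ?ltW // (lt_trans _ lam1).
    by rewrite ler_expR.
  rewrite SFK //; have [h1 _ h2 _ _] := contSF I (subsetT _) If.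
  by split=> //; rewrite setUC.
have ba : b <= k `^ (1 - lam).
  rewrite /b -!(opprB lam 1) !powRN lef_pV2 ?posrE ?powR_gt0 //.
  by apply: ge0_ler_powR; rewrite ?nnegrE ?ltW.
apply: (@trivial_family _ _ _ _ A) => //.
- by rewrite /C' lerDr; pos.
- apply: (@le_trans _ _ (A / b * k `^ (1 - lam))).
    by rewrite mulrAC ler_pdivlMr // ler_pM2l.
  by rewrite ler_pM2r ?powR_gt0 // /C' -addrA addrAC lerDr; pos.
(* Each H-free graph is its fingerprint plus a subset of its container. *)
have [SF [contSF wSF]] := cont n nn1 k0 (lexx _) k0le.
rewrite -/b in contSF wSF.
set Fp := fingerprints _ _ _ in wSF.
have FpS J : J \in Fp -> #|J|%:R <= C * b * n%:R `^ alpha.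
  case/imsetP => I /[!inE] /andP[_ If] ->.
  by have [_ h _ _ _] := contSF I (subsetT _) If.
have cFp := card_le_weight bk0 bk1 FpS wSF.
have cf : #|frees H n|%:R <= #|Fp|%:R * expR (k0 * n%:R `^ alpha).
  pose Q := [set q : graph 'I_n * graph 'I_n | (q.1 \in Fp) && (q.2 \subset (SF q.1).2)].
  apply: (@le_trans _ _ #|Q|%:R).
    rewrite ler_nat -(card_in_imset (f := fun I => ((SF I).1, I :&: (SF I).2)) (D := frees H n)).
      apply: subset_leq_card; apply/subsetP => _ /imsetP[I /[!inE] If ->].
      have [S1 _ _ _ cons] := contSF I (subsetT _) If.
      rewrite /= (cons _ (subxx _) S1) subsetIr andbT.
      by apply/imsetP; exists I; rewrite // inE subsetT.
    move=> I J /[!inE] If Jf [E1 E2].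
    have [SI _ cI _ _] := contSF I (subsetT _) If.
    have [SJ _ cJ _ _] := contSF J (subsetT _) Jf.
    rewrite -(setIidPl cI) -(setIidPl cJ) !setIUr E2 -E1; congr (_ :|: _).
    by rewrite (setIidPr SI) E1 (setIidPr SJ).
  have -> : #|Q|%:R = \sum_(J in Fp) (2 ^ #|(SF J).2|)%:R :> R.
    rewrite -natr_sum -sum1_card; congr _%:R.
    rewrite (eq_bigl (fun q : graph 'I_n * graph 'I_n => (q.1 \in Fp) && (q.2 \in powerset (SF q.1).2))); last by move=> q; rewrite !inE.
    rewrite -(pair_big_dep (mem Fp) (fun J B => B \in powerset (SF J).2) (fun _ _ => 1%N)) /=.
    by apply: eq_bigr => J _; rewrite sum1_card card_powerset.
  rewrite mulr_natl -sumr_const; apply: ler_sum => J /imsetP[I /[!inE] /andP[_ If] ->].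
  have [S1 _ _ [_ c2] cons] := contSF I (subsetT _) If.
  rewrite (cons _ (subxx _) S1) natrX (le_trans (_ : _ <= expR 1 ^+ #|(SF I).2|)) //.
    by rewrite lerXn2r ?nnegrE ?expR_ge0 // (le_trans _ (expR_ge1Dx _)).
  by rewrite -expRM_natl ler_expR mulr1.
apply: (le_trans cf); apply: (@le_trans _ _ (expR (D * n%:R `^ alpha))).
  apply: le_trans (ler_wpM2r (expR_ge0 _) cFp) _.
  by rewrite -expRD ler_expR /D le_eqVlt; apply/orP; left; apply/eqP; ring.
rewrite ler_expR ler_pM2r //.
apply: (@le_trans _ _ (D / b * k `^ (1 - lam))).
  by rewrite mulrAC ler_pdivlMr // ler_pM2l.
by rewrite ler_pM2r ?powR_gt0 // /C' addrAC lerDr; pos.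
Qed.

End MainCase.
(** * Independent sets in locally acyclic hypergraphs *)

Section Bernoulli.
Variables (R : realType) (T : finType) (r : T -> R).
Implicit Types (X Y A B : {set T}) (f g : {set T} -> R).

Definition bern X : R := \prod_v (if v \in X then r v else 1 - r v).
Definition Ex f : R := \sum_(X : {set T}) bern X * f X.

Lemma Ex_cst (a : R) : Ex (fun=> a) = a.
Proof.
rewrite /Ex -mulr_suml -[RHS]mul1r; congr (_ * _).
transitivity (\prod_v (r v + (1 - r v))); last first.
  by rewrite big1 // => v _; rewrite addrC subrK.
by rewrite (@bigA_distr _ 0 1).
Qed.

Lemma eq_Ex f g : f =1 g -> Ex f = Ex g.
Proof. by move=> fg; apply: eq_bigr => X _; rewrite fg. Qed.

Lemma ExB f g : Ex (fun X => f X - g X) = Ex f - Ex g.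
Proof. by rewrite /Ex -sumrB; apply: eq_bigr => X _; rewrite mulrBr. Qed.

Lemma Ex_sum (I : finType) (P : pred I) (f : I -> {set T} -> R) :
  Ex (fun X => \sum_(i | P i) f i X) = \sum_(i | P i) Ex (f i).
Proof.
by rewrite /Ex exchange_big /=; apply: eq_bigr => X _; rewrite mulr_sumr.
Qed.

Lemma ExZ (a : R) f : Ex (fun X => a * f X) = a * Ex f.
Proof. by rewrite /Ex mulr_sumr; apply: eq_bigr => X _; rewrite mulrCA. Qed.

Lemma Ex_subset A : Ex (fun X => (A \subset X)%:R) = \prod_(v in A) r v.
Proof.
transitivity (\prod_v (r v + (if v \in A then 0 else 1 - r v))); last first.
  rewrite [RHS]big_mkcond; apply: eq_bigr => v _.
  by case: ifP; rewrite ?addr0 // addrC subrK.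
rewrite (@bigA_distr _ 0 1); apply: eq_bigr => X _.
case: (boolP (A \subset X)) => [AX|/subsetPn[v vA vX]]; last first.
  by rewrite mulr0 (bigD1 v) //= (negPf vX) vA mul0r.
rewrite mulr1; apply: eq_bigr => v _; case: ifP => // vX.
by case: ifP => // /(subsetP AX); rewrite vX.
Qed.

Definition depends f A := forall X Y, X :&: A = Y :&: A -> f X = f Y.

Lemma dependsS f A B : A \subset B -> depends f A -> depends f B.
Proof.
move=> AB fA X Y XY; apply: fA.
by rewrite -(setIidPr AB) !setIA XY.
Qed.

(* Exchanging the coordinates outside A between two independent samples turns
   f(X) g(Y) into f(X) g(X). *)
Lemma Ex_indep f g A B : depends f A -> depends g B -> [disjoint A & B] ->
  Ex (fun X => f X * g X) = Ex f * Ex g.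
Proof.
move=> fA gB AB.
pose sw (p : {set T} * {set T}) := ((p.1 :&: A) :|: (p.2 :\: A), (p.2 :&: A) :|: (p.1 :\: A)).
have swK : involutive sw.
  by case=> X Y; rewrite /sw /=; congr (_, _); apply/setP => v; rewrite !inE;
    case: (v \in A); case: (v \in X); case: (v \in Y).
have wE p : bern (sw p).1 * bern (sw p).2 = bern p.1 * bern p.2.
  rewrite /bern -!big_split /=; apply: eq_bigr => v _; rewrite !inE.
  by case: (v \in A) => /=; rewrite ?andbT ?andbF ?orbF //= mulrC.
rewrite -[LHS]mulr1 -(Ex_cst 1) /Ex !mulr_suml.
under eq_bigr do rewrite mulr_sumr.
under [RHS]eq_bigr do rewrite mulr_sumr.
rewrite !pair_big /= [RHS](reindex_inj (inv_inj swK)) /=.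
apply: eq_bigr => -[X Y] _; rewrite [LHS]mulrACA [RHS]mulrACA.
have /= -> := wE (X, Y); congr (_ * _).
  rewrite mulr1; congr (_ * _).
    by apply: fA; apply/setP => v; rewrite !inE; case: (v \in A); rewrite ?andbF ?orbF ?andbT.
  apply: gB; apply/setP => v; rewrite !inE.
  have [vB|] := boolP (v \in B); last by rewrite !andbF.
  have vA : v \in A = false by apply/negP => vA; have := disjointFr AB vA; rewrite vB.
  by rewrite vA andbF /= !andbT.
Qed.

Lemma depends_prod (I : finType) (s : seq I) (f : I -> {set T} -> R) (A : I -> {set T}) (B : {set T}) :
  (forall i, i \in s -> depends (f i) (A i)) -> (forall i, i \in s -> A i \subset B) ->
  depends (fun X => \prod_(i <- s) f i X) B.
Proof.
move=> fA AB X Y XY; apply: eq_big_seq => i si.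
exact: (dependsS (AB i si) (fA i si)).
Qed.

Lemma Ex_prod_indep (I : finType) (s : seq I) (f : I -> {set T} -> R) (A : I -> {set T}) :
  uniq s -> (forall i, i \in s -> depends (f i) (A i)) ->
  (forall i j, i \in s -> j \in s -> i != j -> [disjoint A i & A j]) ->
  Ex (fun X => \prod_(i <- s) f i X) = \prod_(i <- s) Ex (f i).
Proof.
elim: s => [|i s IH] /=; first by move=> _ _ _; rewrite big_nil -[RHS](Ex_cst 1); apply: eq_Ex => X; rewrite big_nil.
case/andP=> si us fA dis; rewrite big_cons -IH //.
- rewrite -(@Ex_indep _ _ (A i) (\bigcup_(j <- s) A j)).
  + by apply: eq_Ex => X; rewrite big_cons.
  + by apply: fA; rewrite inE eqxx.
  + apply: (depends_prod (A := A)) => j js; first by apply: fA; rewrite inE js orbT.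
    by rewrite bigcup_seq; apply: bigcup_sup js.
  rewrite -setI_eq0; apply/eqP/setP => v; rewrite !inE; apply/negP => /andP[vi].
  rewrite bigcup_seq => /bigcupP[j js vj].
  have ij : i != j by apply: contraNneq si => ->.
  have := dis i j; rewrite !inE eqxx js orbT => /(_ isT isT ij) d.
  by rewrite (disjointFr d vi) in vj.
- by move=> j js; apply: fA; rewrite inE js orbT.
- by move=> j k js ks; apply: dis; rewrite inE ?js ?ks orbT.
Qed.

Hypothesis r01 : forall v, 0 <= r v <= 1.

Lemma bern_ge0 X : 0 <= bern X.
Proof.
apply: prodr_ge0 => v _; have /andP[h1 h2] := r01 v.
by case: ifP; rewrite ?subr_ge0.
Qed.

Lemma Ex_exists f : exists X, Ex f <= f X.
Proof.
have [X HX|none] := pickP (fun X => Ex f <= f X); first by exists X.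
exfalso.
have lt X : f X < Ex f by have := none X => /negbT; rewrite -ltNge.
have e : Ex (fun X => Ex f - f X) = 0 by rewrite ExB Ex_cst subrr.
have z X : bern X * (Ex f - f X) = 0.
  apply/eqP; move: e => /eqP; rewrite psumr_eq0; last first.
    by move=> Y _; rewrite mulr_ge0 ?bern_ge0 // subr_ge0 ltW.
  by move=> /allP/(_ X); rewrite mem_index_enum => /(_ isT).
have b0 X : bern X = 0.
  have := z X => /eqP; rewrite mulf_eq0 => /orP[/eqP //|].
  by rewrite subr_eq0 => /eqP E; have := lt X; rewrite E ltxx.
have := Ex_cst 1; rewrite /Ex big1 => [/eqP|X _]; last by rewrite b0 mul0r.
by rewrite eq_sym oner_eq0.
Qed.

End Bernoulli.

(** * A random greedy selection with equal selection probabilities *)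

Section GreedyProcess.
Variables (R : realType) (T : finType) (Es : {set {set T}}) (c : T -> nat).

(** The vertex of largest color decides an edge: when it is examined, all the others have been
    settled. *)
Definition top (e : {set T}) (v : T) : bool :=
  (v \in e) && [forall u in e, (u != v) ==> (c u < c v)%N].

Definition tops (v : T) : {set {set T}} := [set e in Es | top e v].

(* Vertices are examined by increasing color; [n] is recursion fuel, and any
   [n > c v] gives the same result. *)
Fixpoint sel n (X : {set T}) (v : T) : bool :=
  if n is m.+1 then (v \in X) &&
    [forall e in tops v, [exists u in e :\ v, ~~ sel m X u]]
  else false.

(** It contains every coordinate of [X] that the decision about [v] can depend on; disjoint cones
    give independent decisions. *)
Fixpoint cone n (v : T) : {set T} :=
  if n is m.+1 then v |: \bigcup_(e in tops v) (e :|: \bigcup_(u in e :\ v) cone m u)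
  else set0.

Definition isel (v : T) (X : {set T}) : bool := sel (c v).+1 X v.
Definition cn (v : T) : {set T} := cone (c v).+1 v.

Lemma tops_color e v u : e \in tops v -> u \in e :\ v -> (c u < c v)%N.
Proof.
rewrite !inE => /and3P[_ _ /forall_inP H] /andP[uv ue].
by have := implyP (H u ue); apply.
Qed.

Lemma sel_fuel n m X v : (c v < n)%N -> (c v < m)%N -> sel n X v = sel m X v.
Proof.
elim: n m v => [//|n IH] [//|m] v cn cm /=; congr (_ && _).
apply: eq_forallb_in => e ev; apply: eq_existsb_in => u uev; congr (~~ _).
by have cu := tops_color ev uev; apply: IH; lia.
Qed.

Lemma cone_fuel n m v : (c v < n)%N -> (c v < m)%N -> cone n v = cone m v.
Proof.
elim: n m v => [//|n IH] [//|m] v cn cm /=; congr (_ |: _).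
apply: eq_bigr => e ev; congr (_ :|: _); apply: eq_bigr => u uev.
by have cu := tops_color ev uev; apply: IH; lia.
Qed.

Lemma iselE v X : isel v X = (v \in X) &&
  [forall e in tops v, [exists u in e :\ v, ~~ isel u X]].
Proof.
rewrite {1}/isel /=; congr (_ && _).
apply: eq_forallb_in => e ev; apply: eq_existsb_in => u uev; congr (~~ _).
by apply: sel_fuel; rewrite // (tops_color ev uev).
Qed.

Lemma cnE v : cn v = v |: \bigcup_(e in tops v) (e :|: \bigcup_(u in e :\ v) cn u).
Proof.
rewrite {1}/cn /=; congr (_ |: _).
apply: eq_bigr => e ev; congr (_ :|: _); apply: eq_bigr => u uev.
by apply: cone_fuel; rewrite // (tops_color ev uev).
Qed.

Lemma cn_self v : v \in cn v.
Proof. by rewrite cnE setU11. Qed.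

Lemma cn_sub e v u : e \in tops v -> u \in e :\ v -> cn u \subset cn v.
Proof.
move=> ev uev; rewrite (cnE v).
apply: subset_trans (subsetUr _ _); apply: subset_trans (bigcup_sup e ev).
apply: subset_trans (subsetUr _ _); exact: (bigcup_sup u uev).
Qed.

Lemma color_ind (P : T -> Prop) :
  (forall v, (forall u, (c u < c v)%N -> P u) -> P v) -> forall v, P v.
Proof.
move=> H v; move: {2}(c v).+1 (ltnSn (c v)) => n; elim: n v => // n IH v cv.
by apply: H => u cu; apply: IH; lia.
Qed.

Lemma cn_color v u : u \in cn v -> u = v \/ (c u < c v)%N.
Proof.
elim/color_ind: v u => v IH u; rewrite cnE !inE => /orP[/eqP->|]; first by left.
case/bigcupP => e ev; rewrite inE => /orP[ue|].
  have [->|uv] := eqVneq u v; first by left.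
  by right; apply: (tops_color ev); rewrite !inE uv.
case/bigcupP => w wev uw; right; have cw := tops_color ev wev.
by case: (IH w cw u uw) => [->|] //; move/ltn_trans; apply.
Qed.

Lemma isel_dep v X Y : X :&: cn v = Y :&: cn v -> isel v X = isel v Y.
Proof.
elim/color_ind: v X Y => v IH X Y XY.
have memE u : u \in cn v -> (u \in X) = (u \in Y).
  by move=> uv; have := congr1 (fun Z : {set T} => u \in Z) XY; rewrite !in_setI uv !andbT.
rewrite !iselE memE ?cn_self //; congr (_ && _).
apply: eq_forallb_in => e ev; apply: eq_existsb_in => u uev; congr (~~ _).
apply: IH; first exact: tops_color ev uev.
have sub := cn_sub ev uev.
by rewrite -(setIidPr sub) !setIA XY.
Qed.

(** In product form, the indicator splits into factors that independence can separate. *)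
Lemma iselR v X : (isel v X)%:R =
  ([set v] \subset X)%:R * \prod_(e in tops v) (1 - \prod_(u in e :\ v) (isel u X)%:R) :> R.
Proof.
rewrite iselE sub1set; case: (v \in X); last by rewrite mul0r.
rewrite mul1r /=; have natprod (D : {set T}) (b : T -> bool) :
    \prod_(u in D) (b u)%:R = [forall u in D, b u]%:R :> R.
  case: (boolP [forall u in D, b u]) => [/forall_inP H|].
    by rewrite big1 // => u uD; rewrite H.
  rewrite negb_forall_in => /exists_inP[u uD bu].
  by rewrite (bigD1 u) //= (negPf bu) mul0r.
case: (boolP [forall e in tops v, _]) => [/forall_inP H|].
  rewrite big1 // => e ev; rewrite natprod; have := H e ev.
  by rewrite -negb_forall_in => /negPf ->; rewrite subr0.
rewrite negb_forall_in => /exists_inP[e ev].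
rewrite -negb_forall_in negbK => He.
by rewrite (bigD1 e) //= natprod He subrr mul0r.
Qed.

(** Injectivity of the colors gives [e] a top vertex, which is rejected as soon as all others are
    selected. *)
Lemma isel_indep X e : e \in Es -> e != set0 ->
  {in e &, injective c} -> ~~ [forall v in e, isel v X].
Proof.
move=> eE /set0Pn[v0 v0e] ci; apply/negP => /forall_inP H.
pose v := [arg max_(v > v0 in e) c v]%N.
have [ve vmax] : v \in e /\ forall u, u \in e -> (c u <= c v)%N.
  by rewrite /v; case: arg_maxnP.
have ev : e \in tops v.
  rewrite inE eE /top ve /=; apply/forall_inP => u ue; apply/implyP => uv.
  rewrite ltn_neqAle vmax // andbT; apply: contra uv => /eqP cuv.
  by apply/eqP/ci.
have := H v ve; rewrite iselE => /andP[_ /forall_inP/(_ e ev)/exists_inP[u]].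
by rewrite !inE => /andP[_ ue]; rewrite H.
Qed.

Variables (j : nat) (p : R).
Hypotheses (j2 : (2 <= j)%N) (p0 : 0 < p) (p1 : p < 1).
Hypothesis Ej : forall e, e \in Es -> #|e| = j.
Hypothesis dis_same : forall v e u u', e \in tops v ->
  u \in e :\ v -> u' \in e :\ v -> u != u' -> [disjoint cn u & cn u'].
Hypothesis dis_diff : forall v e e' u u', e \in tops v -> e' \in tops v -> e != e' ->
  u \in e :\ v -> u' \in e' :\ v -> [disjoint cn u & cn u'].
Hypothesis p_small : forall v, p <= (1 - p ^+ j.-1) ^+ #|tops v|.

Definition act_prob (v : T) : R := p / (1 - p ^+ j.-1) ^+ #|tops v|.

Lemma q_gt0 : 0 < 1 - p ^+ j.-1.
Proof. by rewrite subr_gt0 exprn_ilt1 ?ltW // -lt0n; case: j j2 => [|[]]. Qed.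

Lemma act_prob01 v : 0 <= act_prob v <= 1.
Proof.
have q0 := exprn_gt0 #|tops v| q_gt0.
apply/andP; split; first by rewrite divr_ge0 // ltW.
by rewrite ler_pdivrMr // mul1r.
Qed.

(* The activation probabilities compensate exactly for the chance of being
   blocked, so every vertex is selected with the same probability. *)
Lemma sel_prob v : Ex act_prob (fun X => (isel v X)%:R) = p.
Proof.
elim/color_ind: v => v IH.
have dep u : depends (fun X => (isel u X)%:R : R) (cn u).
  by move=> X Y XY; rewrite (isel_dep XY).
pose W e := \bigcup_(u in e :\ v) cn u.
pose f e (X : {set T}) : R := 1 - \prod_(u in e :\ v) (isel u X)%:R.
have depf e : depends (f e) (W e).
  move=> X Y XY; rewrite /f; congr (_ - _); apply: eq_bigr => u uev.
  apply: (dependsS _ (dep u)) XY; exact: (bigcup_sup u uev).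
have Exf e : e \in tops v -> Ex act_prob (f e) = 1 - p ^+ j.-1.
  move=> ev; rewrite ExB Ex_cst; congr (_ - _).
  transitivity (Ex act_prob (fun X => \prod_(u <- enum (e :\ v)) (isel u X)%:R)).
    by apply: eq_Ex => X; rewrite big_enum.
  rewrite (Ex_prod_indep _ (A := cn)) ?enum_uniq //.
  - rewrite big_enum /= (eq_bigr (fun=> p)) => [|u uev]; last first.
      by apply: IH; apply: tops_color ev uev.
    rewrite prodr_const; congr (_ ^+ _).
    have [eE ve] : e \in Es /\ v \in e by move: ev; rewrite !inE => /and3P[].
    by have := cardsD1 v e; rewrite ve Ej // add1n => ->.
  - by move=> u u'; rewrite !mem_enum; apply: dis_same ev.
transitivity (Ex act_prob (fun X => ([set v] \subset X)%:R * \prod_(e <- enum (tops v)) f e X)).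
  by apply: eq_Ex => X; rewrite iselR big_enum.
rewrite (@Ex_indep _ _ _ _ _ [set v] (\bigcup_(e in tops v) W e)).
- rewrite Ex_subset big_set1 (Ex_prod_indep _ (A := W)) ?enum_uniq //.
  + rewrite big_enum /= (eq_bigr _ Exf) prodr_const /act_prob divfK //.
    by rewrite gt_eqF // exprn_gt0 // q_gt0.
  + move=> e e'; rewrite !mem_enum => ev e'v ee'.
    rewrite -setI_eq0; apply/eqP/setP => x; rewrite !inE; apply/negP => /andP[].
    case/bigcupP => u uev xu /bigcupP[u' ue'v xu'].
    by have := disjointFr (dis_diff ev e'v ee' uev ue'v) xu; rewrite xu'.
- move=> X Y XY; congr (_%:R : R); rewrite !sub1set.
  by have := congr1 (fun Z : {set T} => v \in Z) XY; rewrite !inE eqxx !andbT => ->.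
- apply: (depends_prod (A := W)) => e; rewrite mem_enum => ev //.
  exact: (bigcup_sup e ev).
rewrite disjoints1; apply/bigcupP => -[e ev /bigcupP[u uev vu]].
by case: (cn_color vu) (tops_color ev uev) => [->|]; rewrite ?ltnn // => /ltn_trans h /h; rewrite ltnn.
Qed.

Lemma large_selection (G : {set T}) :
  exists I : {set T}, [/\ I \subset G, p * #|G|%:R <= #|I|%:R &
    forall e, e \in Es -> {in e &, injective c} -> ~~ (e \subset I)].
Proof.
have [X HX] := Ex_exists act_prob01 (fun X => \sum_(v in G) (isel v X)%:R).
exists [set v in G | isel v X]; split.
- by apply/subsetP => v; rewrite inE => /andP[].
- move: HX; rewrite Ex_sum (eq_bigr _ (fun v _ => sel_prob v)) sumr_const mulr_natr.
  move/le_trans; apply; rewrite -natr_sum ler_nat -sum1_card.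
  rewrite big_mkcond [leqRHS]big_mkcond /= leq_sum // => v _.
  by rewrite inE; case: (v \in G) => //=; case: isel.
move=> e eE ci; apply/negP => eI.
have e0 : e != set0 by rewrite -card_gt0 Ej // ltnW.
have := isel_indep X eE e0 ci; apply/negP; rewrite negbK.
by apply/forall_inP => v /(subsetP eI); rewrite inE => /andP[].
Qed.

End GreedyProcess.
Section GreedyColoring.
Variable T : finType.

Lemma greedy_coloring (nb : T -> {set T}) (D : nat) :
  (forall v, #|nb v| <= D)%N -> (forall u v, u \in nb v -> v \in nb u) ->
  (forall v, v \notin nb v) ->
  exists c : T -> nat, (forall v, c v <= D)%N /\
    forall u v, u \in nb v -> c u != c v.
Proof.
move=> nbD sym irr.
suff [c [cD cP]] : exists c : T -> nat, (forall v, c v <= D)%N /\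
    forall u v, u \in enum T -> v \in enum T -> u \in nb v -> c u != c v.
  by exists c; split=> // u v; apply: cP; rewrite mem_enum.
elim: (enum T) => [|v s [c [cD cP]]]; first by exists (fun=> 0%N).
have [k kD kP] : exists2 k, (k <= D)%N & forall u, u \in nb v -> c u != k.
  pose used := [set (inord (c u) : 'I_D.+1) | u in nb v].
  have : (0 < #|~: used|)%N.
    have le : (#|used| <= D)%N by apply: leq_trans (leq_imset_card _ _) (nbD v).
    by have := cardsC used; rewrite card_ord; lia.
  case/card_gt0P => k; rewrite inE => kn; exists k; first by rewrite -ltnS.
  move=> u uv; apply: contra kn => /eqP cu; apply/imsetP; exists u => //.
  by apply: val_inj; rewrite /= inordK ?cu // ltnS.
exists (fun x => if x == v then k else c x); split.
  by move=> x; case: ifP.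
move=> x y; rewrite !inE; case: (eqVneq x v) => [->|xv]; case: (eqVneq y v) => [->|yv] //=.
- by rewrite (negPf (irr v)).
- by move=> _ _ /sym /kP; rewrite eq_sym.
- by move=> _ _ /kP.
exact: cP.
Qed.

End GreedyColoring.

(** * Tight sets and the absence of short cycles of edges *)

Section TightSets.
Variables (R : realType) (T : finType) (dl : {set T} -> R) (G : {set T})
  (Es : {set {set T}}) (j D B : nat).

(** An upper bound for the size of a cone of fuel [n] when every vertex lies in at most [D] edges of
    size [j]. *)
Fixpoint cone_size n : nat :=
  if n is m.+1 then (1 + D * (j + j * cone_size m))%N else 0%N.

Hypothesis dl_super : forall Q Q' : {set T}, Q :&: Q' != set0 ->
  dl Q + dl Q' <= dl (Q :|: Q') + dl (Q :&: Q').
Hypothesis dl_le0 : forall Q : {set T}, Q \subset G -> Q != set0 -> (#|Q| <= B)%N ->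
  dl Q <= 0.
Hypothesis EG : forall e : {set T}, e \in Es -> e \subset G.
Hypothesis Ej : forall e, e \in Es -> #|e| = j.
Hypothesis E0 : forall e, e \in Es -> dl e = 0.
Hypothesis Elt : forall e Q : {set T}, e \in Es -> Q \subset e -> (2 <= #|Q|)%N -> Q != e -> dl Q < 0.
Hypothesis dl1 : forall v, dl [set v] = 0.
Hypothesis degD : forall v, (#|[set e in Es | v \in e]| <= D)%N.
Hypothesis j3 : (3 <= j)%N.
Hypothesis Bbig : (2 * cone_size (D * j).+1 + 2 * j <= B)%N.

(* Small sets have dl <= 0, so supermodularity leaves no slack between tight sets. *)
Lemma tight_merge (Q Q' : {set T}) : Q \subset G -> Q' \subset G -> dl Q = 0 -> dl Q' = 0 ->
  Q :&: Q' != set0 -> (#|Q :|: Q'| <= B)%N -> dl (Q :|: Q') = 0 /\ dl (Q :&: Q') = 0.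
Proof.
move=> QG Q'G Q0 Q'0 ne sz.
have := dl_super ne; rewrite Q0 Q'0 addr0.
have u0 : dl (Q :|: Q') <= 0.
  apply: dl_le0 => //; first by rewrite subUset QG.
  by case/set0Pn: ne => x; rewrite inE => /andP[xQ _]; apply/set0Pn; exists x; rewrite inE xQ.
have i0 : dl (Q :&: Q') <= 0.
  apply: dl_le0 => //; first exact: subset_trans (subsetIl _ _) QG.
  apply: leq_trans sz; apply: subset_leq_card.
  exact: subset_trans (subsetIl _ _) (subsetUl _ _).
by move=> h; split; apply/eqP; rewrite eq_le ?u0 ?i0 /=; move: h u0 i0; lra.
Qed.

(** The intersection is tight as well, while proper subsets of an edge with at least two elements
    are not. *)
Lemma edge_meet e (Q : {set T}) : e \in Es -> Q \subset G -> dl Q = 0 ->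
  (#|e :|: Q| <= B)%N -> (2 <= #|e :&: Q|)%N -> e \subset Q.
Proof.
move=> eE QG Q0 sz m2.
have ne : e :&: Q != set0 by rewrite -card_gt0 ltnW.
have [_ i0] := tight_merge (EG eE) QG (E0 eE) Q0 ne sz.
apply/setIidPl/eqP/negPn/negP => neq.
by have := Elt eE (subsetIl _ _) m2 neq; rewrite i0 ltxx.
Qed.

Lemma tight_bigcup (I : eqType) (s : seq I) (F : I -> {set T}) (Q0 : {set T}) :
  Q0 \subset G -> dl Q0 = 0 ->
  (forall i, i \in s -> [/\ F i \subset G, dl (F i) = 0 & F i :&: Q0 != set0]) ->
  (#|Q0 :|: \bigcup_(i <- s) F i| <= B)%N ->
  dl (Q0 :|: \bigcup_(i <- s) F i) = 0.
Proof.
move=> Q0G dQ0; elim: s => [|i s IH] HF; first by rewrite big_nil setU0.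
rewrite big_cons setUCA => sz.
have HF' k : k \in s -> [/\ F k \subset G, dl (F k) = 0 & F k :&: Q0 != set0].
  by move=> ks; apply: HF; rewrite inE ks orbT.
have [FG dF ne] := HF i (mem_head _ _).
apply: (tight_merge FG _ dF _ _ sz).1.
- rewrite subUset Q0G /=; elim: s HF' {IH HF sz} => [|k s IH] HF'; first by rewrite big_nil sub0set.
  rewrite big_cons subUset IH ?andbT => [|l ls]; first by have [] := HF' k (mem_head _ _).
  by apply: HF'; rewrite inE ls orbT.
- apply: IH => //; apply: leq_trans sz; apply: subset_leq_card; exact: subsetUr.
case/set0Pn: ne => x; rewrite inE => /andP[xF x0]; apply/set0Pn; exists x.
by rewrite inE xF inE x0.
Qed.

Lemma card_bigcup_le (I : finType) (A : {set I}) (F : I -> {set T}) (m : nat) :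
  (forall i, i \in A -> #|F i| <= m)%N -> (#|\bigcup_(i in A) F i| <= #|A| * m)%N.
Proof.
move=> HF; apply: leq_trans (_ : (\sum_(i in A) m <= _)%N); last by rewrite sum_nat_const.
apply: (@leq_trans (\sum_(i in A) #|F i|)); last exact: leq_sum.
elim/big_ind2: _ => [|n1 A1 n2 A2 h1 h2|i _] //; first by rewrite cards0.
exact: leq_trans (leq_card_setU _ _) (leq_add h1 h2).
Qed.

(** A greedy coloring with [D * j + 1] colors separates the vertices of each edge and bounds the
    depth of the cones, hence their size. Cones are tight, being built from overlapping tight edges.
    If cones of two vertices of one edge below [v] met, their union would be tight and swallow the
    edge, although [v], having a larger color, lies in neither. This gives the disjointness required
    by the random selection. *)
Lemma independent_of_tight (p : R) : 0 < p -> p < 1 -> p <= (1 - p ^+ j.-1) ^+ D ->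
  exists I : {set T}, [/\ I \subset G, p * #|G|%:R <= #|I|%:R &
    forall e, e \in Es -> ~~ (e \subset I)].
Proof.
move=> p0 p1 psmall.
have [c [cD cP]] : exists c : T -> nat, (forall v, c v <= D * j)%N /\
    forall u v, u \in (\bigcup_(e in [set e in Es | v \in e]) e) :\ v -> c u != c v.
  apply: greedy_coloring => [v|u v|v]; last by rewrite !inE eqxx.
    apply: (@leq_trans #|\bigcup_(e in [set e in Es | v \in e]) e|).
      by apply: subset_leq_card; apply: subsetDl.
    apply: leq_trans (card_bigcup_le (m := j) _) _; last by rewrite leq_mul2r degD orbT.
    by move=> e; rewrite inE => /andP[/Ej -> _].
  rewrite !in_setD1 eq_sym => /andP[-> /bigcupP[e]]; rewrite inE => /andP[eE ve] ue /=.
  by apply/bigcupP; exists e; rewrite // inE eE.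
have ci e : e \in Es -> {in e &, injective c}.
  move=> eE u v ue ve cuv; apply/eqP/negPn/negP => uv.
  have := cP u v; rewrite in_setD1 uv /= cuv eqxx => /(_ _)/negP; apply => //.
  by apply/bigcupP; exists e; rewrite // inE eE.
have topsD v : (#|tops Es c v| <= D)%N.
  apply: leq_trans (degD v); apply: subset_leq_card; apply/subsetP => e.
  by rewrite !inE => /and3P[-> -> _].
have coneS n v : (#|cone Es c n v| <= cone_size n)%N.
  elim: n v => [|n IH] v /=; first by rewrite cards0.
  apply: leq_trans (leq_card_setU _ _) _; rewrite cards1 leq_add2l.
  apply: (@leq_trans (#|tops Es c v| * (j + j * cone_size n))); last by rewrite leq_mul2r topsD orbT.
  apply: card_bigcup_le => e ev.
  have ej : #|e| = j by apply: Ej; move: ev; rewrite inE => /andP[].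
  apply: leq_trans (leq_card_setU _ _) _; rewrite ej leq_add2l.
  apply: leq_trans (card_bigcup_le (fun u _ => IH u)) _.
  by rewrite leq_mul2r -ej subset_leq_card ?orbT // subsetDl.
have sizeS n m : (n <= m)%N -> (cone_size n <= cone_size m)%N.
  elim: n m => [//|n IH] [//|m] nm /=.
  by rewrite leq_add2l leq_mul2l leq_add2l leq_mul2l IH ?orbT.
have cnS v : (#|cn Es c v| <= cone_size (D * j).+1)%N.
  by apply: leq_trans (coneS _ _) _; apply: sizeS; rewrite ltnS.
have sizeB2 u v (Q : {set T}) : (#|Q| <= 2 * j)%N ->
    (#|Q :|: (cn Es c u :|: cn Es c v)| <= B)%N.
  move=> Qs; apply: leq_trans Bbig; rewrite addnC.
  apply: leq_trans (leq_card_setU _ _) (leq_add Qs _).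
  by rewrite mul2n -addnn; apply: leq_trans (leq_card_setU _ _) (leq_add (cnS _) (cnS _)).
have szsub (Q Q' : {set T}) : Q \subset Q' -> (#|Q'| <= B)%N -> (#|Q| <= B)%N.
  by move=> QQ'; apply: leq_trans; apply: subset_leq_card.
have topE e v : e \in tops Es c v -> e \in Es /\ v \in e.
  by rewrite !inE => /and3P[].
have tightcn v : v \in G -> cn Es c v \subset G /\ dl (cn Es c v) = 0.
  elim/(@color_ind _ c): v => v IH vG.
  have cvB : (#|cn Es c v| <= B)%N.
    by apply: szsub (sizeB2 v v set0 _); rewrite ?cards0 // set0U subsetUl.
  have piece e : e \in tops Es c v -> let P := e :|: \bigcup_(u in e :\ v) cn Es c u in
      [/\ P \subset G, dl P = 0 & P :&: [set v] != set0].
    move=> ev P; have [eE ve] := topE _ _ ev.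
    have PE : P = e :|: \bigcup_(u <- enum (e :\ v)) cn Es c u by rewrite big_enum.
    have uG u : u \in e :\ v -> cn Es c u \subset G /\ dl (cn Es c u) = 0.
      move=> uev; apply: IH; first exact: tops_color ev uev.
      by apply: (subsetP (EG eE)); move: uev; rewrite inE => /andP[].
    split.
    - rewrite subUset EG //=; apply/bigcupsP => u uev; exact: (uG u uev).1.
    - rewrite PE; apply: tight_bigcup; [exact: EG|exact: E0| |].
        move=> u; rewrite mem_enum => uev; have [h1 h2] := uG u uev; split=> //.
        apply/set0Pn; exists u; rewrite inE cn_self /=.
        by move: uev; rewrite inE => /andP[].
      rewrite -PE; apply: szsub cvB; rewrite (cnE _ _ v).
      by apply/subsetP => x xP; rewrite in_setU; apply/orP; right; apply/bigcupP; exists e.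
    by apply/set0Pn; exists v; rewrite /P !inE ve eqxx.
  rewrite cnE; split.
    by rewrite subUset sub1set vG /=; apply/bigcupsP => e ev; have [] := piece e ev.
  rewrite -big_enum; apply: tight_bigcup; rewrite ?sub1set ?dl1 //.
    by move=> e; rewrite mem_enum; apply: piece.
  by rewrite big_enum -cnE.
have memG e v u : e \in tops Es c v -> u \in e -> u \in G.
  by move=> ev; apply: (subsetP (EG (topE _ _ ev).1)).
have inD1 (e : {set T}) v u : u \in e :\ v -> u != v /\ u \in e by rewrite in_setD1 => /andP.
have nv e v u : e \in tops Es c v -> u \in e :\ v -> v \notin cn Es c u.
  move=> ev uev; have cu := tops_color ev uev; apply/negP => /cn_color[E|].
    by rewrite E ltnn in cu.
  by move/ltn_trans => /(_ _ cu); rewrite ltnn.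
have ej2 e : e \in Es -> (#|e| <= 2 * j)%N by move=> /Ej ->; rewrite leq_pmull.
have pair_tight v e e' u u' : e \in tops Es c v -> e' \in tops Es c v ->
    u \in e :\ v -> u' \in e' :\ v -> ~~ [disjoint cn Es c u & cn Es c u'] ->
    cn Es c u :|: cn Es c u' \subset G /\ dl (cn Es c u :|: cn Es c u') = 0.
  move=> ev e'v uev u'ev; rewrite -setI_eq0 => ne.
  have [uG u0] := tightcn u (memG e v u ev (inD1 _ _ _ uev).2).
  have [u'G u'0] := tightcn u' (memG e' v u' e'v (inD1 _ _ _ u'ev).2).
  split; first by rewrite subUset uG.
  apply: (tight_merge uG u'G u0 u'0 ne _).1.
  by apply: szsub (sizeB2 u u' set0 _); rewrite ?cards0 // set0U.
have two (Q : {set T}) x y : x \in Q -> y \in Q -> x != y -> (2 <= #|Q|)%N.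
  by move=> xQ yQ xy; apply/card_gt1P; exists x, y.
have same v e u u' : e \in tops Es c v ->
  u \in e :\ v -> u' \in e :\ v -> u != u' -> [disjoint cn Es c u & cn Es c u'].
  move=> ev uev u'ev uu'; apply/negPn/negP => nd.
  have [QG Q0] := pair_tight v e e u u' ev ev uev u'ev nd.
  have [eE ve] := topE _ _ ev.
  have : e \subset cn Es c u :|: cn Es c u'.
    apply: edge_meet => //; first by apply: sizeB2; apply: ej2.
    apply: (two _ u u') => //; rewrite in_setI in_setU cn_self ?orbT andbT.
      exact: (inD1 _ _ _ uev).2.
    exact: (inD1 _ _ _ u'ev).2.
  move/subsetP/(_ v ve); rewrite in_setU.
  by rewrite (negPf (nv e v u ev uev)) (negPf (nv e v u' ev u'ev)).
have diff v e e' u u' : e \in tops Es c v -> e' \in tops Es c v -> e != e' ->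
  u \in e :\ v -> u' \in e' :\ v -> [disjoint cn Es c u & cn Es c u'].
  move=> ev e'v ee' uev u'ev; apply/negPn/negP => nd.
  have [QG Q0] := pair_tight v e e' u u' ev e'v uev u'ev nd.
  have [eE ve] := topE _ _ ev; have [e'E ve'] := topE _ _ e'v.
  set Q := _ :|: _ in QG Q0.
  have vQ : v \notin Q.
    by rewrite in_setU (negPf (nv e v u ev uev)) (negPf (nv e' v u' e'v u'ev)).
  have eQ1 : (#|e :&: Q| <= 1)%N.
    rewrite leqNgt; apply: contra vQ => h.
    by apply: (subsetP (edge_meet eE QG Q0 (sizeB2 _ _ _ (ej2 _ eE)) h)).
  have ee1 : (#|e :&: e'| <= 1)%N.
    rewrite leqNgt; apply: contra ee' => h.
    rewrite eqEcard (Ej eE) (Ej e'E) leqnn andbT.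
    apply: edge_meet h => //; [exact: EG|exact: E0|].
    apply: szsub (sizeB2 u u (e :|: e') _); first exact: subsetUl.
    by apply: leq_trans (leq_card_setU _ _) _; rewrite !Ej // mul2n addnn.
  (* [e] shares [v] with [e'] and [u] with [Q], so the tight set [e' :|: Q] swallows it. Each of the
     two parts meets [e] at most once, so [e] would have at most two elements, against [j3]. *)
  have ue : e :&: (e' :|: Q) = e.
    apply/setIidPl; apply: edge_meet => //.
    - by rewrite subUset EG.
    - apply: (tight_merge (EG e'E) QG (E0 e'E) Q0 _ (sizeB2 _ _ _ (ej2 _ e'E))).1.
      apply/set0Pn; exists u'; rewrite in_setI in_setU cn_self orbT andbT.
      exact: (inD1 _ _ _ u'ev).2.
    - rewrite setUA; apply: sizeB2; apply: leq_trans (leq_card_setU _ _) _.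
      by rewrite !Ej // mul2n addnn.
    apply: (two _ u v); last exact: (inD1 _ _ _ uev).1.
      by rewrite /Q in_setI 2!in_setU cn_self orbT andbT; exact: (inD1 _ _ _ uev).2.
    by rewrite in_setI in_setU ve ve'.
  have := leq_trans (leq_card_setU (e :&: e') (e :&: Q)) (leq_add ee1 eQ1).
  by rewrite -setIUr ue Ej // leqNgt j3.
have j2 : (2 <= j)%N by apply: ltnW.
have q01 : 0 <= 1 - p ^+ j.-1 <= 1.
  by rewrite subr_ge0 gerBl exprn_ge0 ?exprn_ile1 ?ltW.
have [I [IG cI Iind]] := large_selection j2 p0 p1 Ej same diff
   (fun v => le_trans psmall (ler_wiXn2l (proj1 (andP q01)) (proj2 (andP q01)) (topsD v))) G.
by exists I; split=> // e eE; apply: Iind => //; apply: ci.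
Qed.

End TightSets.
(** * Beating the deletion method *)

Section RandomGraph.
Variable R : realType.

(** A sum of reciprocals replaces the minimum, so an empty index set needs no separate case. *)
Lemma finite_gap (I : finType) (P : pred I) (v : I -> R) :
  (forall i, P i -> 0 < v i) -> exists2 e, 0 < e & forall i, P i -> e <= v i.
Proof.
move=> vpos; pose s := \sum_(i | P i) (v i)^-1.
have s0 : 0 <= s by apply: sumr_ge0 => i /vpos vi; rewrite invr_ge0 ltW.
exists (1 + s)^-1; first by rewrite invr_gt0 ltr_pwDl.
move=> i Pi; have vi := vpos i Pi.
rewrite -[leRHS]invrK lef_pV2 ?posrE ?invr_gt0 //; last by rewrite ltr_pwDl.
rewrite /s (bigD1 i) //= addrCA lerDl addr_ge0 // sumr_ge0 // => k /andP[/vpos vk _].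
by rewrite invr_ge0 ltW.
Qed.

(** Choose the covered vertices, then any set of pairs among them. *)
Lemma card_cov_eq (n u : nat) :
  (#|[set Q : graph 'I_n | #|cov Q| == u]| <= n ^ u * 2 ^ (u ^ 2))%N.
Proof.
pose inside (U : {set 'I_n}) : graph 'I_n := [set e | endpoints e \subset U].
apply: (@leq_trans #|\bigcup_(U in [set U : {set 'I_n} | #|U| == u]) powerset (inside U)|).
  apply: subset_leq_card; apply/subsetP => Q; rewrite inE => cQ.
  apply/bigcupP; exists (cov Q); first by rewrite inE.
  rewrite inE; apply/subsetP => e eQ; rewrite inE; exact: endpoints_cov.
apply: leq_trans (card_bigcup_le (m := 2 ^ (u ^ 2)) _) _ => [U|].
  rewrite inE card_powerset => /eqP cU; rewrite leq_exp2l //.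
  rewrite -(card_imset _ val_inj).
  apply: (@leq_trans #|[set A : {set 'I_n} | (A \subset U) && (#|A| == 2%N)]|).
    apply: subset_leq_card; apply/subsetP => A /imsetP[e eI ->]; move: eI.
    by rewrite !inE => eU; rewrite -/(endpoints e) eU card_endpoints.
  rewrite cards_draws cU bin2 -divn2 -mulnn.
  by rewrite (leq_trans (leq_div _ _)) // leq_mul // leq_pred.
rewrite leq_mul2r card_draws card_ord; apply/orP; right.
rewrite -(leq_pmul2r (fact_gt0 u)) bin_ffact (leq_trans _ (leq_pmulr _ (fact_gt0 u))) //.
elim: u {inside} n => [|u IH] n; first by rewrite ffactn0.
rewrite ffactnS expnS leq_mul // (leq_trans (IH _)) //.
by case: u {IH} => [|u]; rewrite ?expn0 // leq_exp2r ?leq_pred.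
Qed.

Variables (V : finType) (S : graph V) (mu : R).
Local Notation j := #|S|.
Local Notation w := #|cov S|.
Hypotheses (mu0 : 0 < mu) (j3 : (3 <= j)%N).
Hypothesis Smu : j%:R - 1 = mu * (w%:R - 2).
Hypothesis Slt : forall U : graph V, U \subset S -> (2 <= #|U|)%N -> U != S ->
  #|U|%:R - 1 < mu * (#|cov U|%:R - 2).

Section FixN.
Variable n : nat.
Implicit Types (Q X : graph 'I_n).

(** In a random graph of density n^(-1/mu), the expected number of copies of [Q] is of the order of
    the number of edges times n^(-excess/mu). Copies with positive excess are thus rarer than
    edges. *)
Definition excess Q : R := #|Q|%:R - 1 - mu * (#|cov Q|%:R - 2).

Definition embeddings : {set graph 'I_n} :=
  [set Q | `[< exists (f : V -> 'I_n) (fi : injective f), Q = eimg fi @: S >] ].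

Lemma excess_super Q Q' : excess Q + excess Q' <= excess (Q :|: Q') + excess (Q :&: Q').
Proof.
have E1 : #|Q :|: Q'|%:R + #|Q :&: Q'|%:R = #|Q|%:R + #|Q'|%:R :> R.
  by rewrite -!natrD cardsUI.
have E2 : #|cov (Q :|: Q')|%:R + #|cov (Q :&: Q')|%:R <= #|cov Q|%:R + #|cov Q'|%:R :> R.
  by rewrite -!natrD ler_nat covU -(cardsUI (cov Q)) leq_add2l subset_leq_card // covI.
have := ler_wpM2l (ltW mu0) E2; rewrite /excess !mulrBr !mulrDr.
move: E1; move: (#|Q :|: Q'|%:R) (#|Q :&: Q'|%:R) (#|Q|%:R) (#|Q'|%:R).
move: (mu * #|cov (Q :|: Q')|%:R) (mu * #|cov (Q :&: Q')|%:R) (mu * #|cov Q|%:R) (mu * #|cov Q'|%:R).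
move=> a b c d x y z t; lra.
Qed.

Lemma excess1 e : excess [set e] = 0.
Proof. by rewrite /excess cov1 card_endpoints cards1 !subrr mulr0 subrr. Qed.

Lemma embeddingsP Q : Q \in embeddings ->
  [/\ #|Q| = j, #|cov Q| = w & forall U : graph 'I_n, U \subset Q -> exists U' : graph V,
     [/\ U' \subset S, #|U'| = #|U| & #|cov U'| = #|cov U|]].
Proof.
rewrite inE => /asboolP[f [fi ->]]; rewrite card_eimg card_cov_eimg; split=> // U UQ.
exists [set e in S | eimg fi e \in U].
have E : U = eimg fi @: [set e in S | eimg fi e \in U].
  apply/setP => e; apply/idP/imsetP.
    move=> eU; have := subsetP UQ _ eU => /imsetP[e' e'H eE].
    by exists e' => //; rewrite inE e'H -eE.
  by case=> e'; rewrite inE => /andP[_ e'U] ->.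
split; first by apply/subsetP => e; rewrite inE => /andP[].
  by rewrite [in RHS]E card_eimg.
by rewrite [in RHS]E card_cov_eimg.
Qed.

Lemma excess_embedding Q : Q \in embeddings -> excess Q = 0.
Proof. by case/embeddingsP => c1 c2 _; rewrite /excess c1 c2 Smu subrr. Qed.

Lemma excess_lt Q (U : graph 'I_n) : Q \in embeddings -> U \subset Q -> (2 <= #|U|)%N -> U != Q ->
  excess U < 0.
Proof.
case/embeddingsP => c1 c2 H UQ U2 UneQ; have [U' [U'S cU covU]] := H U UQ.
rewrite /excess subr_lt0 -cU -covU; apply: Slt; rewrite ?cU //.
apply: contra UneQ => /eqP U'E; rewrite eqEcard UQ c1 -cU U'E leqnn //.
Qed.

Variables (B D : nat).
Hypothesis D0 : (0 < D)%N.

Definition bad Q : bool := [&& Q != set0, (#|Q| <= B)%N & 0 < excess Q].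

(** A lower bound for the edges left after deleting one edge from each bad set and every edge in
    more than [D] embeddings. Double counting incidences bounds the latter by [j / D] times the
    number of embeddings. *)
Definition score X : R := \sum_(e : edge 'I_n) ([set e] \subset X)%:R -
  \sum_(Q | bad Q) (Q \subset X)%:R -
  j%:R / D%:R * \sum_(Q in embeddings) (Q \subset X)%:R.

Lemma prune X : exists G : graph 'I_n, [/\ score X <= #|G|%:R,
  forall Q, Q \subset G -> Q != set0 -> (#|Q| <= B)%N -> excess Q <= 0 &
  forall e, (#|[set Q in [set Q in embeddings | Q \subset G] | e \in Q]| <= D)%N].
Proof.
pose dg e := #|[set Q in embeddings | (Q \subset X) && (e \in Q)]|.
pose pk Q : option (edge 'I_n) := [pick e in Q].
pose high := [set e in X | (D < dg e)%N].
pose hit := [set e in X | [exists Q : graph 'I_n, [&& bad Q, Q \subset X & pk Q == Some e]]].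
pose G := X :\: (high :|: hit).
have GX : G \subset X by apply: subsetDl.
exists G; split.
- have c1 : #|X|%:R <= #|G|%:R + (#|high|%:R + #|hit|%:R) :> R.
    rewrite -!natrD ler_nat -(cardsID (high :|: hit) X) -/G addnC leq_add2l.
    apply: leq_trans (leq_card_setU high hit); apply: subset_leq_card; exact: subsetIr.
  have c2 : #|hit|%:R <= \sum_(Q | bad Q) (Q \subset X)%:R :> R.
    rewrite -natr_sum ler_nat.
    apply: (@leq_trans #|[set Q | bad Q && (Q \subset X)]|); last first.
      rewrite -sum1_card big_mkcond [leqRHS]big_mkcond /= leq_sum // => Q _.
      by rewrite inE; case: (bad Q); case: (Q \subset X).
    rewrite -(card_imset _ (@Some_inj _)).
    apply: leq_trans (leq_imset_card pk _); apply: subset_leq_card.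
    apply/subsetP => x /imsetP[e]; rewrite inE => /andP[_ /existsP[Q /and3P[bQ QX /eqP pQ]]] ->.
    by apply/imsetP; exists Q; rewrite ?inE ?bQ.
  have c3 : #|high|%:R <= j%:R / D%:R * \sum_(Q in embeddings) (Q \subset X)%:R :> R.
    rewrite mulrAC ler_pdivlMr ?ltr0n // -natr_sum -!natrM ler_nat.
    apply: (@leq_trans (\sum_e dg e)).
      rewrite -sum_nat_const big_mkcond leq_sum // => e _.
      by case: ifP => //; rewrite inE => /andP[_ /ltnW].
    rewrite /dg; under eq_bigr => e _ do rewrite -sum1_card.
    rewrite (exchange_big_dep (fun Q => (Q \in embeddings) && (Q \subset X))) /=; last first.
      by move=> e Q _; rewrite inE => /and3P[-> ->].
    rewrite big_distrr /= big_mkcond [leqRHS]big_mkcond /= leq_sum // => Q _.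
    case: (boolP (Q \in embeddings)) => //= Qe; case: (boolP (Q \subset X)) => //= QX.
    have [<- _ _] := embeddingsP Qe; rewrite muln1 sum1_card; apply: subset_leq_card.
    apply/subsetP => e He; have : Q \in [set Q in embeddings | (Q \subset X) && (e \in Q)] by exact: He.
    by rewrite inE => /and3P[].
  have -> : score X = #|X|%:R - \sum_(Q | bad Q) (Q \subset X)%:R -
      j%:R / D%:R * \sum_(Q in embeddings) (Q \subset X)%:R.
    rewrite /score; congr (_ - _ - _).
    rewrite -sum1_card natr_sum [RHS]big_mkcond /=; apply: eq_bigr => e _.
    by rewrite sub1set; case: (e \in X).
  move: c1 c2 c3; move: (\sum_(Q | _) _) (_ * _) => a b; lra.
- move=> Q QG Q0 QB; rewrite leNgt; apply/negP => Qex.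
  have bQ : bad Q by rewrite /bad Q0 QB.
  have QX := subset_trans QG GX.
  have [e pQ eQ] : exists2 e, pk Q = Some e & e \in Q.
    rewrite /pk; case: pickP => [e eQ|no]; first by exists e.
    by case/set0Pn: Q0 => e; rewrite no.
  have := subsetP QG _ eQ; rewrite in_setD in_setU negb_or => /andP[/andP[_ /negP nh] eX]; apply: nh.
  by rewrite inE eX /=; apply/existsP; exists Q; rewrite bQ QX pQ eqxx.
move=> e; case: (boolP (e \in G)) => eG; last first.
  rewrite (_ : [set Q in _ | _] = set0) ?cards0 //; apply/setP => Q; rewrite !inE.
  by apply/negP => /andP[/andP[_ QG] eQ]; rewrite (subsetP QG) in eG.
have := eG; rewrite in_setD in_setU negb_or => /andP[/andP[eh _] eX].
move: eh; rewrite inE eX /= -leqNgt; apply: leq_trans.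
apply: subset_leq_card; apply/subsetP => Q; rewrite !inE => /andP[/andP[-> QG] ->].
by rewrite (subset_trans QG GX).
Qed.

Lemma Ex_score (p : R) : Ex (fun _ : edge 'I_n => p) score =
  'C(n, 2)%:R * p - \sum_(Q | bad Q) p ^+ #|Q| - j%:R / D%:R * (#|embeddings|%:R * p ^+ j).
Proof.
have ExQ Q : Ex (fun _ : edge 'I_n => p) (fun X => (Q \subset X)%:R) = p ^+ #|Q|.
  by rewrite Ex_subset prodr_const.
rewrite /score ExB ExB ExZ !Ex_sum; congr (_ - _ - _ * _).
- rewrite (eq_bigr (fun=> p)); last by move=> e _; rewrite ExQ cards1 expr1.
  by rewrite sumr_const -[LHS]mulr_natl -[in RHS](card_ord n) -card_edge.
- by apply: eq_bigr => Q _; rewrite ExQ.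
rewrite (eq_bigr (fun=> p ^+ j)); last first.
  by move=> Q /embeddingsP[cQ _ _]; rewrite ExQ cQ.
by rewrite sumr_const -[LHS]mulr_natl.
Qed.

End FixN.
End RandomGraph.
Section DenseFreeGraph.
Variables (R : realType) (V : finType) (S : graph V) (mu : R).
Local Notation j := #|S|.
Local Notation w := #|cov S|.
Hypotheses (mu0 : 0 < mu) (j3 : (3 <= j)%N).
Hypothesis Smu : j%:R - 1 = mu * (w%:R - 2).
Hypothesis Slt : forall U : graph V, U \subset S -> (2 <= #|U|)%N -> U != S ->
  #|U|%:R - 1 < mu * (#|cov U|%:R - 2).

Lemma card_cov_le n (Q : graph 'I_n) : (#|cov Q| <= 2 * #|Q|)%N.
Proof.
rewrite mulnC; apply: (card_bigcup_le (m := 2)) => e _.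
by rewrite card_endpoints.
Qed.

(** Bad sets have boundedly many pairs of edge and vertex numbers, so their excess is bounded away
    from 0 and each type is rarer than edges by a fixed power of [n]. *)
Lemma sum_bad_le (B K : nat) : (0 < K)%N -> exists2 eps : R, 0 < eps &
  forall n : nat, (0 < n)%N ->
  \sum_(Q : graph 'I_n | bad mu B Q) (K%:R * n%:R `^ (- mu^-1)) ^+ #|Q| <=
  ((2 * B).+1 * 2 ^ ((2 * B) ^ 2) * K ^ B)%:R * n%:R `^ (2 - mu^-1 - eps).
Proof.
move=> K0.
pose P (q : 'I_(2 * B).+1 * 'I_B.+1) := (q.2%:R - 1 > mu * (q.1%:R - 2) :> R).
pose v (q : 'I_(2 * B).+1 * 'I_B.+1) : R := (q.2%:R - 1) / mu - (q.1%:R - 2).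
have Pv q : P q -> 0 < v q.
  by case: q => u i; rewrite /P /v /= => h; rewrite subr_gt0 ltr_pdivlMr // mulrC.
have [eps eps0 epsP] := finite_gap Pv.
exists eps => // n n1.
have n0 : 0 < n%:R :> R by rewrite ltr0n.
have n1R : 1 <= n%:R :> R by rewrite ler1n.
have covB (Q : graph 'I_n) : (#|Q| <= B)%N -> (#|cov Q| <= 2 * B)%N.
  by move=> QB; apply: leq_trans (card_cov_le Q) _; rewrite leq_mul2l.
have one (Q : graph 'I_n) : bad mu B Q ->
   (K%:R * n%:R `^ (- mu^-1)) ^+ #|Q| <=
   (K ^ B)%:R * n%:R `^ (2 - mu^-1 - eps - #|cov Q|%:R) :> R.
  case/and3P => Q0 QB Qex; rewrite exprMn natrX ler_pM ?exprn_ge0 ?powR_ge0 //.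
    by rewrite ler_weXn2l // ler1n.
  rewrite -powR_mulrn ?powR_ge0 // -powRrM; apply: ler_powR => //.
  have := epsP (inord #|cov Q|, inord #|Q|).
  rewrite /P /v /= !inordK ?ltnS ?covB // => h.
  have : eps <= (#|Q|%:R - 1) / mu - (#|cov Q|%:R - 2).
    by apply: h; move: Qex; rewrite /excess subr_gt0.
  rewrite mulNr mulrBl mul1r [mu^-1 * _]mulrC.
  by set a := _ / mu; set b := mu^-1; lra.
apply: le_trans (ler_sum _ one) _.
rewrite -mulr_sumr.
rewrite (partition_big (fun Q : graph 'I_n => inord #|cov Q| : 'I_(2 * B).+1) predT) //=.
pose X := n%:R `^ (2 - mu^-1 - eps) : R.
have X0 : 0 < X by rewrite /X; pos.
have K0' : 0 <= (K ^ B)%:R :> R by [].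
rewrite -/X [leRHS](_ : _ = (K ^ B)%:R * (\sum_(u < (2 * B).+1) (2 ^ ((2 * B) ^ 2))%:R * X)); last first.
  by rewrite sumr_const card_ord -[X in _ = _ * X]mulr_natl !natrM; ring.
rewrite ler_wpM2l //; apply: ler_sum => u _.
apply: (@le_trans _ _ (\sum_(Q : graph 'I_n | #|cov Q| == u) X * n%:R `^ (- u%:R))).
  rewrite big_mkcond [leRHS]big_mkcond; apply: ler_sum => Q _.
  case: ifP => [/andP[/and3P[_ QB _] /eqP uE]|_]; last by case: ifP => // _; pos.
  have -> : #|cov Q| = u by rewrite -uE inordK // ltnS covB.
  by rewrite eqxx /X -powRD // (gt_eqF n0) implybT.
rewrite sumr_const -[leLHS]mulr_natl.
have cu : (#|[pred Q : graph 'I_n | #|cov Q| == u]| <= n ^ u * 2 ^ ((2 * B) ^ 2))%N.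
  rewrite (eq_card (B := mem [set Q : graph 'I_n | #|cov Q| == u])); last by move=> Q; rewrite !inE.
  apply: leq_trans (card_cov_eq n u) _; rewrite leq_mul2l leq_exp2l // leq_sqr.
  by rewrite -ltnS ltn_ord orbT.
apply: (@le_trans _ _ ((n ^ u * 2 ^ ((2 * B) ^ 2))%:R * (X * n%:R `^ (- u%:R)))).
  rewrite ler_wpM2r ?ler_nat; [|by pos|exact: cu].
  done.
rewrite powRN powR_mulrn ?ler0n // natrM natrX le_eqVlt; apply/orP; left; apply/eqP.
have nu : n%:R ^+ u != 0 :> R by rewrite gt_eqF // exprn_gt0.
by rewrite (mulrC X) mulrACA divff // mul1r.
Qed.

(** At density K n^(-1/mu) about K n^(2-1/mu) edges are expected, up to a constant. Bad sets are of
    smaller order in [n]. Embeddings of [S] have the same order but carry K^j, so a degree cutoff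
    [D] of order K^(j-1) makes them affordable. *)
Lemma dense_random_graph (B K D : nat) : (0 < K)%N ->
  (16 * j * 2 ^ (w ^ 2) * K ^ j.-1 <= D)%N ->
  exists n : nat, (0 < n)%N /\ exists G : graph 'I_n,
  [/\ K%:R / 8 * n%:R `^ (2 - mu^-1) <= #|G|%:R :> R,
  forall Q : graph 'I_n, Q \subset G -> Q != set0 -> (#|Q| <= B)%N -> excess mu Q <= 0 &
  forall e, (#|[set Q in [set Q in embeddings S n | Q \subset G] | e \in Q]| <= D)%N].
Proof.
move=> K0 HD.
have [eps eps0 bad_le] := sum_bad_le B K0.
pose C1 : R := 16 * ((2 * B).+1 * 2 ^ ((2 * B) ^ 2) * K ^ B)%:R.
(* The first term makes the bad sets negligible, the second makes [p <= 1], and the two successors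
   give [n >= 2]. *)
pose n := (Num.truncn (C1 `^ eps^-1 + K%:R `^ mu)).+2.
have nbig : C1 `^ eps^-1 + K%:R `^ mu <= n%:R.
  by apply: le_trans (ltW (truncnS_gt _)) _; rewrite ler_nat.
have n0 : 0 < n%:R :> R by rewrite ltr0n.
have C10 : 0 <= C1 by rewrite /C1; pos.
have nK : K%:R <= n%:R `^ mu^-1.
  have -> : K%:R = (K%:R `^ mu) `^ mu^-1 :> R by rewrite -powRrM mulfV ?gt_eqF // powRr1.
  apply: ge0_ler_powR; rewrite ?nnegrE ?invr_ge0; try by pos.
  by apply: le_trans nbig; rewrite lerDr; pos.
have nC1 : C1 <= n%:R `^ eps.
  have -> : C1 = (C1 `^ eps^-1) `^ eps by rewrite -powRrM mulVf ?gt_eqF // powRr1.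
  apply: ge0_ler_powR; rewrite ?nnegrE; try by pos.
  by apply: le_trans nbig; rewrite lerDl; pos.
have n2 : (2 <= n)%N by [].
clearbody n; exists n; split; first exact: ltnW.
have n1 := ltnW n2.
pose p : R := K%:R * n%:R `^ (- mu^-1).
have p0 : 0 <= p by rewrite /p; pos.
have p1 : p <= 1.
  by rewrite /p powRN ler_pdivrMr ?powR_gt0 // mul1r.
have D0 : (0 < D)%N.
  by apply: leq_trans HD; rewrite !muln_gt0 !expn_gt0 K0 /= andbT; case: j j3.
pose nb := n%:R `^ (2 - mu^-1) : R.
have nb0 : 0 < nb by rewrite /nb; pos.
have p01 (v : edge 'I_n) : 0 <= p <= 1 by rewrite p0.
have [X HX] := Ex_exists p01 (@score R V S mu n B D).
have [G [sG HG dG]] := @prune R V S mu n B D D0 X.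
exists G; split=> //; apply: le_trans sG; apply: le_trans HX.
rewrite Ex_score -/nb.
have e1 : K%:R / 4 * nb <= 'C(n, 2)%:R * p.
  have c4 : (n ^ 2 <= 4 * 'C(n, 2))%N.
    have E : (n * n.-1 = 2 * 'C(n, 2))%N by rewrite -mul_bin_diag bin1.
    have -> : (4 * 'C(n, 2) = 2 * (2 * 'C(n, 2)))%N by rewrite mulnA.
    rewrite -E.
    by rewrite mulnCA -mulnn leq_mul //; move: n2; clear; case: n => [|[|n]] // _; lia.
  have -> : nb = (n ^ 2)%:R * n%:R `^ (- mu^-1).
    by rewrite /nb powRD ?(gt_eqF n0) ?implybT // natrX powR_mulrn.
  rewrite /p [leRHS](_ : _ = K%:R / 4 * ((4 * 'C(n, 2))%:R * n%:R `^ (- mu^-1))); last first.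
    by rewrite natrM; field.
  rewrite ler_wpM2l //; first by pos.
  by rewrite ler_pM2r ?powR_gt0 // ler_nat.
have e2 : \sum_(Q : graph 'I_n | bad mu B Q) p ^+ #|Q| <= K%:R / 16 * nb.
  apply: le_trans (bad_le n n1) _.
  have -> : nb = n%:R `^ eps * n%:R `^ (2 - mu^-1 - eps).
    by rewrite -powRD ?(gt_eqF n0) ?implybT // addrC subrK.
  rewrite mulrA ler_pM2r ?powR_gt0 //.
  apply: (@le_trans _ _ (C1 / 16)).
    by rewrite /C1 mulrAC divff ?mul1r // pnatr_eq0.
  apply: (@le_trans _ _ (1 / 16 * n%:R `^ eps)); first by rewrite mul1r mulrC ler_pM2l // invr_gt0.
  by rewrite ler_pM2r ?powR_gt0 // ler_pM2r ?invr_gt0 // ler1n.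
have e3 : j%:R / D%:R * (#|embeddings S n|%:R * p ^+ j) <= K%:R / 16 * nb.
  have emb : (#|embeddings S n| <= n ^ w * 2 ^ (w ^ 2))%N.
    apply: leq_trans (card_cov_eq n w); apply: subset_leq_card.
    by apply/subsetP => Q /embeddingsP[_ cQ _]; rewrite inE cQ.
  have -> : p ^+ j = (K ^ j)%:R * n%:R `^ (- (j%:R / mu)).
    rewrite /p exprMn natrX -[(n%:R `^ _) ^+ j]powR_mulrn ?powR_ge0 // -powRrM.
    by congr (_ * _ `^ _); rewrite mulNr mulrC.
  have nbE : nb = (n ^ w)%:R * n%:R `^ (- (j%:R / mu)).
    rewrite natrX -powR_mulrn // -powRD ?(gt_eqF n0) ?implybT //; congr (_ `^ _).
    have -> : j%:R = 1 + mu * (w%:R - 2) by rewrite -Smu addrC subrK.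
    by field; rewrite gt_eqF.
  set z := n%:R `^ _ in nbE *.
  have z0 : 0 < z by rewrite /z; pos.
  apply: (@le_trans _ _ (j%:R / D%:R * ((n ^ w * 2 ^ (w ^ 2))%:R * ((K ^ j)%:R * z)))).
    rewrite ler_wpM2l ?divr_ge0 //; apply: ler_wpM2r; last by rewrite ler_nat.
    by pos.
  rewrite nbE mulrAC ler_pdivrMr ?ltr0n //.
  have h : j%:R * (2 ^ (w ^ 2))%:R * (K ^ j)%:R * 16 <= K%:R * D%:R :> R.
    rewrite -!natrM ler_nat; apply: leq_trans (leq_mul (leqnn K) HD).
    have -> : (K ^ j = K * K ^ j.-1)%N by rewrite -expnS prednK //; case: j j3.
    by rewrite !mulnA leq_eqVlt; apply/orP; left; apply/eqP; clear; lia.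
  rewrite natrM; move: (n ^ w)%:R (2 ^ (w ^ 2))%:R (K ^ j)%:R (j%:R) K%:R D%:R h
    (ler0n R (n ^ w)) => a b k jj kk d h a0.
  have -> : jj * (a * b * (k * z)) = a * z * (jj * b * k) by ring.
  have -> : kk / 16 * (a * z) * d = a * z * (kk * d / 16) by ring.
  by rewrite ler_wpM2l ?mulr_ge0 ?(ltW z0) // ler_pdivlMr.
have -> : K%:R / 8 * nb = K%:R / 4 * nb - K%:R / 16 * nb - K%:R / 16 * nb by field.
by apply: lerB => //; apply: lerB.
Qed.

(* The exponent is that of the deletion method; the gain is the arbitrary A. *)
Lemma dense_free_graph (A : R) : 0 < A -> exists n : nat, (0 < n)%N /\
  exists I : graph 'I_n, A * n%:R `^ (2 - mu^-1) < #|I|%:R /\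
    forall (f : V -> 'I_n) (fi : injective f), ~~ (eimg fi @: S \subset I).
Proof.
move=> A0.
(* With q = M/K the selection keeps M/8 > A times n^(2-1/mu) edges. Since D q^(j-1) = c0 M^(j-1) =
   Lam does not involve K, the chance (1 - q^(j-1))^D of not being blocked is at least exp(-2 Lam),
   and K >= M exp(2 Lam) makes q smaller than that. The term 2 M in K gives q <= 1/2. *)
pose M : R := 8 * A + 8; have M0 : 0 < M by rewrite /M; pos.
pose c0 : nat := (16 * j * 2 ^ (w ^ 2))%N.
pose Lam : R := c0%:R * M ^+ j.-1.
pose K := (Num.truncn (M * expR (2 * Lam) + 2 * M)).+1.
have KM : M * expR (2 * Lam) + 2 * M <= K%:R by exact/ltW/truncnS_gt.
have K0 : 0 < K%:R :> R by rewrite ltr0n.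
have Lam0 : 0 <= Lam by rewrite /Lam; pos.
pose D := (c0 * K ^ j.-1)%N.
pose B := (2 * cone_size j D (D * j).+1 + 2 * j)%N.
have [n [n1 [G [Gbig HG dG]]]] := @dense_random_graph B K D isT (leqnn _).
exists n; split=> //.
have n0 : 0 < n%:R :> R by rewrite ltr0n.
pose q := M / K%:R.
have q0 : 0 < q by rewrite /q; pos.
have ex0 : 0 < expR (2 * Lam) := expR_gt0 _.
have qhalf : q <= 2^-1.
  rewrite /q ler_pdivrMr // mulrC ler_pdivlMr // mulrC (le_trans _ KM) // lerDr; pos.
have q1 : q < 1 by apply: le_lt_trans qhalf _; rewrite invf_lt1 // ltr1n.
pose x := q ^+ j.-1.
have x0 : 0 <= x by rewrite /x; pos.
have xhalf : x <= 2^-1.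
  apply: le_trans qhalf; rewrite /x -[leRHS]expr1; apply: ler_wiXn2l; rewrite ?(ltW q0) ?(ltW q1) //.
  by case: j j3 => [|[|]].
have qD : q <= (1 - x) ^+ D.
  apply: (@le_trans _ _ (expR (- (2 * Lam)))).
    rewrite expRN -[leRHS]mul1r ler_pdivlMr // /q mulrAC ler_pdivrMr // mul1r.
    by rewrite (le_trans _ KM) // lerDl; pos.
  have -> : - (2 * Lam) = D%:R * (- (2 * x)).
    rewrite /Lam /x /q /D expr_div_n natrM natrX.
    have Kj : 0 < K%:R ^+ j.-1 :> R by pos.
    move: (K%:R ^+ j.-1) (M ^+ j.-1) Kj => a b a0; field.
    by rewrite gt_eqF.
  rewrite expRM_natl lerXn2r ?nnegrE ?expR_ge0 //; first by move: xhalf; lra.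
  rewrite expRN -[leLHS]mul1r ler_pdivrMr ?expR_gt0 //.
  apply: (@le_trans _ _ ((1 - x) * (1 + 2 * x))); first by move: xhalf x0; nra.
  by rewrite ler_wpM2l ?expR_ge1Dx //; move: xhalf; lra.
pose Es := [set Q in embeddings S n | Q \subset G].
have EsP Q : Q \in Es -> Q \in embeddings S n /\ Q \subset G.
  by rewrite inE => /andP[].
have [||||||||||I [IG cI Iind]] := @independent_of_tight R _ (@excess R mu n) G Es j D B _ _ _ _ _ _ _ _ _ _ q q0 q1 qD.
- by move=> Q Q' _; apply: excess_super.
- by move=> Q QG Q0 QB; apply: HG.
- by move=> e /EsP[].
- by move=> e /EsP[/embeddingsP[]].
- by move=> e /EsP[eE _]; apply: (excess_embedding Smu).
- by move=> e Q /EsP[eE _]; apply: (excess_lt Slt).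
- by move=> e; apply: excess1.
- exact: dG.
- exact: j3.
- exact: leqnn.
exists I; split.
  apply: lt_le_trans cI; apply: lt_le_trans (ler_wpM2l (ltW q0) Gbig).
  rewrite /q [ltRHS](_ : _ = M / 8 * n%:R `^ (2 - mu^-1)); last by field; rewrite gt_eqF.
  by rewrite ltr_pM2r ?powR_gt0 // ltr_pdivlMr // mulrC /M ltrDl.
move=> f fi; apply/negP => sub; have := Iind (eimg fi @: S).
rewrite inE (subset_trans sub IG) andbT sub => /(_ _)/negP; apply => //.
by rewrite inE; apply/asboolP; exists f, fi.
Qed.

End DenseFreeGraph.

(** * Densest subgraphs and the condition lambda > 1 *)

Section LambdaGt1.
Variables (R : realType) (V : finType) (H : graph V).

Lemma next_next_neq (s : seq V) x : uniq s -> (2 < size s)%N -> x \in s ->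
  next s x != x /\ next s (next s x) != x.
Proof.
move=> us s3 xs; have [i s' E] := rot_to xs.
have us' : uniq (x :: s') by rewrite -E rot_uniq.
have nE y : next s y = next (x :: s') y by rewrite -E next_rot.
have : (2 < size (x :: s'))%N by rewrite -E size_rot.
rewrite !nE; case: s' us' {E nE} => [|y [|z s']] //= /and3P[].
rewrite !inE !negb_or => /and3P[xy xz _] /andP[yz _] _ _.
by rewrite !eqxx /= eq_sym xy (negPf xy) eq_sym xz.
Qed.

(** Successive pairs along a cycle with more than two vertices are distinct edges, so there are at
    least as many edges as vertices. *)
Lemma cycle_subgraph : has_cycle H -> exists U : graph V,
  [/\ U \subset H, (#|cov U| <= #|U|)%N & (3 <= #|U|)%N].
Proof.
case=> s s3 /andP[cs us].
pose U := [set e in H | endpoints e \subset [set x in s]].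
have edgeP x : x \in s -> exists2 e : edge V, e \in U & endpoints e = [set x; next s x].
  move=> xs; have := next_cycle cs xs; rewrite /adj /= => /imsetP[e eH eE].
  exists e; last by [].
  rewrite inE eH -eE; apply/subsetP => y; rewrite !inE => /orP[]/eqP-> //.
  by rewrite mem_next.
have [f fP] : exists f : V -> option (edge V), forall x, x \in s ->
    exists e, [/\ f x = Some e, e \in U & endpoints e = [set x; next s x]].
  exists (fun x => [pick e in U | endpoints e == [set x; next s x]]) => x xs.
  case: pickP => [e /andP[eU /eqP eE]|no]; first by exists e.
  by have [e eU eE] := edgeP x xs; have := no e; rewrite eU eE eqxx.
have sU : (size s <= #|U|)%N.
  have : uniq (map f s).
    rewrite map_inj_in_uniq // => x y xs ys E.
    have [e [fx _ ex]] := fP x xs; have [e' [fy _ ey]] := fP y ys.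
    have {}E : e = e' by move: E; rewrite fx fy => -[].
    have XY : [set x; next s x] = [set y; next s y] by rewrite -ex -ey E.
    have : x \in [set y; next s y] by rewrite -XY !inE eqxx.
    rewrite !inE => /orP[/eqP//|/eqP xny].
    have : y \in [set x; next s x] by rewrite XY !inE eqxx.
    rewrite !inE => /orP[/eqP//|/eqP ynx].
    have [_ /eqP] := next_next_neq us s3 xs; case.
    by rewrite -ynx.
  move/card_uniqP; rewrite size_map => <-.
  rewrite -(card_imset _ (@Some_inj _)); apply: subset_leq_card.
  apply/subsetP => o /mapP[x xs ->]; have [e [-> eU _]] := fP x xs.
  exact: imset_f.
exists U; split.
- by apply/subsetP => e; rewrite inE => /andP[].
- apply: leq_trans sU; apply: (@leq_trans #|[set x in s]|).
    apply: subset_leq_card; rewrite cov_sub; apply/forall_inP => e.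
    by rewrite inE => /andP[].
  by rewrite cardsE card_size.
exact: leq_trans s3 sU.
Qed.

(** Deleting one edge from the subgraph around a cycle makes it proper and leaves at least v-1 edges
    on its v covered vertices. *)
Lemma m2star_ge1 : has_cycle H -> 1 <= m2star R H.
Proof.
move=> /cycle_subgraph[U [UH cU U3]].
have [e eU] : exists e, e \in U by apply/card_gt0P; apply: leq_trans U3.
have cUe : (#|U :\ e|.+1 = #|U|)%N by rewrite (cardsD1 e U) eU.
have c2 : (2 < #|cov (U :\ e)|)%N by apply: cov_gt2; rewrite -ltnS cUe.
have nf : ~~ full H (U :\ e).
  rewrite negb_and; apply/orP; left; rewrite neq_ltn -ltnS cUe.
  by rewrite ltnS subset_leq_card.
have UeH : U :\ e \subset H := subset_trans (subsetDl _ _) UH.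
have := @m2star_ub R _ _ _ UeH c2 nf.
have cle : (#|cov (U :\ e)| <= #|U :\ e|.+1)%N.
  by rewrite cUe; apply: leq_trans cU; apply: subset_leq_card; apply: covS; apply: subsetDl.
have cp : 0 < #|cov (U :\ e)|%:R - 2 :> R by rewrite subr_gt0 ltr_nat.
rewrite -ler_pdivrMr //; apply: le_trans; rewrite ler_pdivlMr // mul1r.
have : #|cov (U :\ e)|%:R <= #|U :\ e|%:R + 1 :> R by rewrite natr1 ler_nat.
by lra.
Qed.

(** The supremum ranges over finitely many densities, so if all were below [b] they would be so by a
    fixed gap. Replacing the vertex set of a witness by the vertices its edges cover only shrinks
    the denominator. *)
Lemma m2star_attained (b : R) : has_cycle H -> 0 < b -> b <= m2star R H ->
  exists U : graph V, [/\ U \subset H, (2 <= #|U|)%N &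
    b * (#|cov U|%:R - 2) <= #|U|%:R - 1].
Proof.
move=> cyc b0 bm.
pose ok (F : {set V} * graph V) := [&& F \in subgraph H, F != ([set: V], H) & (2 < #|F.1|)%N].
pose d (F : {set V} * graph V) : R := (#|F.2|%:R - 1) / (#|F.1|%:R - 2).
have [F /andP[/and3P[FH _ F2] bF]|none] := pickP (fun F => ok F && (b <= d F)).
  have c2 : 0 < #|F.1|%:R - 2 :> R by rewrite subr_gt0 ltr_nat.
  have bF' : b * (#|F.1|%:R - 2) <= #|F.2|%:R - 1 by rewrite -ler_pdivlMr.
  move: FH; rewrite inE => /andP[FH /forall_inP Fe].
  exists F.2; split=> //.
    have : 0 < #|F.2|%:R - 1 :> R by apply: lt_le_trans bF'; pos.
    by rewrite subr_gt0 ltr1n.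
  apply: le_trans bF'; rewrite ler_pM2l // lerD2r ler_nat.
  by apply: subset_leq_card; rewrite cov_sub; apply/forall_inP.
exfalso.
have [eps eps0 epsP] : exists2 eps : R, 0 < eps & forall F, ok F -> eps <= b - d F.
  apply: finite_gap => F okF; rewrite subr_gt0 ltNge; apply/negP => bF.
  by have := none F; rewrite okF bF.
suff : m2star R H <= b - eps by move/(le_trans bm); lra.
apply: ge_sup.
  have [U [UH cU U3]] := cycle_subgraph cyc.
  have [e eU] : exists e, e \in U by apply/card_gt0P; apply: leq_trans U3.
  have cUe : (#|U :\ e|.+1 = #|U|)%N by rewrite (cardsD1 e U) eU.
  exists (d (cov (U :\ e), U :\ e)), (cov (U :\ e), U :\ e); split=> //=.
  - rewrite inE (subset_trans (subsetDl _ _) UH) /=.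
    by apply/forall_inP => e'; apply: endpoints_cov.
  - case=> _ E; have := subset_leq_card UH; rewrite -cUe -E ltnn //.
  by apply: cov_gt2; rewrite -ltnS cUe.
move=> x [F [FH /eqP Fne F2 ->]].
have okF : ok F by rewrite /ok FH Fne.
by have := epsP F okF; rewrite /d; lra.
Qed.

Variables (A alpha : R).

(** If lambda <= 1, some subgraph has density at least 1/(2-alpha), and so has the densest one [S],
    of density mu. Graphs without [S] are H-free, and [dense_free_graph] gives one with more than A
    n^(2-1/mu) >= A n^alpha edges. *)
Lemma lambdastar_gt1 : has_cycle H -> 0 < A -> 0 < alpha -> alpha < 2 ->
  (forall n : nat, (turan n H)%:R <= A * n%:R `^ alpha) ->
  1 < lambdastar alpha H.
Proof.
move=> cyc A0 a0 a2 exH; rewrite ltNge; apply/negP => lam1.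
have m1 := m2star_ge1 cyc.
have m0 : 0 < m2star R H by apply: lt_le_trans m1.
have b0 : 0 < 2 - alpha by rewrite subr_gt0.
pose be := (2 - alpha)^-1; have be0 : 0 < be by rewrite /be; pos.
have bem : be <= m2star R H.
  move: lam1; rewrite /lambdastar ler_pdivrMr ?mulr_gt0 // mul1r => h.
  by rewrite /be -[leLHS]mul1r ler_pdivrMr.
have [U0 [U0H U02 U0be]] := m2star_attained cyc be0 bem.
pose d (U : graph V) : R := (#|U|%:R - 1) / (#|cov U|%:R - 2).
pose P (U : graph V) := (U \subset H) && (2 <= #|U|)%N.
have P0 : P U0 by rewrite /P U0H.
have [Um Pm dm] := @Order.TotalTheory.arg_maxP _ R _ U0 P d P0.
pose P' (U : graph V) := P U && (d Um <= d U).
have P'm : P' Um by rewrite /P' Pm lexx.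
(* Fewest edges among the densest subgraphs: every proper edge subset of [S] with at least two edges
   is then strictly sparser, as [Slt] requires. *)
have [S /andP[/andP[SH S2] dS] Smin] := @arg_minnP _ Um P' (fun U => #|U|) P'm.
have cpos (U : graph V) : (2 <= #|U|)%N -> 0 < #|cov U|%:R - 2 :> R.
  by move=> U2; rewrite subr_gt0 ltr_nat cov_gt2.
pose mu := d S.
have mumax U : P U -> d U <= mu by move=> /dm; move/le_trans; apply.
have muE : #|S|%:R - 1 = mu * (#|cov S|%:R - 2).
  by rewrite /mu /d divfK // gt_eqF // cpos.
have mube : be <= mu.
  apply: le_trans (mumax _ P0).
  by rewrite /d ler_pdivlMr // cpos.
have mu1 : 1 < mu.
  have [U [UH cU U3]] := cycle_subgraph cyc.
  have PU : P U by rewrite /P UH ltnW.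
  apply: lt_le_trans (mumax _ PU); rewrite /d ltr_pdivlMr ?cpos ?(ltnW U3) // mul1r.
  have : #|cov U|%:R <= #|U|%:R :> R by rewrite ler_nat.
  lra.
have mu0 : 0 < mu by apply: lt_trans mu1.
(* Two edges cover at least three vertices, so their density is at most 1, whereas the cycle forces
   mu > 1. *)
have S3 : (3 <= #|S|)%N.
  rewrite ltn_neqAle S2 andbT; apply/negP => /eqP SE.
  have : 3 <= #|cov S|%:R :> R by rewrite ler_nat cov_gt2.
  move: muE mu1; rewrite -SE => muE mu1 c3.
  have : 1 * (#|cov S|%:R - 2) < mu * (#|cov S|%:R - 2) by rewrite ltr_pM2r // cpos.
  by rewrite -muE; lra.
have Slt (U : graph V) : U \subset S -> (2 <= #|U|)%N -> U != S ->
    #|U|%:R - 1 < mu * (#|cov U|%:R - 2).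
  move=> US U2 UneS; rewrite -ltr_pdivrMr ?cpos // -/(d U) ltNge; apply/negP => h.
  have UH := subset_trans US SH.
  have : P' U by rewrite /P' /P UH U2 (le_trans dS).
  move/Smin; rewrite leqNgt; apply/negP; rewrite negbK.
  by apply: proper_card; rewrite properEneq UneS.
have [n [n1 [I [Ibig Ifree]]]] := dense_free_graph mu0 S3 muE Slt A0.
have : is_free H I.
  apply/negPn/negP => /is_freePn[f [fi sub]]; have := Ifree f fi; apply/negP.
  by rewrite negbK; apply: subset_trans sub; apply: imsetS.
move/(free_le (exH n)); rewrite leNgt => /negP; apply.
apply: le_lt_trans Ibig; rewrite ler_pM2l //; apply: ler_powR; first by rewrite ler1n.
have : mu^-1 <= 2 - alpha by rewrite -[leRHS]invrK lef_pV2 ?posrE ?invr_gt0.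
lra.
Qed.

End LambdaGt1.
Theorem theorem4p8 (R : realType) (V : finType) (H : graph V) (A alpha : R)
    (bipH : bipartite H) (cycH : has_cycle H) (goodH : ES_good alpha H)
    (A_gt0 : 0 < A) (alpha_gt0 : 0 < alpha) (alpha_lt2 : alpha < 2)
    (exH : forall n : nat, (turan n H)%:R <= A * n%:R `^ alpha) :
  let phi := phi alpha H in
  let lambda := lambdastar alpha H in
  exists2 C : R, 0 < C & exists n0 : nat,
  forall n : nat, (n0 <= n)%N -> forall k : R, 0 < k ->
  k <= n%:R `^ (phi / (lambda - 1)) / ln n%:R `^ (2 / (lambda - 1)) ->
  exists (S : {fset colored_graph 'I_n})
         (g : graph 'I_n -> colored_graph 'I_n)
         (h : colored_graph 'I_n -> graph 'I_n),
  [/\ forall J, J \in S ->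
        #|uncolor J|%:R <= C * k `^ (1 - lambda) * n%:R `^ alpha,
      forall I, is_free H I -> g I \in S,
      forall J, J \in S -> #|h J|%:R <= k * n%:R `^ alpha,
      forall s : nat, (1 <= s)%N ->
        #|` [fset J in S | #|uncolor J| == s]%fset |%:R <=
          (C * n%:R `^ alpha / s%:R) `^ (lambda / (lambda - 1) * s%:R) *
          expR (C * k `^ (1 - lambda) * n%:R `^ alpha) &
      forall I, is_free H I ->
        uncolor (g I) \subset I /\
        I \subset (h (g I) :|: uncolor (g I))%SET].
Proof.
move=> phi lambda; apply: (main_case A_gt0 alpha_gt0) => //.
- exact: lambdastar_gt1 cycH A_gt0 alpha_gt0 alpha_lt2 exH.
- have [U [UH _ U3]] := cycle_subgraph cycH.
  by apply: leq_trans (subset_leq_card UH); apply: ltnW.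
exact: m2star_ge1.
Qed.
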